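(* Let $\mathbb{T}$ be a time scale with $\sup\mathbb{T}=+\infty$ and $\bar\mu_\mathbb{T}<+\infty$, and let $A=(a_{ij})\in\mathbb{R}^{n\times n}$, $b=(b_1,\dots,b_n)^T\in\mathbb{R}^n$ be such that the single-input system $x^\Delta=Ax+bu$ on $\mathbb{T}$ is positive. Let $k=\operatorname{rank}[b,Ab,\dots,A^{n-1}b]$, let $a_1,\dots,a_k\in\mathbb{R}$ satisfy $A^kb=-a_1b-a_2Ab-\dots-a_kA^{k-1}b$, and for $i=0,\dots,k-1$ set $v_{k-i}:=A^ib+a_kA^{i-1}b+\dots+a_{k-i+1}b$ (so $v_k=b$). For $j=1,\dots,n$ let $\alpha_j$ be the maximum of the numbers $-a_{ij}/b_i$ over $i\ne j$ with $b_i\neq0$, together with the number $(-a_{jj}-\gamma(\mathbb{T}))/b_j$ if $b_j\ne0$ and $\gamma(\mathbb{T})<+\infty$ (with $\alpha_j=-\infty$ if there are no such numbers). Then the system is positively stabilizable if and only if (1) for every $\lambda\in\operatorname{spec}(A)$ with $\lambda\notin\mathcal{S}_\mathbb{T}$ one has $\operatorname{rank}[\lambda I-A,\ b]=n$, and (2) there exists a row vector $K=(k_1,\dots,k_n)\in\mathbb{R}^{1\times n}$ with $k_j\ge\alpha_j$ for $j=1,\dots,n$ and $Kv_i<a_i$ for $i=1,\dots,k$.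
   Context: $\mathbb{T}$ is a time scale (closed nonempty subset of $\mathbb{R}$) with graininess $\mu_\mathbb{T}(t)=\inf\{s\in\mathbb{T}:s>t\}-t$, $\bar\mu_\mathbb{T}=\sup_t\mu_\mathbb{T}(t)$, $\gamma(\mathbb{T})=1/\bar\mu_\mathbb{T}\in(0,+\infty]$ (with $1/0=+\infty$); $x^\Delta$ is the delta derivative. The control system is positive if for every $t_0\in\mathbb{T}$, every piecewise continuous control with values in $\mathbb{R}_+$ and every initial state in $\mathbb{R}^n_+$, the trajectory stays in $\mathbb{R}^n_+$. An autonomous system $x^\Delta=Mx$ is positive if trajectories from $\mathbb{R}^n_+$ stay in $\mathbb{R}^n_+$; it is uniformly exponentially stable (resp. positively uniformly exponentially stable) if there exist $K\ge1,\alpha>0$ and an open neighborhood $V$ of $0$ with $\|x(t)\|\le Ke^{-\alpha(t-t_0)}\|x_0\|$ for all $t_0\le t$ in $\mathbb{T}$ and all $x_0\in V$ (resp. $x_0\in V\cap\mathbb{R}^n_+$). The system is positively stabilizable if there is a row vector $K$ such that $x^\Delta=(A+bK)x$ is positive and positively uniformly exponentially stable. $\mathcal{S}_\mathbb{T}$ is the set of $\lambda\in\mathbb{C}$ for which $x^\Delta=\lambda x$ is uniformly exponentially stable. *)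

(* Defs.v *)
From Stdlib Require Import Reals List.
Import ListNotations.
Open Scope R_scope.

(* vectors of R^n : nat -> R (coordinates 0..n-1); matrices: nat -> nat -> R *)
Fixpoint rsum (m : nat) (f : nat -> R) : R :=
  match m with O => 0 | S p => rsum p f + f p end.

Definition mv (n : nat) (M : nat -> nat -> R) (x : nat -> R) : nat -> R :=
  fun i => rsum n (fun j => M i j * x j).

Fixpoint Apow (n : nat) (A : nat -> nat -> R) (i : nat) (b : nat -> R) : nat -> R :=
  match i with O => b | S p => mv n A (Apow n A p b) end.

Definition vnorm (n : nat) (x : nat -> R) : R := sqrt (rsum n (fun i => x i ^ 2)).

Definition nonneg_vec (n : nat) (x : nat -> R) : Prop :=
  forall i, (i < n)%nat -> 0 <= x i.

(* open subset of R^n containing ... (only the first n coordinates count) *)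
Definition open_Rn (n : nat) (V : (nat -> R) -> Prop) : Prop :=
  forall x, V x -> exists r, 0 < r /\
    forall y, vnorm n (fun i => y i - x i) < r -> V y.

Definition C := (R * R)%type.
Definition C0 : C := (0, 0).
Definition RtoC (r : R) : C := (r, 0).
Definition Cadd (z w : C) : C := (fst z + fst w, snd z + snd w).
Definition Cmul (z w : C) : C :=
  (fst z * fst w - snd z * snd w, fst z * snd w + snd z * fst w).
Definition Cnorm (z : C) : R := sqrt (fst z ^ 2 + snd z ^ 2).
Definition Csum_list {X} (l : list X) (f : X -> C) : C :=
  fold_right (fun j acc => Cadd (f j) acc) C0 l.
Definition open_C (V : C -> Prop) : Prop :=
  forall z, V z -> exists r, 0 < r /\
    forall w, Cnorm (fst w - fst z, snd w - snd z) < r -> V w.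

Definition rsum_list (l : list nat) (f : nat -> R) : R :=
  fold_right (fun j acc => f j + acc) 0 l.

Definition indep_cols_R (rows cols : nat) (M : nat -> nat -> R) (l : list nat) : Prop :=
  NoDup l /\ (forall j, In j l -> (j < cols)%nat) /\
  forall c : nat -> R,
    (forall i, (i < rows)%nat -> rsum_list l (fun j => c j * M i j) = 0) ->
    forall j, In j l -> c j = 0.

Definition rank_R (rows cols : nat) (M : nat -> nat -> R) (r : nat) : Prop :=
  (exists l, length l = r /\ indep_cols_R rows cols M l) /\
  (forall l, indep_cols_R rows cols M l -> (length l <= r)%nat).

Definition indep_cols_C (rows cols : nat) (M : nat -> nat -> C) (l : list nat) : Prop :=
  NoDup l /\ (forall j, In j l -> (j < cols)%nat) /\
  forall c : nat -> C,
    (forall i, (i < rows)%nat -> Csum_list l (fun j => Cmul (c j) (M i j)) = C0) ->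
    forall j, In j l -> c j = C0.

Definition rank_C (rows cols : nat) (M : nat -> nat -> C) (r : nat) : Prop :=
  (exists l, length l = r /\ indep_cols_C rows cols M l) /\
  (forall l, indep_cols_C rows cols M l -> (length l <= r)%nat).

Definition in_spec (n : nat) (A : nat -> nat -> R) (lam : C) : Prop :=
  exists v : nat -> C, (exists i, (i < n)%nat /\ v i <> C0) /\
    forall i, (i < n)%nat ->
      Csum_list (seq 0 n) (fun j => Cmul (RtoC (A i j)) (v j)) = Cmul lam (v i).

Definition augm (n : nat) (A : nat -> nat -> R) (b : nat -> R) (lam : C)
  : nat -> nat -> C :=
  fun i j => if Nat.ltb j n then
               (if Nat.eqb i j then Cadd lam (RtoC (- A i j)) else RtoC (- A i j))
             else RtoC (b i).

Definition closed_set (T : R -> Prop) : Prop :=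
  forall t, (forall eps, 0 < eps -> exists s, T s /\ Rabs (s - t) < eps) -> T t.
Definition is_time_scale (T : R -> Prop) : Prop := (exists t, T t) /\ closed_set T.
Definition unbounded_above (T : R -> Prop) : Prop := forall M, exists t, T t /\ M < t.

Definition is_glb (E : R -> Prop) (m : R) : Prop :=
  (forall x, E x -> m <= x) /\ (forall m', (forall x, E x -> m' <= x) -> m' <= m).

Definition forward_jump (T : R -> Prop) (t s : R) : Prop :=
  ((exists r, T r /\ t < r) /\ is_glb (fun r => T r /\ t < r) s) \/
  (~ (exists r, T r /\ t < r) /\ s = t).

Definition graininess (T : R -> Prop) (t m : R) : Prop :=
  exists s, forward_jump T t s /\ m = s - t.

Definition grain_set (T : R -> Prop) (m : R) : Prop := exists t, T t /\ graininess T t m.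

Definition right_dense (T : R -> Prop) (t : R) : Prop := forward_jump T t t.

Definition delta_deriv (T : R -> Prop) (f : R -> R) (t D : R) : Prop :=
  exists s, forward_jump T t s /\
    forall eps, 0 < eps -> exists d, 0 < d /\
      forall r, T r -> Rabs (t - r) < d ->
        Rabs (f s - f r - D * (s - r)) <= eps * Rabs (s - r).

Definition restrict (T : R -> Prop) (t0 : R) : R -> Prop := fun t => T t /\ t0 <= t.

Definition cont_on (S : R -> Prop) (f : R -> R) (t : R) : Prop :=
  forall eps, 0 < eps -> exists d, 0 < d /\
    forall s, S s -> Rabs (s - t) < d -> Rabs (f s - f t) < eps.

Definition lim_right (T : R -> Prop) (f : R -> R) (t l : R) : Prop :=
  forall eps, 0 < eps -> exists d, 0 < d /\
    forall s, T s -> t < s < t + d -> Rabs (f s - l) < eps.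
Definition lim_left (T : R -> Prop) (f : R -> R) (t l : R) : Prop :=
  forall eps, 0 < eps -> exists d, 0 < d /\
    forall s, T s -> t - d < s < t -> Rabs (f s - l) < eps.

Definition piecewise_cont (T : R -> Prop) (u : R -> R) : Prop :=
  (forall a c, exists l : list R, forall t, T t -> a <= t <= c -> ~ In t l -> cont_on T u t) /\
  (forall t, T t -> (exists l, lim_right T u t l) /\ (exists l, lim_left T u t l)).

Definition ctrl_solution (T : R -> Prop) (n : nat) (A : nat -> nat -> R) (b : nat -> R)
  (u : R -> R) (t0 : R) (x0 : nat -> R) (x : R -> nat -> R) : Prop :=
  (forall i, (i < n)%nat -> x t0 i = x0 i) /\
  (forall i, (i < n)%nat -> forall t, restrict T t0 t -> cont_on (restrict T t0) (fun s => x s i) t) /\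
  (forall t, restrict T t0 t -> (~ right_dense T t \/ cont_on T u t) ->
     forall i, (i < n)%nat ->
       delta_deriv (restrict T t0) (fun s => x s i) t (mv n A (x t) i + b i * u t)).

Definition positive_ctrl (T : R -> Prop) (n : nat) (A : nat -> nat -> R) (b : nat -> R) : Prop :=
  forall t0 (u : R -> R) x0 x, T t0 -> piecewise_cont T u -> (forall t, T t -> 0 <= u t) ->
    nonneg_vec n x0 -> ctrl_solution T n A b u t0 x0 x ->
    forall t, T t -> t0 <= t -> nonneg_vec n (x t).

Definition auto_solution (T : R -> Prop) (n : nat) (M : nat -> nat -> R)
  (t0 : R) (x0 : nat -> R) (x : R -> nat -> R) : Prop :=
  (forall i, (i < n)%nat -> x t0 i = x0 i) /\
  (forall t, restrict T t0 t -> forall i, (i < n)%nat ->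
     delta_deriv (restrict T t0) (fun s => x s i) t (mv n M (x t) i)).

Definition positive_auto (T : R -> Prop) (n : nat) (M : nat -> nat -> R) : Prop :=
  forall t0 x0 x, T t0 -> nonneg_vec n x0 -> auto_solution T n M t0 x0 x ->
    forall t, T t -> t0 <= t -> nonneg_vec n (x t).

Definition pos_UES (T : R -> Prop) (n : nat) (M : nat -> nat -> R) : Prop :=
  exists (K al : R) (V : (nat -> R) -> Prop),
    1 <= K /\ 0 < al /\ open_Rn n V /\ V (fun _ => 0) /\
    forall t0 t x0 x, T t0 -> T t -> t0 <= t -> V x0 -> nonneg_vec n x0 ->
      auto_solution T n M t0 x0 x ->
      vnorm n (x t) <= K * exp (- (al * (t - t0))) * vnorm n x0.

Definition pos_stabilizable (T : R -> Prop) (n : nat) (A : nat -> nat -> R) (b : nat -> R) : Prop :=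
  exists K : nat -> R,
    positive_auto T n (fun i j => A i j + b i * K j) /\
    pos_UES T n (fun i j => A i j + b i * K j).

Definition C_solution (T : R -> Prop) (lam : C) (t0 : R) (z0 : C) (z : R -> C) : Prop :=
  z t0 = z0 /\
  forall t, restrict T t0 t ->
    delta_deriv (restrict T t0) (fun s => fst (z s)) t (fst (Cmul lam (z t))) /\
    delta_deriv (restrict T t0) (fun s => snd (z s)) t (snd (Cmul lam (z t))).

Definition in_S (T : R -> Prop) (lam : C) : Prop :=
  exists (K al : R) (V : C -> Prop),
    1 <= K /\ 0 < al /\ open_C V /\ V C0 /\
    forall t0 t z0 z, T t0 -> T t -> t0 <= t -> V z0 -> C_solution T lam t0 z0 z ->
      Cnorm (z t) <= K * exp (- (al * (t - t0))) * Cnorm z0.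

(* extended reals below: None = -oo *)
Definition max_list (l : list R) : option R :=
  fold_right (fun x acc => match acc with None => Some x | Some y => Some (Rmax x y) end) None l.

Definition ge_ext (x : R) (a : option R) : Prop :=
  match a with None => True | Some y => y <= x end.

(* alpha_j (j in 0..n-1); mub = mu_bar, gamma = 1/mub, gamma < +oo iff mub <> 0 *)
Definition alpha (n : nat) (A : nat -> nat -> R) (b : nat -> R) (mub : R) (j : nat) : option R :=
  max_list
    (flat_map (fun i => if Nat.eq_dec i j then []
                        else if Req_dec_T (b i) 0 then [] else [(- A i j) / b i]) (seq 0 n)
     ++ (if Req_dec_T (b j) 0 then []
         else if Req_dec_T mub 0 then [] else [(- A j j - / mub) / b j])).

Definition vvec (n : nat) (A : nat -> nat -> R) (b : nat -> R) (a : nat -> R) (k m : nat)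
  : nat -> R :=
  fun r => let i := (k - m)%nat in
    Apow n A i b r + rsum i (fun l => a (k - l)%nat * Apow n A (i - 1 - l) b r).

(* Main.v *)
(** A gain [K] turns the system into [x^Delta = M x] with [M = A + b K], which is positive iff [M] is
    Metzler and [1 + mub * M j j >= 0]; these are the inequalities [K j >= alpha j].  A positive
    system is positively uniformly exponentially stable iff there is a row vector [w > 0] with
    [w M < 0] (then [w x] decays exponentially), and for a Metzler matrix such a [w] exists iff no
    real [lam >= 0] is an eigenvalue of [M].

    Sufficiency: let [w M = lam w] with [lam >= 0].  If [w b = 0] then [lam] is an uncontrollable
    eigenvalue of [A] outside [S_T], against (1).  Otherwise [M v_(m+1) = v_m - (a_(m+1) - K v_(m+1)) b]
    with [v_k = b] and [v_0 = 0] makes all [w v_m / w b] positive, which is absurd for [m = 0].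

    Necessity: an uncontrollable [lam] is a left eigenvalue of every [M], so a linear form of a decaying
    solution solves [z^Delta = lam z] and [lam] lies in [S_T].  The numbers [a_m - K v_m] are the
    coefficients of a monic polynomial whose roots are eigenvalues of [M], hence have negative real
    part, and such a real polynomial has positive coefficients.

    Solutions exist as series [sum_k h_k(t) M^k x0] in the monomials [h_k] of the time scale, and all
    comparison arguments are instances of one exponential barrier lemma. *)

From Stdlib Require Import Reals RList List Lra Lia Classical ClassicalEpsilon.
From Coquelicot Require Coquelicot.
From mathcomp Require all_boot all_order all_algebra Rstruct complex polyrcf zify ring.
Require Import Defs.
Open Scope R_scope.

(** * Finite sums *)

(** Positivity and stability quantify over all solutions and would hold vacuously without any, so
    reading inequalities on [M] off these properties requires existence on an arbitrary closed set.
    The time-scale exponential is never constructed: solutions are compared with the ordinary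
    exponential, for which [1 + x <= exp x] is what a jump needs. The set [S_T] is never computed
    either; only two facts about it enter, namely that no real [lam >= 0] belongs to it and that the
    eigenvalue of a left eigenvector of a stable loop does. Linear certificates [w] take the place
    of Perron-Frobenius theory: the derivative of [w x] is linear in [x], so the one inequality
    [w M < 0] serves dense points and jumps alike. Left eigenvectors are preferred throughout, since
    they turn a solution into a scalar equation and, when orthogonal to [b], do not see the gain. *)

Lemma rsum_ext (m : nat) (f g : nat -> R) :
  (forall i, (i < m)%nat -> f i = g i) -> rsum m f = rsum m g.
Proof.
  induction m as [|m IH]; intros H; simpl; [reflexivity|].
  rewrite IH by (intros; apply H; lia); rewrite H by lia; reflexivity.
Qed.

Lemma rsum_plus (m : nat) (f g : nat -> R) :
  rsum m (fun i => f i + g i) = rsum m f + rsum m g.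
Proof. induction m as [|m IH]; simpl; [ring|rewrite IH; ring]. Qed.

Lemma rsum_scal_l (m : nat) (c : R) (f : nat -> R) :
  rsum m (fun i => c * f i) = c * rsum m f.
Proof. induction m as [|m IH]; simpl; [ring|rewrite IH; ring]. Qed.

Lemma rsum_zero (m : nat) (f : nat -> R) :
  (forall i, (i < m)%nat -> f i = 0) -> rsum m f = 0.
Proof.
  intros H; rewrite (rsum_ext m f (fun i => 0 * 0)) by (intros; rewrite H; trivial; ring).
  rewrite rsum_scal_l; ring.
Qed.

Lemma rsum_le (m : nat) (f g : nat -> R) :
  (forall i, (i < m)%nat -> f i <= g i) -> rsum m f <= rsum m g.
Proof.
  induction m as [|m IH]; intros H; simpl; [lra|].
  apply Rplus_le_compat; [apply IH; intros; apply H; lia|apply H; lia].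
Qed.

Lemma rsum_ge0 (m : nat) (f : nat -> R) :
  (forall i, (i < m)%nat -> 0 <= f i) -> 0 <= rsum m f.
Proof. intros H; rewrite <- (rsum_zero m (fun _ => 0)) by trivial; now apply rsum_le. Qed.

Lemma rsum_abs (m : nat) (f : nat -> R) : Rabs (rsum m f) <= rsum m (fun i => Rabs (f i)).
Proof.
  induction m as [|m IH]; simpl; [rewrite Rabs_R0; lra|].
  apply Rle_trans with (1 := Rabs_triang _ _); lra.
Qed.

Lemma rsum_term_le (m : nat) (f : nat -> R) (i : nat) :
  (forall j, (j < m)%nat -> 0 <= f j) -> (i < m)%nat -> f i <= rsum m f.
Proof.
  induction m as [|m IH]; intros H Hi; [lia|]; simpl.
  assert (0 <= f m) by (apply H; lia).
  assert (0 <= rsum m f) by (apply rsum_ge0; intros; apply H; lia).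
  destruct (Nat.eq_dec i m) as [->|Hne]; [lra|].
  assert (f i <= rsum m f) by (apply IH; [intros; apply H; lia|lia]); lra.
Qed.

Lemma rsum_exchange (m p : nat) (f : nat -> nat -> R) :
  rsum m (fun i => rsum p (fun j => f i j)) = rsum p (fun j => rsum m (fun i => f i j)).
Proof.
  induction m as [|m IH]; simpl; [rewrite rsum_zero; trivial|].
  rewrite IH, <- rsum_plus; reflexivity.
Qed.

Lemma rsum_delta (m j : nat) (f : nat -> R) : (j < m)%nat ->
  rsum m (fun i => f i * (if Nat.eq_dec i j then 1 else 0)) = f j.
Proof.
  induction m as [|m IH]; intros Hj; [lia|]; simpl.
  destruct (Nat.eq_dec m j) as [->|Hne].
  - rewrite rsum_zero; [ring|].
    intros i Hi; destruct (Nat.eq_dec i j); [lia|ring].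
  - rewrite IH by lia; ring.
Qed.

Lemma rsum_ge_term (m : nat) (f : nat -> R) (i : nat) :
  (forall j, (j < m)%nat -> j <> i -> 0 <= f j) -> (i < m)%nat -> f i <= rsum m f.
Proof.
  induction m as [|m IH]; intros H Hi; [lia|]; simpl.
  destruct (Nat.eq_dec i m) as [->|Hne].
  - assert (0 <= rsum m f) by (apply rsum_ge0; intros; apply H; lia); lra.
  - assert (0 <= f m) by (apply H; lia).
    assert (f i <= rsum m f) by (apply IH; [intros; apply H; lia|lia]); lra.
Qed.

Lemma rsum_head (m : nat) (f : nat -> R) : rsum (S m) f = f 0%nat + rsum m (fun i => f (S i)).
Proof.
  induction m as [|m IH]; [simpl; ring|].
  change (rsum (S (S m)) f) with (rsum (S m) f + f (S m)); rewrite IH; simpl; ring.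
Qed.

Lemma rsum_rev (m : nat) (f : nat -> R) : rsum m (fun l => f (m - 1 - l)%nat) = rsum m f.
Proof.
  induction m as [|m IH]; [reflexivity|].
  rewrite rsum_head; simpl rsum at 2; rewrite <- IH, Rplus_comm.
  f_equal; [apply rsum_ext; intros i Hi|]; f_equal; lia.
Qed.

(** * Time scales *)

Lemma exp_le_compat (x y : R) : x <= y -> exp x <= exp y.
Proof.
  intros [H| ->]; [left; now apply exp_increasing|apply Rle_refl].
Qed.

Lemma forward_jump_exists (X : R -> Prop) (t : R) : exists s, forward_jump X t s.
Proof.
  destruct (classic (exists r, X r /\ t < r)) as [He|Hn]; [|exists t; now right].
  destruct (completeness (fun m => forall x, X x /\ t < x -> m <= x)) as [s [Hub Hl]].
  - destruct He as [r Hr]; exists r; intros m Hm; now apply Hm.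
  - exists t; intros x [_ Hx]; lra.
  - exists s; left; split; trivial; split.
    + intros x Hx; apply Hl; intros m Hm; now apply Hm.
    + exact Hub.
Qed.

Lemma forward_jump_ge (X : R -> Prop) (t s : R) : forward_jump X t s -> t <= s.
Proof.
  intros [[_ [_ Hg]]|[_ ->]]; [|lra].
  apply Hg; intros x [_ Hx]; lra.
Qed.

Lemma forward_jump_gap (X : R -> Prop) (t s r : R) :
  forward_jump X t s -> X r -> t < r -> s <= r.
Proof.
  intros [[_ [Hl _]]|[Hn _]] Hr Htr; [apply Hl; now split|].
  exfalso; apply Hn; now exists r.
Qed.

Lemma forward_jump_in (X : R -> Prop) (t s : R) :
  closed_set X -> X t -> forward_jump X t s -> X s.
Proof.
  intros Hc Ht [[_ [Hl Hg]]|[_ ->]]; [|exact Ht].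
  apply Hc; intros eps Heps; apply NNPP; intros Hno.
  assert (s + eps <= s); [|lra].
  apply Hg; intros x [Hx Htx]; apply Rnot_lt_le; intros Hlt; apply Hno; exists x; split; trivial.
  assert (s <= x) by (apply Hl; now split).
  rewrite Rabs_pos_eq; lra.
Qed.

Lemma closed_restrict (T : R -> Prop) (t0 : R) : closed_set T -> closed_set (restrict T t0).
Proof.
  intros Hc t Ht; split.
  - apply Hc; intros eps Heps; destruct (Ht eps Heps) as [s [[Hs _] Hd]]; now exists s.
  - apply Rnot_lt_le; intros Hlt; destruct (Ht (t0 - t)) as [s [[_ Hs] Hd]]; [lra|].
    apply Rabs_def2 in Hd; lra.
Qed.

(** * Existence of solutions *)

(** Geometric growth with ratio [L] is what the solution series has to absorb. The sum of the
    absolute entries is increased by 1 so that [L > 0] even for the zero matrix and [2 * L] can be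
    divided by. *)
Lemma Apow_bound (n : nat) (M : nat -> nat -> R) (x0 : nat -> R) :
  exists L C, 0 < L /\ 0 <= C /\
    forall k i, (i < n)%nat -> Rabs (Apow n M k x0 i) <= C * L ^ k.
Proof.
  exists (1 + rsum n (fun i => rsum n (fun j => Rabs (M i j)))), (rsum n (fun j => Rabs (x0 j))).
  set (L := 1 + _); set (C := rsum n (fun j => Rabs (x0 j))).
  assert (HL : 1 <= L).
  { unfold L; assert (0 <= rsum n (fun i => rsum n (fun j => Rabs (M i j)))); [|lra].
    apply rsum_ge0; intros; apply rsum_ge0; intros; apply Rabs_pos. }
  assert (HC : 0 <= C) by (apply rsum_ge0; intros; apply Rabs_pos).
  repeat split; [lra|exact HC|].
  induction k as [|k IH]; intros i Hi; simpl.
  - rewrite Rmult_1_r.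
    apply (rsum_term_le n (fun j => Rabs (x0 j))); trivial; intros; apply Rabs_pos.
  - unfold mv; apply Rle_trans with (1 := rsum_abs _ _).
    assert (HLk : 0 <= C * L ^ k) by (apply Rmult_le_pos; [lra|apply pow_le; lra]).
    apply Rle_trans with (rsum n (fun j => C * L ^ k * Rabs (M i j))).
    + apply rsum_le; intros j Hj; rewrite Rabs_mult, Rmult_comm.
      apply Rmult_le_compat_r; [apply Rabs_pos|now apply IH].
    + rewrite rsum_scal_l.
      replace (C * (L * L ^ k)) with (C * L ^ k * L) by ring.
      apply Rmult_le_compat_l; trivial.
      apply Rle_trans with (rsum n (fun i => rsum n (fun j => Rabs (M i j)))); [|unfold L; lra].
      apply (rsum_term_le n (fun i => rsum n (fun j => Rabs (M i j)))); trivial.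
      intros; apply rsum_ge0; intros; apply Rabs_pos.
Qed.

Module Existence.
Import Coquelicot.Coquelicot.
Import Defs.

(** A monotone [f] frozen at the left end of each cell of width [h] errs there by at most its
    increment over the cell; these increments telescope in the integral of the error bound [psi]. *)
Lemma step_enclosure_monotone (f : R -> R) (h : R) (N : nat) (a : R) :
  0 < h -> (forall x y, x <= y -> f x <= f y) ->
  exists (phi psi : R -> R) (p1 : IsStepFun phi a (a + INR N * h))
         (p2 : IsStepFun psi a (a + INR N * h)),
    (forall t, a <= t <= a + INR N * h -> Rabs (f t - phi t) <= psi t) /\
    RiemannInt_SF (mkStepFun p2) = h * (f (a + INR N * h) - f a).
Proof.
  intros Hh Hf; induction N as [|N IH].
  - exists (fct_cte (f a)), (fct_cte 0), (StepFun_P4 _ _ _), (StepFun_P4 _ _ _); split.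
    + intros t Ht; simpl in Ht; unfold fct_cte.
      replace t with a by lra.
      replace (f a - f a) with 0 by ring; rewrite Rabs_R0; lra.
    + rewrite StepFun_P18; simpl.
      replace (a + 0 * h) with a by ring; ring.
  - destruct IH as (phi & psi & p1 & p2 & Hphi & Hint).
    set (c := a + INR N * h) in *.
    assert (Ed : a + INR (S N) * h = c + h) by (unfold c; rewrite S_INR; ring).
    assert (Hac : a <= c) by (unfold c; assert (0 <= INR N) by apply pos_INR; nra).
    rewrite Ed.
    set (phi' := fun t => if Rle_dec t c then phi t else f c).
    set (psi' := fun t => if Rle_dec t c then psi t else f (c + h) - f c).
    assert (agree_l : forall g v, IsStepFun g a c ->
      IsStepFun (fun t => if Rle_dec t c then g t else v) a c).
    { intros g v [l [l0 Had]]; exists l, l0.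
      destruct Had as (H1 & H2 & H3 & H4 & H5); repeat split; auto.
      intros i Hi x Hx.
      destruct (Rle_dec x c) as [_|Hn]; [now apply (H5 i Hi)|].
      exfalso; apply Hn; unfold open_interval in Hx.
      apply Rle_trans with (pos_Rl l (S i)); [lra|].
      rewrite Rmax_right in H3 by lra; rewrite <- H3.
      apply (proj1 (RList_P6 l) H1); lia. }
    assert (agree_r : forall g v,
      IsStepFun (fun t => if Rle_dec t c then g t else v) c (c + h)).
    { intros g v.
      exists (c :: (c + h) :: nil), (v :: nil); repeat split.
      - intros i Hi; simpl in Hi; replace i with 0%nat by lia; simpl; lra.
      - simpl; rewrite Rmin_left; lra.
      - simpl; rewrite Rmax_right; lra.
      - intros i Hi x Hx; simpl in Hi; replace i with 0%nat in * by lia.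
        unfold open_interval in Hx; simpl in Hx; simpl.
        destruct (Rle_dec x c); [lra|reflexivity]. }
    pose proof (agree_l phi (f c) p1) as q1.
    pose proof (agree_r phi (f c)) as q2.
    pose proof (agree_l psi (f (c + h) - f c) p2) as r1.
    pose proof (agree_r psi (f (c + h) - f c)) as r2.
    assert (Hch : c <= c + h) by lra.
    exists phi', psi', (StepFun_P41 Hac Hch q1 q2), (StepFun_P41 Hac Hch r1 r2); split.
    + intros t Ht; unfold phi', psi'.
      destruct (Rle_dec t c) as [Hl|Hn]; [apply Hphi; lra|].
      assert (f c <= f t) by (apply Hf; lra).
      assert (f t <= f (c + h)) by (apply Hf; lra).
      rewrite Rabs_pos_eq; lra.
    + rewrite <- (StepFun_P43 r1 r2).
      assert (E1 : RiemannInt_SF (mkStepFun r1) = RiemannInt_SF (mkStepFun p2)).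
      { apply Rle_antisym; apply StepFun_P37; trivial; intros x Hx; simpl;
          destruct (Rle_dec x c); lra. }
      assert (E2 : RiemannInt_SF (mkStepFun r2) = (f (c + h) - f c) * h).
      { transitivity (RiemannInt_SF (mkStepFun (StepFun_P4 c (c + h) (f (c + h) - f c)))).
        - apply Rle_antisym; apply StepFun_P37; trivial; intros x Hx; simpl; unfold fct_cte;
            destruct (Rle_dec x c); lra.
        - rewrite StepFun_P18; ring. }
      rewrite E1, E2, Hint; ring.
Qed.

Lemma ex_RInt_monotone (f : R -> R) (a b : R) :
  (forall x y, x <= y -> f x <= f y) -> ex_RInt f a b.
Proof.
  intros Hf.
  assert (main : forall a b, a <= b -> ex_RInt f a b).
  { clear a b; intros a b [Hab| ->]; [|apply ex_RInt_point].
    apply ex_RInt_Reals_1; intros eps.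
    pose proof (Hf a b (Rlt_le _ _ Hab)) as Hfab.
    (* As [N > q], a subdivision into [S N] cells makes the error [h * (f b - f a)] smaller than
       [eps]; [S N] avoids a division by 0. *)
    set (q := (b - a) * (f b - f a) / eps).
    assert (He := cond_pos eps).
    (* [Riemann_integrable] asks for witnesses in [Type], so the existentials are opened by
       description. *)
    destruct (constructive_indefinite_description _ (INR_unbounded q)) as [N HN].
    set (h := (b - a) / INR (S N)).
    assert (HN0 : 0 < INR (S N)) by (apply lt_0_INR; lia).
    assert (Hh : 0 < h) by (apply Rdiv_lt_0_compat; lra).
    assert (Eb : a + INR (S N) * h = b) by (unfold h; field; lra).
    pose proof (step_enclosure_monotone f h (S N) a Hh Hf) as HH.
    rewrite Eb in HH.
    apply constructive_indefinite_description in HH; destruct HH as [phi HH].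
    apply constructive_indefinite_description in HH; destruct HH as [psi HH].
    apply constructive_indefinite_description in HH; destruct HH as [p1 HH].
    apply constructive_indefinite_description in HH; destruct HH as [p2 [H1 H2]].
    exists (mkStepFun p1), (mkStepFun p2); split.
    - intros t; rewrite Rmin_left, Rmax_right by lra; apply H1.
    - rewrite H2, Rabs_pos_eq by (apply Rmult_le_pos; lra).
      unfold h, q in *.
      rewrite S_INR in *.
      apply Rmult_lt_reg_r with ((INR N + 1) / eps); [apply Rdiv_lt_0_compat; lra|].
      replace ((b - a) / (INR N + 1) * (f b - f a) * ((INR N + 1) / eps))
        with ((b - a) * (f b - f a) / eps) by (field; lra).
      replace (eps * ((INR N + 1) / eps)) with (INR N + 1) by (field; lra).
      lra. }
  destruct (Rle_dec a b); [now apply main|].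
  apply ex_RInt_swap, main; lra.
Qed.

(* The last point of [X] before [tau]; clamped to [t0] when [tau < t0]. *)
Definition ts_floor (X : R -> Prop) (t0 tau : R) : R :=
  epsilon (inhabits 0) (fun m => is_lub (fun r => X r /\ r <= Rmax tau t0) m).

Lemma ts_floor_lub (X : R -> Prop) (t0 tau : R) :
  X t0 -> is_lub (fun r => X r /\ r <= Rmax tau t0) (ts_floor X t0 tau).
Proof.
  intros H0; unfold ts_floor; apply epsilon_spec.
  destruct (completeness (fun r => X r /\ r <= Rmax tau t0)) as [m Hm].
  - exists (Rmax tau t0); intros r [_ Hr]; exact Hr.
  - exists t0; split; [exact H0|apply Rmax_r].
  - now exists m.
Qed.

Lemma ts_floor_max (X : R -> Prop) (t0 tau r : R) :
  X t0 -> X r -> r <= tau -> r <= ts_floor X t0 tau.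
Proof.
  intros H0 Hr Hle; apply (ts_floor_lub X t0 tau H0); split; [exact Hr|].
  apply Rle_trans with tau; [exact Hle|apply Rmax_l].
Qed.

Lemma ts_floor_ge (X : R -> Prop) (t0 tau : R) : X t0 -> t0 <= ts_floor X t0 tau.
Proof.
  intros H0; apply (ts_floor_lub X t0 tau H0); split; [exact H0|apply Rmax_r].
Qed.

Lemma ts_floor_le (X : R -> Prop) (t0 tau : R) :
  X t0 -> t0 <= tau -> ts_floor X t0 tau <= tau.
Proof.
  intros H0 Ht; apply (ts_floor_lub X t0 tau H0); intros r [_ Hr].
  now rewrite Rmax_left in Hr.
Qed.

Lemma ts_floor_mono (X : R -> Prop) (t0 x y : R) :
  X t0 -> x <= y -> ts_floor X t0 x <= ts_floor X t0 y.
Proof.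
  intros H0 Hxy; apply (ts_floor_lub X t0 x H0); intros r [Hr Hle].
  apply (ts_floor_lub X t0 y H0); split; [exact Hr|].
  apply Rle_trans with (1 := Hle); apply Rle_max_compat_r, Hxy.
Qed.

Lemma ts_floor_in (X : R -> Prop) (t0 tau : R) :
  closed_set X -> X t0 -> X (ts_floor X t0 tau).
Proof.
  intros Hc H0; apply Hc; intros eps Heps.
  destruct (ts_floor_lub X t0 tau H0) as [Hub Hl].
  apply NNPP; intros Hno.
  assert (ts_floor X t0 tau <= ts_floor X t0 tau - eps); [|lra].
  apply Hl; intros r [Hr Hle].
  apply Rnot_lt_le; intros Hlt; apply Hno; exists r; split; [exact Hr|].
  assert (r <= ts_floor X t0 tau) by (apply Hub; now split).
  rewrite Rabs_left1; lra.
Qed.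

(* The k-fold iterated delta integral of [1]: the delta integral of [f] is the Riemann integral of
   [f] composed with [ts_floor]. *)
Fixpoint ts_monomial (X : R -> Prop) (t0 : R) (k : nat) (t : R) : R :=
  match k with
  | O => 1
  | S p => RInt (fun tau => ts_monomial X t0 p (ts_floor X t0 tau)) t0 t
  end.

(** Both bounds go through one induction: monotonicity of [h_k] composed with the monotone floor
    makes the next integrand integrable, and its nonnegativity makes the next monomial increase. *)
Lemma ts_monomial_bounds (X : R -> Prop) (t0 : R) (k : nat) (r s : R) :
  X t0 -> t0 <= r <= s ->
  0 <= ts_monomial X t0 k r <= ts_monomial X t0 k s.
Proof.
  intros H0; revert r s; induction k as [|k IH]; intros r s Hrs; [simpl; lra|].
  assert (Hmon : forall x y, x <= y ->
    ts_monomial X t0 k (ts_floor X t0 x) <= ts_monomial X t0 k (ts_floor X t0 y)).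
  { intros x y Hxy; apply IH; split; [now apply ts_floor_ge|now apply ts_floor_mono]. }
  assert (Hpos : forall x, 0 <= ts_monomial X t0 k (ts_floor X t0 x)).
  { intros x; apply (IH _ (ts_floor X t0 x)); split; [now apply ts_floor_ge|lra]. }
  simpl; split.
  - apply RInt_ge_0; [lra|now apply ex_RInt_monotone|auto].
  - rewrite <- (RInt_Chasles _ t0 r s) by now apply ex_RInt_monotone.
    unfold plus; simpl.
    assert (0 <= RInt (fun tau => ts_monomial X t0 k (ts_floor X t0 tau)) r s); [|lra].
    apply RInt_ge_0; [lra|now apply ex_RInt_monotone|auto].
Qed.

Lemma ts_monomial_integrable (X : R -> Prop) (t0 : R) (k : nat) (r s : R) :
  X t0 -> ex_RInt (fun tau => ts_monomial X t0 k (ts_floor X t0 tau)) r s.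
Proof.
  intros H0; apply ex_RInt_monotone; intros x y Hxy; apply ts_monomial_bounds; trivial.
  split; [now apply ts_floor_ge|now apply ts_floor_mono].
Qed.

(** A mean value inequality with a free slope: [v = h_k(t)] gives the differentiability estimate of
    [h_(k+1)] at [t], and [v = 0] a Lipschitz bound. The order of [r] and [s] is left open because a
    point near [t] may lie on either side of the jump [s]. *)
Lemma ts_monomial_increment (X : R -> Prop) (t0 : R) (k : nat) (v m r s : R) :
  X t0 ->
  (forall tau, Rmin r s < tau < Rmax r s ->
     Rabs (ts_monomial X t0 k (ts_floor X t0 tau) - v) <= m) ->
  Rabs (ts_monomial X t0 (S k) s - ts_monomial X t0 (S k) r - v * (s - r)) <= m * Rabs (s - r).
Proof.
  intros H0.
  assert (main : forall r s, r <= s ->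
    (forall tau, r < tau < s -> Rabs (ts_monomial X t0 k (ts_floor X t0 tau) - v) <= m) ->
    Rabs (ts_monomial X t0 (S k) s - ts_monomial X t0 (S k) r - v * (s - r))
      <= m * Rabs (s - r)).
  { clear r s; intros r s Hrs Hb; simpl.
    set (g := fun tau => ts_monomial X t0 k (ts_floor X t0 tau)) in *.
    assert (Hg : forall x y, ex_RInt g x y) by (intros; now apply ts_monomial_integrable).
    rewrite <- (RInt_Chasles g t0 r s) by apply Hg.
    unfold plus; simpl.
    assert (H1 : RInt g r s <= RInt (fun _ => v + m) r s).
    { apply RInt_le; trivial; [apply ex_RInt_const|].
      intros x Hx; specialize (Hb x Hx); apply Rabs_le_between in Hb; unfold g; lra. }
    assert (H2 : RInt (fun _ => v - m) r s <= RInt g r s).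
    { apply RInt_le; trivial; [apply ex_RInt_const|].
      intros x Hx; specialize (Hb x Hx); apply Rabs_le_between in Hb; unfold g; lra. }
    rewrite RInt_const in H1, H2; unfold scal in H1, H2; simpl in H1, H2.
    unfold mult in H1, H2; simpl in H1, H2.
    rewrite (Rabs_pos_eq (s - r)) by lra.
    apply Rabs_le; lra. }
  intros Hb; destruct (Rle_dec r s) as [Hrs|Hrs].
  - apply main; trivial; intros tau Ht; apply Hb.
    rewrite Rmin_left, Rmax_right; lra.
  - rewrite (Rabs_minus_sym s r).
    replace (ts_monomial X t0 (S k) s - ts_monomial X t0 (S k) r - v * (s - r))
      with (- (ts_monomial X t0 (S k) r - ts_monomial X t0 (S k) s - v * (r - s))) by ring.
    rewrite Rabs_Ropp; apply main; [lra|]; intros tau Ht; apply Hb.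
    rewrite Rmin_right, Rmax_left; lra.
Qed.

Lemma RInt_exp_scaled (be t0 t c : R) : 0 < be -> 0 < c ->
  is_RInt (fun x => exp (be * (x - t0)) / c) t0 t
    ((exp (be * (t - t0)) / c - 1 / c) / be).
Proof.
  intros Hb Hc.
  replace ((exp (be * (t - t0)) / c - 1 / c) / be) with
    (minus (exp (be * (t - t0)) / c / be) (exp (be * (t0 - t0)) / c / be)).
  - apply (is_RInt_derive (fun x => exp (be * (x - t0)) / c / be)).
    + intros x _; unfold Rdiv; auto_derive; trivial.
      unfold Rminus; field; lra.
    + intros x _; apply (ex_derive_continuous (fun x => exp (be * (x - t0)) / c)).
      unfold Rdiv; auto_derive; trivial.
  - unfold minus, plus, opp; simpl.
    replace (be * (t0 - t0)) with 0 by ring; rewrite exp_0; field; lra.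
Qed.

(** An exponential divided by [be ^ k] reproduces itself under integration, and [ts_floor] only
    moves the argument to the left. The rate [be] stays free so that it can later beat the growth of
    the powers of [M]. *)
Lemma ts_monomial_exp_bound (X : R -> Prop) (t0 be : R) (k : nat) (t : R) :
  X t0 -> 0 < be -> t0 <= t ->
  ts_monomial X t0 k t <= exp (be * (t - t0)) / be ^ k.
Proof.
  intros H0 Hb; revert t; induction k as [|k IH]; intros t Ht.
  - simpl; rewrite Rdiv_1_r, <- exp_0; apply exp_le_compat; nra.
  - assert (Hbk : 0 < be ^ k) by now apply pow_lt.
    apply Rle_trans with (RInt (fun x => exp (be * (x - t0)) / be ^ k) t0 t).
    + apply RInt_le; trivial; [now apply ts_monomial_integrable| |].
      * eexists; now apply RInt_exp_scaled.
      * intros x Hx.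
        apply Rle_trans with (1 := IH _ (ts_floor_ge X t0 x H0)).
        apply Rmult_le_compat_r; [left; now apply Rinv_0_lt_compat|].
        apply exp_le_compat, Rmult_le_compat_l; [lra|].
        assert (ts_floor X t0 x <= x) by (apply ts_floor_le; trivial; lra); lra.
    + rewrite (is_RInt_unique _ _ _ _ (RInt_exp_scaled be t0 t (be ^ k) Hb Hbk)); simpl.
      assert (0 < 1 / be ^ k) by (apply Rdiv_lt_0_compat; lra).
      apply Rle_trans with (exp (be * (t - t0)) / be ^ k / be); [|right; field; lra].
      apply Rmult_le_compat_r; [left; now apply Rinv_0_lt_compat|lra].
Qed.

(** The slope of [h_k] is [h_(k-1)], at most the exponential over [be ^ (k-1)]; the constant is
    written over [be ^ k] to include [k = 0], where the monomial is constant. *)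
Lemma ts_monomial_lipschitz (X : R -> Prop) (t0 be : R) (k : nat) (t1 r s : R) :
  X t0 -> 0 < be -> t0 <= r <= t1 -> t0 <= s <= t1 ->
  Rabs (ts_monomial X t0 k s - ts_monomial X t0 k r)
    <= be * exp (be * (t1 - t0)) / be ^ k * Rabs (s - r).
Proof.
  intros H0 Hb Hr Hs.
  assert (He := exp_pos (be * (t1 - t0))).
  destruct k as [|k].
  - simpl; rewrite Rminus_diag, Rabs_R0; apply Rmult_le_pos; [|apply Rabs_pos].
    rewrite Rdiv_1_r; nra.
  - assert (Hbk : 0 < be ^ k) by now apply pow_lt.
    replace (ts_monomial X t0 (S k) s - ts_monomial X t0 (S k) r) with
      (ts_monomial X t0 (S k) s - ts_monomial X t0 (S k) r - 0 * (s - r)) by ring.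
    replace (be * exp (be * (t1 - t0)) / be ^ S k) with (exp (be * (t1 - t0)) / be ^ k)
      by (simpl; field; lra).
    apply ts_monomial_increment; trivial; intros tau Htau.
    assert (t0 <= tau <= t1).
    { revert Htau; unfold Rmin, Rmax; destruct (Rle_dec r s); lra. }
    pose proof (ts_floor_ge X t0 tau H0).
    assert (ts_floor X t0 tau <= tau) by (apply ts_floor_le; trivial; lra).
    rewrite Rminus_0_r, Rabs_pos_eq.
    2:{ apply (ts_monomial_bounds X t0 k (ts_floor X t0 tau) (ts_floor X t0 tau)); trivial; lra. }
    apply Rle_trans with (ts_monomial X t0 k t1).
    + apply ts_monomial_bounds; trivial; lra.
    + apply ts_monomial_exp_bound; trivial; lra.
Qed.

Lemma series_half_bound (u : nat -> R) (K : R) :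
  (forall k, Rabs (u k) <= K * (/ 2) ^ k) -> ex_series u /\ Rabs (Series u) <= 2 * K.
Proof.
  intros Hu.
  assert (Hg : is_series (fun k => K * (/ 2) ^ k) (2 * K)).
  { replace (2 * K) with (K * / (1 - / 2)) by field.
    apply (is_series_scal_l K (fun k => (/ 2) ^ k)), is_series_geom; rewrite Rabs_pos_eq; lra. }
  assert (Ha : ex_series (fun k => Rabs (u k))).
  { apply (ex_series_le (fun k => Rabs (u k)) (fun k => K * (/ 2) ^ k)); [|now exists (2 * K)].
    intros k; unfold norm; simpl; unfold abs; simpl; rewrite Rabs_Rabsolu; apply Hu. }
  split; [now apply ex_series_Rabs|].
  apply Rle_trans with (Series (fun k => Rabs (u k))); [now apply Series_Rabs|].
  rewrite <- (is_series_unique _ _ Hg); apply Series_le; [|now exists (2 * K)].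
  intros k; split; [apply Rabs_pos|apply Hu].
Qed.

Lemma is_series_rsum (m : nat) (f : nat -> nat -> R) :
  (forall j, (j < m)%nat -> ex_series (f j)) ->
  is_series (fun k => rsum m (fun j => f j k)) (rsum m (fun j => Series (f j))).
Proof.
  induction m as [|m IH]; intros H; simpl.
  - assert (Hz : is_series (fun k => 0 * (/ 2) ^ k) (0 * / (1 - / 2))).
    { apply (is_series_scal_l 0 (fun k => (/ 2) ^ k)), is_series_geom; rewrite Rabs_pos_eq; lra. }
    rewrite Rmult_0_l in Hz.
    apply is_series_ext with (2 := Hz); intros; apply Rmult_0_l.
  - apply (is_series_plus (fun k => rsum m (fun j => f j k)) (f m)).
    + apply IH; intros; apply H; lia.
    + apply Series_correct, H; lia.
Qed.

Theorem auto_solution_exists (T : R -> Prop) (n : nat) (M : nat -> nat -> R)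
  (t0 : R) (x0 : nat -> R) :
  closed_set T -> T t0 -> exists x, auto_solution T n M t0 x0 x.
Proof.
  intros HcT HT0.
  pose proof (closed_restrict T t0 HcT) as Hc.
  set (X := restrict T t0) in *.
  assert (H0 : X t0) by (split; [exact HT0|lra]).
  destruct (Apow_bound n M x0) as (L & C & HL & HC & Hpow).
  set (h := ts_monomial X t0); set (y := fun k i => Apow n M k x0 i).
  (* Twice the growth rate of the powers of [M]: the terms are then dominated by a geometric series
     of ratio 1/2. *)
  set (be := 2 * L); assert (Hbe : 0 < be) by (unfold be; lra).
  assert (Hratio : forall k, L ^ k / be ^ k = (/ 2) ^ k).
  { intros k; unfold be; rewrite Rpow_mult_distr, pow_inv.
    field; split; apply pow_nonzero; lra. }
  (* The shift [d] treats the solution ([d = 0]) and its derivative ([d = 1]) at once. *)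
  assert (Hterm : forall t d i k, t0 <= t -> (i < n)%nat ->
    Rabs (h k t * y (k + d)%nat i) <= exp (be * (t - t0)) * C * L ^ d * (/ 2) ^ k).
  { intros t d i k Ht Hi; rewrite <- Hratio, Rabs_mult, Rabs_pos_eq.
    2:{ apply (ts_monomial_bounds X t0 k t t); trivial; lra. }
    apply Rle_trans with (exp (be * (t - t0)) / be ^ k * (C * L ^ (k + d))).
    - apply Rmult_le_compat; [|apply Rabs_pos| |now apply Hpow].
      + apply (ts_monomial_bounds X t0 k t t); trivial; lra.
      + now apply ts_monomial_exp_bound.
    - rewrite pow_add; right; field; apply pow_nonzero; lra. }
  assert (Hsum : forall t d i, t0 <= t -> (i < n)%nat -> ex_series (fun k => h k t * y (k + d)%nat i)).
  { intros t d i Ht Hi.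
    apply (series_half_bound _ (exp (be * (t - t0)) * C * L ^ d)); intros k; now apply Hterm. }
  assert (Hsum0 : forall t i, t0 <= t -> (i < n)%nat -> ex_series (fun k => h k t * y k i)).
  { intros t i Ht Hi; apply (ex_series_ext (fun k => h k t * y (k + 0)%nat i)).
    - intros k; now rewrite Nat.add_0_r.
    - now apply Hsum. }
  exists (fun t i => Series (fun k => h k t * y k i)); split.
  - intros i Hi; rewrite Series_incr_1 by (apply Hsum0; trivial; lra).
    rewrite (Series_ext _ (fun k => 0 * y (S k) i)).
    + rewrite Series_scal_l; unfold h, y; simpl; ring.
    + intros k; unfold h; simpl; rewrite RInt_point; reflexivity.
  - intros t Ht i Hi.
    assert (Ht0 : t0 <= t) by apply Ht.
    destruct (forward_jump_exists X t) as [s Hs]; exists s; split; [exact Hs|].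
    pose proof (forward_jump_in X t s Hc Ht Hs) as HXs.
    pose proof (forward_jump_ge X t s Hs) as Hts.
    (* Applying [M] termwise turns [y k] into [y (S k)], so the candidate derivative is a series in
       the same monomials. *)
    assert (HD : mv n M (fun j => Series (fun k => h k t * y k j)) i
                 = Series (fun k => h k t * y (S k) i)).
    { unfold mv; symmetry; apply is_series_unique.
      apply (is_series_ext (fun k => rsum n (fun j => M i j * (h k t * y k j)))).
      { intros k; unfold y; simpl; unfold mv; rewrite <- rsum_scal_l.
        apply rsum_ext; intros; ring. }
      rewrite (rsum_ext n _ (fun j => Series (fun k => M i j * (h k t * y k j))))
        by (intros; now rewrite Series_scal_l).
      apply (is_series_rsum n (fun j k => M i j * (h k t * y k j))).
      intros j Hj; apply (ex_series_scal_l (M i j) (fun k => h k t * y k j)); now apply Hsum0. }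
    rewrite HD.
    (* The radius below is at most 1, so the floors compared with [t] lie before [t + 1], where the
       Lipschitz bound is taken. *)
    set (Cst := be * exp (be * (t + 1 - t0)) * C * L).
    assert (HCst : 0 <= Cst).
    { unfold Cst; repeat apply Rmult_le_pos; try lra; left; apply exp_pos. }
    intros eps Heps.
    (* At a right-scattered [t] this radius keeps [r] from lying beyond the gap, so [r <= t]; at a
       right-dense one [s = t] and any radius serves. *)
    set (d0 := if Req_dec_T s t then 1 else s - t).
    assert (Hd0 : 0 < d0) by (unfold d0; destruct (Req_dec_T s t); lra).
    set (d1 := eps / (2 * Cst + 1)).
    assert (Hd1 : 0 < d1) by (apply Rdiv_lt_0_compat; lra).
    exists (Rmin 1 (Rmin d0 d1)); split; [repeat apply Rmin_pos; lra|].
    intros r Hr Hrd.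
    assert (Hr1 : Rabs (t - r) < 1) by (eapply Rlt_le_trans; [exact Hrd|apply Rmin_l]).
    assert (Hr2 : Rabs (t - r) < d0).
    { eapply Rlt_le_trans; [exact Hrd|]; eapply Rle_trans; [apply Rmin_r|apply Rmin_l]. }
    assert (Hr3 : Rabs (t - r) < d1).
    { eapply Rlt_le_trans; [exact Hrd|]; eapply Rle_trans; [apply Rmin_r|apply Rmin_r]. }
    assert (Hr0 : t0 <= r) by apply Hr.
    (* Between [r] and [s] the floor never leaves the segment from [r] to [t], because no point of
       [X] lies strictly between [t] and [s]. *)
    assert (Hfloor : forall tau, Rmin r s < tau < Rmax r s ->
      Rabs (ts_floor X t0 tau - t) <= Rabs (t - r)).
    { intros tau Htau.
      pose proof (ts_floor_in X t0 tau Hc H0) as Hin.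
      destruct (Rle_dec r t) as [Hrt|Hrt].
      - rewrite Rmin_left, Rmax_right in Htau by lra.
        assert (ts_floor X t0 tau <= tau) by (apply ts_floor_le; trivial; lra).
        assert (r <= ts_floor X t0 tau) by (apply ts_floor_max; trivial; lra).
        assert (ts_floor X t0 tau <= t).
        { apply Rnot_lt_le; intros Hlt.
          pose proof (forward_jump_gap X t s _ Hs Hin Hlt); lra. }
        rewrite Rabs_left1, Rabs_pos_eq; lra.
      - assert (s = t).
        { unfold d0 in Hr2; destruct (Req_dec_T s t) as [E|Hne]; [exact E|].
          pose proof (forward_jump_gap X t s r Hs Hr); rewrite Rabs_left1 in Hr2; lra. }
        subst s; rewrite Rmin_right, Rmax_left in Htau by lra.
        assert (ts_floor X t0 tau <= tau) by (apply ts_floor_le; trivial; lra).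
        assert (t <= ts_floor X t0 tau) by (apply ts_floor_max; trivial; lra).
        rewrite Rabs_pos_eq, Rabs_left1; lra. }
    (* The remainder term by term: the increment of [h_(k+1)] minus its linear part of slope
       [h_k(t)]. The terms with [h_0] cancel. *)
    set (e := fun k => (h (S k) s - h (S k) r - h k t * (s - r)) * y (S k) i).
    assert (Heq : Series (fun k => h k s * y k i) - Series (fun k => h k r * y k i)
                  - Series (fun k => h k t * y (S k) i) * (s - r) = Series e).
    { assert (Hs0 : t0 <= s) by lra.
      rewrite (Series_incr_1 (fun k => h k s * y k i)) by now apply Hsum0.
      rewrite (Series_incr_1 (fun k => h k r * y k i)) by now apply Hsum0.
      replace (h 0%nat s) with 1 by reflexivity; replace (h 0%nat r) with 1 by reflexivity.
      assert (E1 : ex_series (fun k => h (S k) s * y (S k) i))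
        by (apply (ex_series_incr_1 (fun k => h k s * y k i)); now apply Hsum0).
      assert (E2 : ex_series (fun k => h (S k) r * y (S k) i))
        by (apply (ex_series_incr_1 (fun k => h k r * y k i)); now apply Hsum0).
      assert (E3 : ex_series (fun k => h k t * y (S k) i)).
      { apply (ex_series_ext (fun k => h k t * y (k + 1)%nat i));
          [intros k; now rewrite Nat.add_1_r|now apply Hsum]. }
      rewrite (Series_ext e (fun k => (h (S k) s * y (S k) i - h (S k) r * y (S k) i)
                                      - (s - r) * (h k t * y (S k) i)))
        by (intros; unfold e; ring).
      rewrite Series_minus, Series_minus, Series_scal_l; trivial; [ring| |].
      - now apply (ex_series_minus (fun k => h (S k) s * y (S k) i)).
      - now apply (ex_series_scal_l (s - r) (fun k => h k t * y (S k) i)). }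
    rewrite Heq.
    assert (He : Rabs (Series e) <= 2 * (Cst * Rabs (t - r) * Rabs (s - r))).
    { apply series_half_bound; intros k; unfold e; rewrite Rabs_mult, <- Hratio.
      assert (Hk : 0 < be ^ k) by now apply pow_lt.
      apply Rle_trans with
        (be * exp (be * (t + 1 - t0)) / be ^ k * Rabs (t - r) * Rabs (s - r) * (C * L ^ S k)).
      - apply Rmult_le_compat; [apply Rabs_pos|apply Rabs_pos| |now apply Hpow].
        apply ts_monomial_increment; trivial; intros tau Htau.
        specialize (Hfloor tau Htau).
        pose proof (ts_floor_ge X t0 tau H0).
        apply Rle_trans with (be * exp (be * (t + 1 - t0)) / be ^ k
                              * Rabs (ts_floor X t0 tau - t)).
        + apply ts_monomial_lipschitz; trivial; [lra|].
          split; trivial; apply Rabs_le_between in Hfloor; lra.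
        + apply Rmult_le_compat_l; trivial.
          left; apply Rdiv_lt_0_compat; trivial.
          apply Rmult_lt_0_compat; trivial; apply exp_pos.
      - right; unfold Cst; simpl; field; lra. }
    apply Rle_trans with (1 := He).
    assert (2 * Cst * Rabs (t - r) <= eps).
    { apply Rle_trans with ((2 * Cst + 1) * d1); [|right; unfold d1; field; lra].
      apply Rmult_le_compat; try lra; apply Rabs_pos. }
    assert (0 <= Rabs (s - r)) by apply Rabs_pos; nra.
Qed.

End Existence.
Import Existence.

(** * Delta derivatives and exponential barriers *)

Lemma forward_jump_unique (X : R -> Prop) (t s s' : R) :
  forward_jump X t s -> forward_jump X t s' -> s = s'.
Proof.
  intros [[He [H1 H2]]|[Hn ->]] [[He' [H1' H2']]|[Hn' ->]]; trivial.
  - apply Rle_antisym; auto.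
  - contradiction.
  - contradiction.
Qed.

(** Barriers carry a positive margin [eps], which this passage to the limit removes. *)
Lemma eps_mult_le_0 (x y : R) : (forall eps, 0 < eps -> x <= eps * y) -> 0 <= y -> x <= 0.
Proof.
  intros H Hy; apply Rnot_lt_le; intros Hx.
  assert (He : 0 < x / (2 * (y + 1))) by (apply Rdiv_lt_0_compat; lra).
  specialize (H _ He).
  assert (x / (2 * (y + 1)) * y <= x / 2); [|lra].
  apply Rle_trans with (x / (2 * (y + 1)) * (y + 1)); [apply Rmult_le_compat_l; lra|].
  right; field; lra.
Qed.

(** The point [r = t] lies within every radius, so the error there is at most [eps * |s - t|] for
    every [eps]. *)
Lemma delta_deriv_jump (X : R -> Prop) (f : R -> R) (t s D : R) :
  X t -> forward_jump X t s -> delta_deriv X f t D -> f s = f t + (s - t) * D.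
Proof.
  intros Ht Hs [s' [Hs' HD]].
  rewrite (forward_jump_unique X t s' s Hs' Hs) in HD.
  assert (Rabs (f s - f t - D * (s - t)) <= 0).
  { apply eps_mult_le_0 with (Rabs (s - t)); [|apply Rabs_pos].
    intros eps Heps; destruct (HD eps Heps) as [d [Hd H]]; apply H; trivial.
    rewrite Rminus_diag, Rabs_R0; exact Hd. }
  assert (f s - f t - D * (s - t) = 0); [|lra].
  apply NNPP; intros Hne; apply Rabs_pos_lt in Hne; lra.
Qed.

Lemma delta_deriv_cont (X : R -> Prop) (f : R -> R) (t D : R) :
  X t -> delta_deriv X f t D -> cont_on X f t.
Proof.
  intros Ht HfD e He.
  destruct (HfD) as [s [Hs HD]].
  pose proof (delta_deriv_jump X f t s D Ht Hs HfD) as Hj.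
  (* At a right-scattered [t] the distance from [r] to [s] does not shrink, so the remainder is made
     small through [eps] against the fixed bound [w]. *)
  set (w := Rabs (s - t) + 2).
  assert (Hw : 2 <= w) by (unfold w; assert (H := Rabs_pos (s - t)); lra).
  destruct (HD (e / (2 * w))) as [d [Hd H]]; [apply Rdiv_lt_0_compat; lra|].
  set (d1 := e / (2 * (Rabs D + 1))).
  assert (HaD := Rabs_pos D).
  assert (Hd1 : 0 < d1) by (apply Rdiv_lt_0_compat; lra).
  exists (Rmin 1 (Rmin d d1)); split; [repeat apply Rmin_pos; lra|].
  intros r Hr Hrd.
  assert (Hr1 : Rabs (r - t) < 1) by (eapply Rlt_le_trans; [exact Hrd|apply Rmin_l]).
  assert (Hr2 : Rabs (r - t) < d)
    by (eapply Rlt_le_trans; [exact Hrd|]; eapply Rle_trans; [apply Rmin_r|apply Rmin_l]).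
  assert (Hr3 : Rabs (r - t) < d1)
    by (eapply Rlt_le_trans; [exact Hrd|]; eapply Rle_trans; [apply Rmin_r|apply Rmin_r]).
  assert (Hb := H r Hr); rewrite Rabs_minus_sym in Hb; specialize (Hb Hr2).
  assert (Hsr : Rabs (s - r) <= w).
  { replace (s - r) with ((s - t) - (r - t)) by ring; unfold w.
    eapply Rle_trans; [apply Rabs_triang|]; rewrite Rabs_Ropp; lra. }
  replace (f r - f t) with (D * (r - t) - (f s - f r - D * (s - r))) by (rewrite Hj; ring).
  eapply Rle_lt_trans; [apply Rabs_triang|]; rewrite Rabs_Ropp, Rabs_mult.
  assert (e / (2 * w) * Rabs (s - r) <= e / 2).
  { apply Rle_trans with (e / (2 * w) * w); [|right; field; lra].
    apply Rmult_le_compat_l; trivial; left; apply Rdiv_lt_0_compat; lra. }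
  assert (Rabs D * Rabs (r - t) < e / 2); [|lra].
  apply Rlt_le_trans with ((Rabs D + 1) * d1); [|right; unfold d1; field; lra].
  apply Rle_lt_trans with (Rabs D * d1); [apply Rmult_le_compat_l; lra|].
  apply Rmult_lt_compat_r; lra.
Qed.

Lemma delta_deriv_ext (X : R -> Prop) (f g : R -> R) (t D : R) :
  (forall s, f s = g s) -> delta_deriv X f t D -> delta_deriv X g t D.
Proof.
  intros Hfg [s [Hs HD]]; exists s; split; trivial; intros eps Heps.
  destruct (HD eps Heps) as [d [Hd H]]; exists d; split; trivial.
  intros r Hr Hrd; rewrite <- !Hfg; now apply H.
Qed.

Lemma delta_deriv_const (X : R -> Prop) (c t : R) : delta_deriv X (fun _ => c) t 0.
Proof.
  destruct (forward_jump_exists X t) as [s Hs]; exists s; split; trivial.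
  intros eps Heps; exists 1; split; [lra|]; intros r _ _.
  replace (c - c - 0 * (s - r)) with 0 by ring; rewrite Rabs_R0.
  apply Rmult_le_pos; [lra|apply Rabs_pos].
Qed.

Lemma delta_deriv_plus (X : R -> Prop) (f g : R -> R) (t D E : R) :
  delta_deriv X f t D -> delta_deriv X g t E ->
  delta_deriv X (fun s => f s + g s) t (D + E).
Proof.
  intros [s [Hs HD]] [s' [Hs' HE]].
  rewrite (forward_jump_unique X t s' s Hs' Hs) in HE; clear s' Hs'.
  exists s; split; trivial; intros eps Heps.
  destruct (HD (eps / 2)) as [d1 [Hd1 H1]]; [lra|].
  destruct (HE (eps / 2)) as [d2 [Hd2 H2]]; [lra|].
  exists (Rmin d1 d2); split; [now apply Rmin_pos|].
  intros r Hr Hrd.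
  assert (Rabs (t - r) < d1) by (eapply Rlt_le_trans; [exact Hrd|apply Rmin_l]).
  assert (Rabs (t - r) < d2) by (eapply Rlt_le_trans; [exact Hrd|apply Rmin_r]).
  replace (f s + g s - (f r + g r) - (D + E) * (s - r)) with
    ((f s - f r - D * (s - r)) + (g s - g r - E * (s - r))) by ring.
  eapply Rle_trans; [apply Rabs_triang|].
  specialize (H1 r Hr ltac:(assumption)); specialize (H2 r Hr ltac:(assumption)); lra.
Qed.

Lemma delta_deriv_scal (X : R -> Prop) (f : R -> R) (c t D : R) :
  delta_deriv X f t D -> delta_deriv X (fun s => c * f s) t (c * D).
Proof.
  intros [s [Hs HD]]; exists s; split; trivial; intros eps Heps.
  assert (Hc := Rabs_pos c).
  destruct (HD (eps / (Rabs c + 1))) as [d [Hd H]]; [apply Rdiv_lt_0_compat; lra|].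
  exists d; split; trivial; intros r Hr Hrd.
  replace (c * f s - c * f r - c * D * (s - r)) with (c * (f s - f r - D * (s - r))) by ring.
  rewrite Rabs_mult.
  apply Rle_trans with ((Rabs c + 1) * (eps / (Rabs c + 1) * Rabs (s - r))).
  - apply Rmult_le_compat; try lra; [apply Rabs_pos|now apply H].
  - right; field; lra.
Qed.

Lemma delta_deriv_rsum (X : R -> Prop) (m : nat) (w : nat -> R) (f : R -> nat -> R)
  (t : R) (D : nat -> R) :
  (forall i, (i < m)%nat -> delta_deriv X (fun s => f s i) t (D i)) ->
  delta_deriv X (fun s => rsum m (fun i => w i * f s i)) t (rsum m (fun i => w i * D i)).
Proof.
  induction m as [|m IH]; intros H; simpl; [apply delta_deriv_const|].
  apply (delta_deriv_plus X (fun s => rsum m (fun i => w i * f s i)) (fun s => w m * f s m)).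
  - apply IH; intros; apply H; lia.
  - apply (delta_deriv_scal X (fun s => f s m)), H; lia.
Qed.

(** Real induction along a closed set. The supremum of the points up to which [P] holds is in [X]
    and satisfies [P]; if it were below the target point, a jump or a right-dense step would carry
    [P] past it. *)
Lemma ts_induction (X : R -> Prop) (t0 : R) (P : R -> Prop) :
  closed_set X -> X t0 -> (forall t, X t -> t0 <= t) -> P t0 ->
  (forall t s, X t -> P t -> forward_jump X t s -> t < s -> P s) ->
  (forall t, X t -> P t -> forward_jump X t t ->
     exists d, 0 < d /\ forall s, X s -> t < s < t + d -> P s) ->
  (forall t, X t -> (forall eps, 0 < eps -> exists s, X s /\ t - eps < s < t) ->
     (forall s, X s -> s < t -> P s) -> P t) ->
  forall t, X t -> P t.
Proof.
  intros Hc H0 Hmin HP0 Hjump Hdense Hleft t1 Ht1; apply NNPP; intros HnP.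
  set (E := fun u => X u /\ u <= t1 /\ forall s, X s -> s <= u -> P s).
  assert (HE0 : E t0).
  { repeat split; trivial; [now apply Hmin|].
    intros s Hs Hle; replace s with t0; trivial.
    apply Rle_antisym; trivial; now apply Hmin. }
  destruct (completeness E) as [m [Hub Hl]].
  { exists t1; intros u [_ [Hu _]]; exact Hu. }
  { now exists t0. }
  assert (Happrox : forall eps, 0 < eps -> exists u, E u /\ m - eps < u <= m).
  { intros eps Heps; apply NNPP; intros Hno.
    assert (m <= m - eps); [|lra].
    apply Hl; intros u Hu; apply Rnot_lt_le; intros Hlt; apply Hno.
    exists u; split; trivial; split; trivial; now apply Hub. }
  assert (HXm : X m).
  { apply Hc; intros eps Heps; destruct (Happrox eps Heps) as [u [Hu Hd]].
    exists u; split; [apply Hu|rewrite Rabs_left1; lra]. }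
  assert (Hbelow : forall s, X s -> s < m -> P s).
  { intros s Hs Hlt; destruct (Happrox (m - s)) as [u [Hu Hd]]; [lra|].
    apply Hu; trivial; lra. }
  assert (HPm : P m).
  { destruct (classic (forall eps, 0 < eps -> exists s, X s /\ m - eps < s < m)) as [Hd|Hn];
      [now apply Hleft|].
    apply not_all_ex_not in Hn; destruct Hn as [eps Hn].
    apply imply_to_and in Hn; destruct Hn as [Heps Hn].
    destruct (Happrox eps Heps) as [u [Hu Hd]].
    destruct (Req_dec u m) as [<-|Hne]; [apply Hu; [apply Hu|lra]|].
    exfalso; apply Hn; exists u; split; [apply Hu|lra]. }
  assert (Hmt : m < t1).
  { assert (m <= t1) by (apply Hl; intros u Hu; apply Hu).
    destruct (Req_dec m t1) as [E1|Hne]; [rewrite E1 in HPm; contradiction|lra]. }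
  destruct (forward_jump_exists X m) as [s Hs].
  pose proof (forward_jump_ge X m s Hs) as Hms.
  destruct (Rle_lt_or_eq_dec m s Hms) as [Hlt|Heq].
  - pose proof (Hjump m s HXm HPm Hs Hlt) as HPs.
    assert (HEs : E s); [|apply Hub in HEs; lra].
    repeat split; [now apply (forward_jump_in X m)|now apply (forward_jump_gap X m)|].
    intros r Hr Hle; destruct (Rtotal_order r m) as [H|[->|H]]; auto.
    replace r with s; trivial; apply Rle_antisym; trivial; now apply (forward_jump_gap X m).
  - subst s; destruct (Hdense m HXm HPm Hs) as [d [Hd HP]].
    assert (Hdt : m + d <= t1).
    { apply Rnot_lt_le; intros Hlt; apply HnP, HP; trivial; lra. }
    assert (exists r, X r /\ m < r < m + d) as [r [Hr Hrd]].
    { apply NNPP; intros Hno.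
      destruct Hs as [[_ [_ Hg]]|[Hn _]]; [|apply Hn; now exists t1].
      assert (m + d <= m); [|lra].
      apply Hg; intros x [Hx Hmx]; apply Rnot_lt_le; intros Hxd; apply Hno; exists x; auto. }
    assert (HEr : E r); [|apply Hub in HEr; lra].
    repeat split; trivial; [lra|].
    intros q Hq Hle; destruct (Rtotal_order q m) as [H|[->|H]]; auto.
    apply HP; trivial; lra.
Qed.

Lemma uniform_radius (I : Type) (l : list I) (Q : I -> R -> Prop) :
  (forall i, In i l -> exists d, 0 < d /\ forall s, s < d -> Q i s) ->
  exists d, 0 < d /\ forall i s, In i l -> s < d -> Q i s.
Proof.
  induction l as [|a l IH]; intros H.
  - exists 1; split; [lra|]; intros i s [].
  - destruct IH as [d [Hd HQ]]; [intros; apply H; now right|].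
    destruct (H a) as [d' [Hd' HQ']]; [now left|].
    exists (Rmin d d'); split; [now apply Rmin_pos|].
    intros i s [->|Hi] Hs.
    + apply HQ'; eapply Rlt_le_trans; [exact Hs|apply Rmin_r].
    + apply HQ; trivial; eapply Rlt_le_trans; [exact Hs|apply Rmin_l].
Qed.

Lemma exp_eps_delta (x e : R) : 0 < e ->
  exists d, 0 < d /\ forall y, Rabs (y - x) < d -> Rabs (exp y - exp x) < e.
Proof.
  intros He.
  destruct (derivable_continuous_pt exp x (derivable_pt_exp x) e He) as [d [Hd H]].
  exists d; split; trivial; intros y Hy.
  destruct (Req_dec y x) as [->|Hne]; [rewrite Rminus_diag, Rabs_R0; exact He|].
  apply H; repeat split; [|exact Hy]; now apply not_eq_sym.
Qed.

(** The family is compared as a whole, since [D i] may depend on every [y j] and is controlled only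
    while all of them respect the barrier. At a right-dense point only a component touching the
    barrier has to be examined, and its slope must strictly exceed that of the barrier, which leaves
    room for the error of the delta derivative. *)
Theorem exponential_barrier (X : R -> Prop) (t0 : R) (I : Type) (l : list I)
  (y D : I -> R -> R) (c L : R) :
  closed_set X -> X t0 -> (forall t, X t -> t0 <= t) -> 0 < c ->
  (forall i t, In i l -> X t -> delta_deriv X (y i) t (D i t)) ->
  (forall i, In i l -> - c <= y i t0) ->
  (forall t s, X t -> forward_jump X t s -> t < s ->
     (forall j, In j l -> - (c * exp (L * (t - t0))) <= y j t) ->
     forall i, In i l ->
       - (c * exp (L * (t - t0)) * exp (L * (s - t))) <= y i t + (s - t) * D i t) ->
  (forall t, X t -> forward_jump X t t ->
     (forall j, In j l -> - (c * exp (L * (t - t0))) <= y j t) ->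
     forall i, In i l -> y i t = - (c * exp (L * (t - t0))) ->
       - (c * exp (L * (t - t0)) * L) < D i t) ->
  forall t i, X t -> In i l -> - (c * exp (L * (t - t0))) <= y i t.
Proof.
  intros Hcl H0 Hmin Hc Hder Hinit Hjump Hdense t i Ht; revert i.
  assert (Hsplit : forall t s, exp (L * (s - t0)) = exp (L * (t - t0)) * exp (L * (s - t))).
  { intros u s; rewrite <- exp_plus; f_equal; ring. }
  apply (ts_induction X t0 (fun t => forall i, In i l -> - (c * exp (L * (t - t0))) <= y i t));
    trivial; clear t Ht.
  - intros i Hi; rewrite Rminus_diag, Rmult_0_r, exp_0, Rmult_1_r; auto.
  - intros t s Ht HP Hs Hts i Hi.
    rewrite (Hsplit t s), (delta_deriv_jump X (y i) t s (D i t) Ht Hs) by auto.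
    rewrite <- Rmult_assoc; now apply Hjump.
  - intros t Ht HP Hs.
    set (B := c * exp (L * (t - t0))) in *.
    assert (HB : 0 < B) by (apply Rmult_lt_0_compat; [exact Hc|apply exp_pos]).
    destruct (uniform_radius I l (fun i r => forall s, X s -> 0 < s - t <= r ->
      - (c * exp (L * (s - t0))) <= y i s)) as [d [Hd H]].
    2:{ exists d; split; trivial; intros s Hs' Hsd i Hi; apply (H i (s - t)); trivial; lra. }
    intros i Hi.
    assert (Hlow : forall s, B * (1 + L * (s - t)) <= c * exp (L * (s - t0))).
    { intros s; rewrite (Hsplit t s), <- Rmult_assoc; apply Rmult_le_compat_l; [unfold B in *; lra|].
      apply exp_ineq1_le. }
    (* Strictly above the barrier continuity suffices; on the barrier the strict slope inequality
       decides. *)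
    destruct (Rle_lt_or_eq_dec _ _ (HP i Hi)) as [Hlt|Heq].
    + set (g := y i t + B).
      assert (Hg : 0 < g) by (unfold g; lra).
      destruct (delta_deriv_cont X (y i) t (D i t) Ht (Hder i t Hi Ht) (g / 2)) as [d [Hd H]];
        [lra|].
      assert (HL := Rabs_pos L).
      (* Within [d'] the tangent to the barrier moves by at most half of the gap [g]. *)
      set (d' := g / (2 * (B * (Rabs L + 1)))).
      assert (HBL : 0 < B * (Rabs L + 1)) by (apply Rmult_lt_0_compat; lra).
      assert (Hd' : 0 < d') by (apply Rdiv_lt_0_compat; lra).
      exists (Rmin d d'); split; [now apply Rmin_pos|].
      intros r Hr s Hs' Hsr.
      assert (r < d) by (eapply Rlt_le_trans; [exact Hr|apply Rmin_l]).
      assert (r < d') by (eapply Rlt_le_trans; [exact Hr|apply Rmin_r]).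
      assert (Hys : Rabs (y i s - y i t) < g / 2) by (apply H; trivial; rewrite Rabs_pos_eq; lra).
      apply Rabs_def2 in Hys; specialize (Hlow s).
      assert (- (g / 2) <= B * (L * (s - t))).
      { apply Rle_trans with (- (B * (Rabs L + 1) * d')); [right; unfold d'; field; lra|].
        assert (- (Rabs L + 1) <= L).
        { assert (Hl := Rle_abs (- L)); rewrite Rabs_Ropp in Hl; lra. }
        assert (- ((Rabs L + 1) * d') <= L * (s - t)); [|nra].
        assert ((Rabs L + 1) * (s - t) <= (Rabs L + 1) * d') by (apply Rmult_le_compat_l; lra).
        nra. }
      unfold g in *; lra.
    + assert (Heta := Hdense t Ht Hs HP i Hi (eq_sym Heq)).
      fold B in Heta.
      destruct (Hder i t Hi Ht) as [s' [Hs' HD]].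
      rewrite (forward_jump_unique X t s' t Hs' Hs) in HD; clear s' Hs'.
      (* The admissible error is the difference of the two slopes, positive by strictness. *)
      destruct (HD (D i t + B * L)) as [d [Hd H]]; [lra|].
      exists d; split; trivial; intros r Hr s Hs' Hsr.
      assert (Hb := H s Hs'); rewrite Rabs_minus_sym, (Rabs_pos_eq (s - t)) in Hb by lra.
      specialize (Hb ltac:(lra)).
      apply (Rle_trans _ _ _ (Rle_abs _)) in Hb; specialize (Hlow s); nra.
  - intros t Ht Hld HP i Hi; apply Rnot_lt_le; intros Hlt.
    set (g := - (c * exp (L * (t - t0))) - y i t).
    assert (Hg : 0 < g) by (unfold g; lra).
    destruct (delta_deriv_cont X (y i) t (D i t) Ht (Hder i t Hi Ht) (g / 2)) as [d [Hd H]];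
      [lra|].
    destruct (exp_eps_delta (L * (t - t0)) (g / (2 * c))) as [d' [Hd' H']];
      [apply Rdiv_lt_0_compat; lra|].
    assert (HL := Rabs_pos L).
    set (d2 := d' / (Rabs L + 1)).
    assert (Hd2 : 0 < d2) by (apply Rdiv_lt_0_compat; lra).
    (* At a left-dense point a violation by [g] would already show at a nearby earlier [s], since
       [y i] and the barrier each change by less than [g / 2]. *)
    destruct (Hld (Rmin d d2)) as [s [Hs Hsd]]; [now apply Rmin_pos|].
    assert (t - s < d) by (assert (Hm := Rmin_l d d2); lra).
    assert (t - s < d2) by (assert (Hm := Rmin_r d d2); lra).
    assert (Hys : Rabs (y i s - y i t) < g / 2) by (apply H; trivial; rewrite Rabs_left1; lra).
    assert (Hes : Rabs (exp (L * (s - t0)) - exp (L * (t - t0))) < g / (2 * c)).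
    { apply H'; replace (L * (s - t0) - L * (t - t0)) with (L * (s - t)) by ring.
      rewrite Rabs_mult, (Rabs_left1 (s - t)) by lra.
      apply Rlt_le_trans with ((Rabs L + 1) * d2); [|right; unfold d2; field; lra].
      apply Rle_lt_trans with ((Rabs L + 1) * - (s - t)); [apply Rmult_le_compat_r; lra|].
      apply Rmult_lt_compat_l; lra. }
    assert (Hsi : - (c * exp (L * (s - t0))) <= y i s) by (apply HP; trivial; lra).
    apply Rabs_def2 in Hys; apply Rabs_def2 in Hes.
    assert (c * (exp (L * (s - t0)) - exp (L * (t - t0))) < c * (g / (2 * c)))
      by (apply Rmult_lt_compat_l; lra).
    replace (c * (g / (2 * c))) with (g / 2) in * by (field; lra).
    unfold g in *; lra.
Qed.

(** * Positivity, uniqueness and scalar comparison *)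

Lemma forward_jump_restrict (T : R -> Prop) (t0 t s : R) :
  t0 <= t -> forward_jump (restrict T t0) t s <-> forward_jump T t s.
Proof.
  intros Ht.
  assert (H : forall r, restrict T t0 r /\ t < r <-> T r /\ t < r).
  { intros r; unfold restrict; split; [tauto|]; intros [H1 H2]; repeat split; trivial; lra. }
  split; (intros [[[r Hr] [H1 H2]]|[Hn ->]];
    [left; split; [exists r; now apply H|split;
      [intros x Hx; apply H1; now apply H
      |intros m' Hm; apply H2; intros x Hx; apply Hm; now apply H]]
    |right; split; trivial; intros [r Hr]; apply Hn; exists r; now apply H]).
Qed.

Lemma restrict_start (T : R -> Prop) (t0 : R) : T t0 -> restrict T t0 t0.
Proof. intros H; split; [exact H|lra]. Qed.

Lemma grain_le (T : R -> Prop) (mub t0 t s : R) :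
  is_lub (grain_set T) mub -> restrict T t0 t -> forward_jump (restrict T t0) t s ->
  s - t <= mub.
Proof.
  intros [Hub _] [Ht Hle] Hs; apply Hub; exists t; split; trivial.
  exists s; split; trivial; now apply (forward_jump_restrict T t0 t s).
Qed.

(** The bound is strict because [L] serves as the rate of barriers, whose slopes must be beaten
    strictly. *)
Lemma row_sum_bound (n : nat) (M : nat -> nat -> R) :
  exists L, 0 < L /\ forall i, (i < n)%nat -> rsum n (fun j => Rabs (M i j)) < L.
Proof.
  exists (1 + rsum n (fun i => rsum n (fun j => Rabs (M i j)))).
  assert (Hrow : forall i, 0 <= rsum n (fun j => Rabs (M i j)))
    by (intros; apply rsum_ge0; intros; apply Rabs_pos).
  split.
  - assert (0 <= rsum n (fun i => rsum n (fun j => Rabs (M i j)))) by (apply rsum_ge0; auto); lra.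
  - intros i Hi.
    assert (rsum n (fun j => Rabs (M i j)) <= rsum n (fun i => rsum n (fun j => Rabs (M i j)))).
    { apply (rsum_term_le n (fun i => rsum n (fun j => Rabs (M i j)))); auto. }
    lra.
Qed.

Theorem metzler_positive_auto (T : R -> Prop) (n : nat) (M : nat -> nat -> R) (mub : R) :
  closed_set T -> is_lub (grain_set T) mub ->
  (forall i j, (i < n)%nat -> (j < n)%nat -> i <> j -> 0 <= M i j) ->
  (forall j, (j < n)%nat -> 0 <= 1 + mub * M j j) ->
  positive_auto T n M.
Proof.
  intros Hc Hlub Hoff Hdiag t0 x0 x H0 Hx0 [Hinit Hsol] t Ht Htt i Hi.
  destruct (row_sum_bound n M) as [L [HL Hrow]].
  assert (Hrow' : forall i, (i < n)%nat -> rsum n (fun j => M i j) < L).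
  { intros j Hj; eapply Rle_lt_trans; [|now apply (Hrow j)].
    apply rsum_le; intros; apply Rle_abs. }
  (* While [x >= -B], the shifted vector [x + B] is nonnegative, so a Metzler [M] maps it to at
     least its diagonal term; [B] times the row sum is then subtracted. *)
  assert (Hshift : forall u B k, (k < n)%nat -> (forall j, (j < n)%nat -> - B <= x u j) ->
     M k k * (x u k + B) - B * rsum n (fun j => M k j) <= mv n M (x u) k).
  { intros u B k Hk HB; unfold mv.
    assert (E : rsum n (fun j => M k j * (x u j + B)) =
                rsum n (fun j => M k j * x u j) + B * rsum n (fun j => M k j)).
    { rewrite <- rsum_scal_l, <- rsum_plus; apply rsum_ext; intros; ring. }
    assert (M k k * (x u k + B) <= rsum n (fun j => M k j * (x u j + B))); [|lra].
    apply (rsum_ge_term n (fun j => M k j * (x u j + B))); trivial.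
    intros j Hj Hjk; apply Rmult_le_pos; [now apply Hoff, not_eq_sym|].
    specialize (HB j Hj); lra. }
  assert (- x t i <= 0); [|lra].
  apply eps_mult_le_0 with (exp (L * (t - t0))); [|left; apply exp_pos].
  intros eps Heps.
  assert (HB : - (eps * exp (L * (t - t0))) <= x t i); [|lra].
  apply (exponential_barrier (restrict T t0) t0 nat (seq 0 n) (fun i t => x t i)
           (fun i t => mv n M (x t) i) eps L); trivial.
  - now apply closed_restrict.
  - now apply restrict_start.
  - intros u [_ Hu]; exact Hu.
  - intros j u Hj Hu; apply in_seq in Hj; apply Hsol; trivial; lia.
  - intros j Hj; apply in_seq in Hj; rewrite Hinit by lia.
    assert (0 <= x0 j) by (apply Hx0; lia); lra.
  - intros u s Hu Hs Hus HBj k Hk; apply in_seq in Hk.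
    set (B := eps * exp (L * (u - t0))) in *.
    assert (HB0 : 0 < B) by (apply Rmult_lt_0_compat; [exact Heps|apply exp_pos]).
    assert (Hb : forall j, (j < n)%nat -> - B <= x u j) by (intros; apply HBj, in_seq; lia).
    specialize (Hshift u B k ltac:(lia) Hb); specialize (Hb k ltac:(lia)).
    specialize (Hrow' k ltac:(lia)); specialize (Hdiag k ltac:(lia)).
    pose proof (grain_le T mub t0 u s Hlub Hu Hs) as Hmu.
    (* [1 + m * M k k] is affine in [m], so nonnegativity at 0 and at [mub] passes to every grain
       between them. *)
    assert (0 <= 1 + (s - u) * M k k) by (destruct (Rle_dec 0 (M k k)); nra).
    assert (He := exp_ineq1_le (L * (s - u))).
    set (m := s - u) in *; set (q := rsum n (fun j => M k j)) in *.
    assert (0 < m) by (unfold m; lra).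
    assert (m * (M k k * (x u k + B) - B * q) <= m * mv n M (x u) k)
      by (apply Rmult_le_compat_l; lra).
    assert (B * (1 + L * m) <= B * exp (L * m)) by (apply Rmult_le_compat_l; lra).
    assert (0 <= (1 + m * M k k) * (x u k + B)) by (apply Rmult_le_pos; lra).
    assert (B * m * q <= B * m * L) by (apply Rmult_le_compat_l; [|lra]; apply Rmult_le_pos; lra).
    nra.
  - intros u Hu Hs HBj k Hk Heq; apply in_seq in Hk.
    set (B := eps * exp (L * (u - t0))) in *.
    assert (HB0 : 0 < B) by (apply Rmult_lt_0_compat; [exact Heps|apply exp_pos]).
    assert (Hb : forall j, (j < n)%nat -> - B <= x u j) by (intros; apply HBj, in_seq; lia).
    specialize (Hshift u B k ltac:(lia) Hb); rewrite Heq in Hshift.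
    specialize (Hrow' k ltac:(lia)); nra.
  - now split.
  - apply in_seq; lia.
Qed.

Lemma auto_solution_comb (T : R -> Prop) (n : nat) (M : nat -> nat -> R) (t0 c d : R)
  (x0 y0 : nat -> R) (x y : R -> nat -> R) :
  auto_solution T n M t0 x0 x -> auto_solution T n M t0 y0 y ->
  auto_solution T n M t0 (fun i => c * x0 i + d * y0 i) (fun t i => c * x t i + d * y t i).
Proof.
  intros [Hx0 Hx] [Hy0 Hy]; split.
  - intros i Hi; now rewrite Hx0, Hy0.
  - intros t Ht i Hi.
    replace (mv n M (fun i => c * x t i + d * y t i) i) with
      (c * mv n M (x t) i + d * mv n M (y t) i).
    + apply (delta_deriv_plus _ (fun s => c * x s i) (fun s => d * y s i));
        [apply (delta_deriv_scal _ (fun s => x s i))|apply (delta_deriv_scal _ (fun s => y s i))];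
        auto.
    + unfold mv; rewrite <- !rsum_scal_l, <- rsum_plus; apply rsum_ext; intros; ring.
Qed.

Lemma auto_solution_zero (T : R -> Prop) (n : nat) (M : nat -> nat -> R) (t0 : R)
  (x0 : nat -> R) (x : R -> nat -> R) (t : R) (i : nat) :
  closed_set T -> T t0 -> (forall j, (j < n)%nat -> x0 j = 0) -> auto_solution T n M t0 x0 x ->
  restrict T t0 t -> (i < n)%nat -> x t i = 0.
Proof.
  intros Hc H0 Hz [Hinit Hsol] Ht Hi.
  destruct (row_sum_bound n M) as [L [HL Hrow]].
  (* The signs put [x] and [-x] into one family: with no sign condition on [M], a lower bound on [x]
     alone would not control [M x]. *)
  set (sg := fun b : bool => if b then 1 else -1).
  set (l := list_prod (true :: false :: nil) (seq 0 n)).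
  assert (Hl : forall b j, In (b, j) l <-> (j < n)%nat).
  { intros b j; unfold l; rewrite in_prod_iff, in_seq; destruct b; simpl; intuition lia. }
  assert (Hmv : forall u B k (b : bool), (k < n)%nat -> 0 < B ->
     (forall p, In p l -> - B <= sg (fst p) * x u (snd p)) ->
     - (B * L) < sg b * mv n M (x u) k).
  { intros u B k b Hk HB0 HB.
    assert (Ha : forall j, (j < n)%nat -> Rabs (x u j) <= B).
    { intros j Hj.
      assert (H1 := HB (true, j)); assert (H2 := HB (false, j)); simpl in H1, H2.
      apply Rabs_le; rewrite Hl in H1, H2; specialize (H1 Hj); specialize (H2 Hj); lra. }
    assert (Hm : Rabs (mv n M (x u) k) <= B * rsum n (fun j => Rabs (M k j))).
    { eapply Rle_trans; [apply rsum_abs|]; rewrite <- rsum_scal_l.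
      apply rsum_le; intros j Hj; rewrite Rabs_mult, Rmult_comm.
      apply Rmult_le_compat_r; [apply Rabs_pos|auto]. }
    assert (B * rsum n (fun j => Rabs (M k j)) < B * L) by (apply Rmult_lt_compat_l; auto).
    assert (Rabs (mv n M (x u) k) < B * L) as Hab by lra.
    apply Rabs_def2 in Hab; destruct b; simpl; lra. }
  assert (HB : forall b, sg b * x t i >= 0).
  { intros b.
    assert (- (sg b * x t i) <= 0); [|lra].
    apply eps_mult_le_0 with (exp (L * (t - t0))); [|left; apply exp_pos].
    intros eps Heps.
    assert (HB : - (eps * exp (L * (t - t0))) <= sg b * x t i); [|lra].
    apply (exponential_barrier (restrict T t0) t0 (bool * nat) l
             (fun p t => sg (fst p) * x t (snd p))
             (fun p t => sg (fst p) * mv n M (x t) (snd p)) eps L) with (i := (b, i)); trivial.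
    - now apply closed_restrict.
    - now apply restrict_start.
    - intros u [_ Hu]; exact Hu.
    - intros [b' j] u Hj Hu; apply Hl in Hj; simpl.
      apply (delta_deriv_scal _ (fun s => x s j)), Hsol; trivial.
    - intros [b' j] Hj; apply Hl in Hj; simpl; rewrite Hinit, Hz by trivial; lra.
    - intros u s Hu Hs Hus HBj [b' k] Hk; apply Hl in Hk; simpl.
      set (B := eps * exp (L * (u - t0))) in *.
      assert (HB0 : 0 < B) by (apply Rmult_lt_0_compat; [exact Heps|apply exp_pos]).
      specialize (Hmv u B k b' Hk HB0 HBj).
      assert (Hb := HBj (b', k)); simpl in Hb; rewrite Hl in Hb; specialize (Hb Hk).
      assert (He := exp_ineq1_le (L * (s - u))).
      assert (B * (1 + L * (s - u)) <= B * exp (L * (s - u))) by (apply Rmult_le_compat_l; lra).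
      assert ((s - u) * - (B * L) <= (s - u) * (sg b' * mv n M (x u) k))
        by (apply Rmult_le_compat_l; lra).
      nra.
    - intros u Hu Hs HBj [b' k] Hk Heq; apply Hl in Hk; simpl.
      apply Hmv; trivial; apply Rmult_lt_0_compat; [exact Heps|apply exp_pos].
    - now apply Hl. }
  assert (H1 := HB true); assert (H2 := HB false); simpl in H1, H2; lra.
Qed.

Lemma C_solution_unique (T : R -> Prop) (lam : C) (t0 : R) (z0 : C) (z w : R -> C) (t : R) :
  closed_set T -> T t0 -> C_solution T lam t0 z0 z -> C_solution T lam t0 z0 w ->
  restrict T t0 t -> z t = w t.
Proof.
  intros Hc H0 Hz Hw Ht.
  (* Multiplication by [lam] as a real 2 by 2 matrix, which reduces uniqueness to
     [auto_solution_zero]. *)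
  set (M := fun i j : nat => match i, j with
                             | O, O => fst lam | O, _ => - snd lam
                             | _, O => snd lam | _, _ => fst lam end).
  set (vec := fun (z : R -> C) t (i : nat) => match i with O => fst (z t) | _ => snd (z t) end).
  assert (Hvec : forall z, C_solution T lam t0 z0 z ->
    auto_solution T 2 M t0 (vec (fun _ => z0) t0) (vec z)).
  { clear; intros z [Hz0 Hz]; split.
    - intros [|i] _; simpl; now rewrite Hz0.
    - intros t Ht i Hi; destruct (Hz t Ht) as [H1 H2].
      destruct i as [|[|i]]; [| |lia]; unfold mv; simpl.
      + replace (0 + fst lam * fst (z t) + - snd lam * snd (z t)) with (fst (Cmul lam (z t)))
          by (unfold Cmul; simpl; ring); exact H1.
      + replace (0 + snd lam * fst (z t) + fst lam * snd (z t)) with (snd (Cmul lam (z t)))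
          by (unfold Cmul; simpl; ring); exact H2. }
  pose proof (auto_solution_comb T 2 M t0 1 (-1) _ _ _ _ (Hvec z Hz) (Hvec w Hw)) as Hd.
  assert (Hzero : forall i, (i < 2)%nat -> 1 * vec z t i + -1 * vec w t i = 0).
  { intros i Hi; apply (auto_solution_zero T 2 M t0 _ _ t i Hc H0) with (2 := Hd); trivial.
    intros; simpl; ring. }
  assert (H1 := Hzero 0%nat ltac:(lia)); assert (H2 := Hzero 1%nat ltac:(lia)).
  simpl in H1, H2; destruct (z t), (w t); simpl in *; f_equal; lra.
Qed.

(** Lets two solutions with different initial values be compared after cross-multiplying by these
    values, with no division in [C]. *)
Lemma C_solution_mul (T : R -> Prop) (lam zeta : C) (t0 : R) (z0 : C) (z : R -> C) :
  C_solution T lam t0 z0 z -> C_solution T lam t0 (Cmul z0 zeta) (fun t => Cmul (z t) zeta).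
Proof.
  intros [Hi Hz]; split; [now rewrite Hi|].
  intros t Ht; destruct (Hz t Ht) as [H1 H2]; split.
  - apply (delta_deriv_ext _ (fun s => fst zeta * fst (z s) + - snd zeta * snd (z s)));
      [intros; unfold Cmul; simpl; ring|].
    replace (fst (Cmul lam (Cmul (z t) zeta))) with
      (fst zeta * fst (Cmul lam (z t)) + - snd zeta * snd (Cmul lam (z t)))
      by (unfold Cmul; simpl; ring).
    apply (delta_deriv_plus _ (fun s => fst zeta * fst (z s)) (fun s => - snd zeta * snd (z s)));
      [apply (delta_deriv_scal _ (fun s => fst (z s)))|apply (delta_deriv_scal _ (fun s => snd (z s)))];
      trivial.
  - apply (delta_deriv_ext _ (fun s => snd zeta * fst (z s) + fst zeta * snd (z s)));
      [intros; unfold Cmul; simpl; ring|].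
    replace (snd (Cmul lam (Cmul (z t) zeta))) with
      (snd zeta * fst (Cmul lam (z t)) + fst zeta * snd (Cmul lam (z t)))
      by (unfold Cmul; simpl; ring).
    apply (delta_deriv_plus _ (fun s => snd zeta * fst (z s)) (fun s => fst zeta * snd (z s)));
      [apply (delta_deriv_scal _ (fun s => fst (z s)))|apply (delta_deriv_scal _ (fun s => snd (z s)))];
      trivial.
Qed.

Lemma scalar_growth (X : R -> Prop) (t0 lam : R) (f : R -> R) (t : R) :
  closed_set X -> X t0 -> (forall t, X t -> t0 <= t) -> 0 <= lam -> 0 <= f t0 ->
  (forall t, X t -> delta_deriv X f t (lam * f t)) -> X t -> f t0 <= f t.
Proof.
  intros Hc H0 Hmin Hlam Hf0 Hf Ht.
  (* The barrier is applied to [f - f t0]: as long as this is at least [-B], one has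
     [lam * f >= - lam * B], and the extra 1 makes the slope strict. *)
  set (L := lam + 1).
  assert (f t0 - f t <= 0); [|lra].
  apply eps_mult_le_0 with (exp (L * (t - t0))); [|left; apply exp_pos].
  intros eps Heps.
  assert (HB : - (eps * exp (L * (t - t0))) <= f t - f t0); [|lra].
  apply (exponential_barrier X t0 unit (tt :: nil) (fun _ t => f t - f t0)
           (fun _ t => lam * f t) eps L) with (i := tt); trivial.
  - intros i u _ Hu.
    replace (lam * f u) with (lam * f u + 0) by ring.
    apply (delta_deriv_plus X f (fun _ => - f t0)); [now apply Hf|apply delta_deriv_const].
  - intros; lra.
  - intros u s Hu Hs Hus HB i _.
    specialize (HB tt (or_introl eq_refl)); simpl in HB.
    set (B := eps * exp (L * (u - t0))) in *.
    assert (HB0 : 0 < B) by (apply Rmult_lt_0_compat; [exact Heps|apply exp_pos]).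
    assert (He := exp_ineq1_le (L * (s - u))).
    assert (B * (1 + L * (s - u)) <= B * exp (L * (s - u))) by (apply Rmult_le_compat_l; lra).
    assert (0 <= B * (s - u)) by (apply Rmult_le_pos; lra).
    assert (- B * lam <= lam * f u) by nra.
    assert ((s - u) * (- B * lam) <= (s - u) * (lam * f u)) by (apply Rmult_le_compat_l; lra).
    unfold L in *; nra.
  - intros u Hu Hs HB i _ Heq.
    set (B := eps * exp (L * (u - t0))) in *.
    assert (HB0 : 0 < B) by (apply Rmult_lt_0_compat; [exact Heps|apply exp_pos]).
    replace (f u) with (f t0 - B) by lra; unfold L; nra.
  - now left.
Qed.

Lemma scalar_decay (X : R -> Prop) (t0 al : R) (f D : R -> R) (t : R) :
  closed_set X -> X t0 -> (forall t, X t -> t0 <= t) -> 0 < al ->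
  (forall t, X t -> 0 <= f t) ->
  (forall t, X t -> delta_deriv X f t (D t)) -> (forall t, X t -> D t <= - al * f t) ->
  X t -> f t <= f t0 * exp (- (al / 2) * (t - t0)).
Proof.
  intros Hc H0 Hmin Hal Hf Hder HD Ht.
  (* Half of the rate buys the strict slope. Across a jump of size [m] the new value is at most
     [f u * (1 - al * m)], hence at most [f u * exp (L * m)], because [f u >= 0]. *)
  set (L := - (al / 2)).
  assert (f t - f t0 * exp (L * (t - t0)) <= 0); [|lra].
  apply eps_mult_le_0 with (exp (L * (t - t0))); [|left; apply exp_pos].
  intros eps Heps.
  assert (Hf0 := Hf t0 H0).
  (* The amplitude [f t0 + eps] is positive even if [f t0 = 0]. *)
  assert (HB : - ((f t0 + eps) * exp (L * (t - t0))) <= -1 * f t); [|lra].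
  apply (exponential_barrier X t0 unit (tt :: nil) (fun _ t => -1 * f t)
           (fun _ t => -1 * D t) (f t0 + eps) L) with (i := tt); trivial.
  - lra.
  - intros i u _ Hu; now apply delta_deriv_scal, Hder.
  - intros; lra.
  - intros u s Hu Hs Hus HB i _.
    specialize (HB tt (or_introl eq_refl)); simpl in HB.
    set (B := (f t0 + eps) * exp (L * (u - t0))) in *.
    assert (He := exp_ineq1_le (L * (s - u))).
    specialize (HD u Hu); specialize (Hf u Hu).
    assert (f u * exp (L * (s - u)) <= B * exp (L * (s - u)))
      by (apply Rmult_le_compat_r; [left; apply exp_pos|lra]).
    assert (f u * (1 + L * (s - u)) <= f u * exp (L * (s - u))) by (apply Rmult_le_compat_l; lra).
    assert ((s - u) * D u <= (s - u) * (- al * f u)) by (apply Rmult_le_compat_l; lra).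
    assert (0 <= al * f u * (s - u)) by (repeat apply Rmult_le_pos; lra).
    unfold L in *; lra.
  - intros u Hu Hs HB i _ Heq.
    set (B := (f t0 + eps) * exp (L * (u - t0))) in *.
    assert (HB0 : 0 < B) by (apply Rmult_lt_0_compat; [lra|apply exp_pos]).
    specialize (HD u Hu); replace (f u) with B in HD by lra; unfold L; nra.
  - now left.
Qed.

(** * Sign conditions forced by positivity *)

Lemma nonneg_delta_deriv (X : R -> Prop) (f : R -> R) (t D : R) :
  X t -> (exists r, X r /\ t < r) -> closed_set X -> f t = 0 -> (forall s, X s -> 0 <= f s) ->
  delta_deriv X f t D -> 0 <= D.
Proof.
  intros Ht Hr Hc Hft Hf HfD; destruct (HfD) as [s [Hs HD]].
  destruct (Rle_lt_or_eq_dec t s (forward_jump_ge X t s Hs)) as [Hlt|<-].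
  - pose proof (delta_deriv_jump X f t s D Ht Hs HfD) as Hj.
    assert (0 <= f s) by (apply Hf; now apply (forward_jump_in X t)); nra.
  - apply Rnot_lt_le; intros HD0.
    (* With this error a negative [D] would give [f r <= D / 2 * (r - t) < 0] just to the right of
       [t]. *)
    destruct (HD (- D / 2)) as [d [Hd H]]; [lra|].
    assert (exists r, X r /\ t < r < t + d) as [r [Hr1 Hr2]].
    { apply NNPP; intros Hno.
      destruct Hs as [[_ [_ Hg]]|[Hn _]]; [|contradiction].
      assert (t + d <= t); [|lra].
      apply Hg; intros x [Hx Htx]; apply Rnot_lt_le; intros Hxd; apply Hno; exists x; auto. }
    assert (Hb := H r Hr1); rewrite Rabs_minus_sym, (Rabs_pos_eq (r - t)) in Hb by lra.
    specialize (Hb ltac:(lra)); rewrite Hft in Hb.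
    assert (0 <= f r) by auto.
    rewrite Rabs_left1 in Hb by nra; nra.
Qed.

Lemma unbounded_restrict (T : R -> Prop) (t0 t : R) :
  unbounded_above T -> exists r, restrict T t0 r /\ t < r.
Proof.
  intros Hu; destruct (Hu (Rmax t t0)) as [r [Hr Hlt]]; exists r.
  assert (H1 := Rmax_l t t0); assert (H2 := Rmax_r t t0).
  repeat split; trivial; lra.
Qed.

Definition unit_vec (j i : nat) : R := if Nat.eq_dec i j then 1 else 0.

Lemma mv_unit_vec (n : nat) (M : nat -> nat -> R) (i j : nat) :
  (j < n)%nat -> mv n M (unit_vec j) i = M i j.
Proof. intros Hj; unfold mv; apply (rsum_delta n j (fun k => M i k) Hj). Qed.

Lemma mv_ext (n : nat) (M : nat -> nat -> R) (x y : nat -> R) (i : nat) :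
  (forall j, (j < n)%nat -> x j = y j) -> mv n M x i = mv n M y i.
Proof. intros H; apply rsum_ext; intros j Hj; now rewrite H. Qed.

Lemma grain_sup_nonneg (T : R -> Prop) (mub : R) :
  is_time_scale T -> is_lub (grain_set T) mub -> 0 <= mub.
Proof.
  intros [[t Ht] _] [Hub _]; destruct (forward_jump_exists T t) as [s Hs].
  assert (s - t <= mub) by (apply Hub; exists t; split; trivial; now exists s).
  apply forward_jump_ge in Hs; lra.
Qed.

(** Solutions started at unit vectors are the tests. A coordinate [i] that starts at 0 and stays
    nonnegative has initial derivative [M i j >= 0]; across a grain [m] the coordinate [j] becomes
    [1 + m * M j j]. *)
Theorem positive_auto_metzler (T : R -> Prop) (n : nat) (M : nat -> nat -> R) (mub : R) :
  is_time_scale T -> unbounded_above T -> is_lub (grain_set T) mub ->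
  positive_auto T n M ->
  (forall i j, (i < n)%nat -> (j < n)%nat -> i <> j -> 0 <= M i j) /\
  (forall j, (j < n)%nat -> 0 <= 1 + mub * M j j).
Proof.
  intros HT Hunb Hlub Hpos; pose proof (grain_sup_nonneg T mub HT Hlub) as Hmub.
  destruct HT as [[t1 Ht1] Hc]; destruct Hlub as [Hub Hl].
  assert (Hunit : forall j, nonneg_vec n (unit_vec j)).
  { intros j i _; unfold unit_vec; destruct (Nat.eq_dec i j); lra. }
  split.
  - intros i j Hi Hj Hij.
    destruct (auto_solution_exists T n M t1 (unit_vec j) Hc Ht1) as [x Hx].
    pose proof (Hpos t1 _ x Ht1 (Hunit j) Hx) as Hp; destruct Hx as [Hinit Hsol].
    apply (nonneg_delta_deriv (restrict T t1) (fun s => x s i) t1).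
    + now apply restrict_start.
    + now apply unbounded_restrict.
    + now apply closed_restrict.
    + rewrite Hinit by trivial; unfold unit_vec; destruct (Nat.eq_dec i j); [contradiction|trivial].
    + intros s [Hs Hle]; now apply Hp.
    + rewrite <- (mv_unit_vec n M i j Hj), <- (mv_ext n M (x t1) (unit_vec j)) by auto.
      apply Hsol; trivial; now apply restrict_start.
  - intros j Hj; apply Rnot_lt_le; intros Hneg.
    assert (Hgr : forall m, grain_set T m -> 0 <= 1 + m * M j j).
    { intros m [t [Ht [s [Hs ->]]]].
      destruct (auto_solution_exists T n M t (unit_vec j) Hc Ht) as [x Hx].
      pose proof (Hpos t _ x Ht (Hunit j) Hx) as Hp; destruct Hx as [Hinit Hsol].
      assert (Hs' : forward_jump (restrict T t) t s) by (apply forward_jump_restrict; [lra|trivial]).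
      pose proof (restrict_start T t Ht) as Hr.
      pose proof (delta_deriv_jump (restrict T t) (fun s => x s j) t s _ Hr Hs' (Hsol t Hr j Hj)) as Hd.
      rewrite (mv_ext n M (x t) (unit_vec j)), (mv_unit_vec n M j j Hj) in Hd by auto.
      cbv beta in Hd; rewrite Hinit in Hd by trivial.
      unfold unit_vec in Hd; destruct (Nat.eq_dec j j); [|contradiction].
      rewrite <- Hd; apply Hp; trivial.
      - now apply (forward_jump_in T t).
      - now apply (forward_jump_ge T). }
    assert (HM : M j j < 0) by nra.
    (* The bound holds for every grain, hence for their supremum, attained or not. *)
    assert (mub <= - / M j j).
    { apply Hl; intros m Hm; specialize (Hgr m Hm).
      apply Rmult_le_reg_r with (- M j j); [lra|].
      replace (- / M j j * - M j j) with 1 by (field; lra); lra. }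
    assert (mub * - M j j <= - / M j j * - M j j) by (apply Rmult_le_compat_r; lra).
    replace (- / M j j * - M j j) with 1 in * by (field; lra); lra.
Qed.

Lemma piecewise_cont_const (T : R -> Prop) (c : R) : piecewise_cont T (fun _ => c).
Proof.
  assert (H : forall e, 0 < e -> Rabs (c - c) < e)
    by (intros; rewrite Rminus_diag, Rabs_R0; trivial).
  split.
  - intros u v; exists nil; intros t _ _ _ e He; exists 1; split; [lra|auto].
  - intros t _; split; exists c; intros e He; exists 1; split; try lra; auto.
Qed.

(* A constant control is absorbed into the state as an extra coordinate with zero derivative. *)
Lemma ctrl_solution_const_exists (T : R -> Prop) (n : nat) (A : nat -> nat -> R) (b : nat -> R)
  (c t0 : R) (x0 : nat -> R) :
  closed_set T -> T t0 -> exists x, ctrl_solution T n A b (fun _ => c) t0 x0 x.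
Proof.
  intros Hc H0.
  set (M := fun i j => if Nat.eq_dec i n then 0 else if Nat.eq_dec j n then b i else A i j).
  set (y0 := fun i => if Nat.eq_dec i n then c else x0 i).
  destruct (auto_solution_exists T (S n) M t0 y0 Hc H0) as [y [Hinit Hsol]].
  assert (Hlast : forall t, restrict T t0 t -> y t n = c).
  { intros t Ht.
    (* [y n - c] has zero derivative and zero initial value, so uniqueness for the zero matrix
       applies. *)
    assert (Hd : auto_solution T 1 (fun _ _ => 0) t0 (fun _ => 0) (fun t _ => y t n - c)).
    { split.
      - intros i _; rewrite Hinit by lia; unfold y0; destruct (Nat.eq_dec n n); [ring|contradiction].
      - intros s Hs i _.
        assert (E : mv 1 (fun _ _ => 0) (fun _ => y s n - c) i = mv (S n) M (y s) n + 0).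
        { unfold mv at 2; rewrite rsum_zero; [unfold mv; simpl; ring|].
          intros j _; unfold M; destruct (Nat.eq_dec n n); [ring|contradiction]. }
        rewrite E; apply (delta_deriv_plus _ (fun s => y s n) (fun _ => - c));
          [apply Hsol; trivial; lia|apply delta_deriv_const]. }
    assert (y t n - c = 0); [|lra].
    apply (auto_solution_zero T 1 (fun _ _ => 0) t0 (fun _ => 0) (fun t _ => y t n - c) t 0); auto. }
  assert (Hmv : forall t i, restrict T t0 t -> (i < n)%nat ->
    mv (S n) M (y t) i = mv n A (y t) i + b i * c).
  { intros t i Ht Hi; unfold mv; simpl; rewrite (Hlast t Ht); f_equal.
    - apply rsum_ext; intros j Hj; unfold M.
      destruct (Nat.eq_dec i n); [lia|]; destruct (Nat.eq_dec j n); [lia|reflexivity].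
    - unfold M; destruct (Nat.eq_dec i n); [lia|]; destruct (Nat.eq_dec n n); [reflexivity|lia]. }
  exists y; repeat split.
  - intros i Hi; rewrite Hinit by lia; unfold y0; destruct (Nat.eq_dec i n); [lia|reflexivity].
  - intros i Hi t Ht; apply (delta_deriv_cont _ _ t (mv (S n) M (y t) i)); trivial.
    apply Hsol; trivial; lia.
  - intros t Ht _ i Hi; rewrite <- Hmv by trivial; apply Hsol; trivial; lia.
Qed.

Theorem positive_ctrl_auto (T : R -> Prop) (n : nat) (A : nat -> nat -> R) (b : nat -> R) :
  positive_ctrl T n A b -> positive_auto T n A.
Proof.
  intros Hpos t0 x0 x H0 Hx0 [Hinit Hsol].
  apply (Hpos t0 (fun _ => 0) x0 x); trivial.
  - apply piecewise_cont_const.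
  - intros; lra.
  - repeat split; trivial.
    + intros i Hi t Ht; apply (delta_deriv_cont _ _ t (mv n A (x t) i)); auto.
    + intros t Ht _ i Hi; rewrite Rmult_0_r, Rplus_0_r; auto.
Qed.

(** Under the control 1 the state started at 0 has initial derivative [b]. *)
Theorem positive_ctrl_input (T : R -> Prop) (n : nat) (A : nat -> nat -> R) (b : nat -> R) (i : nat) :
  is_time_scale T -> unbounded_above T -> positive_ctrl T n A b -> (i < n)%nat -> 0 <= b i.
Proof.
  intros [[t0 H0] Hc] Hunb Hpos Hi.
  destruct (ctrl_solution_const_exists T n A b 1 t0 (fun _ => 0) Hc H0) as [x Hx].
  assert (Hp : forall t, T t -> t0 <= t -> nonneg_vec n (x t)).
  { apply (Hpos t0 (fun _ => 1) (fun _ => 0) x); trivial.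
    - apply piecewise_cont_const.
    - intros; lra.
    - intros j _; lra. }
  destruct Hx as (Hinit & _ & Hsol).
  pose proof (restrict_start T t0 H0) as Hr.
  apply (nonneg_delta_deriv (restrict T t0) (fun s => x s i) t0); trivial.
  - now apply unbounded_restrict.
  - now apply closed_restrict.
  - now apply Hinit.
  - intros s [Hs Hle]; now apply Hp.
  - replace (b i) with (mv n A (x t0) i + b i * 1).
    + apply Hsol; trivial; right.
      intros e He; exists 1; split; [lra|]; intros; rewrite Rminus_diag, Rabs_R0; trivial.
    + unfold mv; rewrite rsum_zero; [ring|].
      intros j Hj; rewrite Hinit by trivial; ring.
Qed.

(** * Exponential stability, certificates and eigenvalues *)

Lemma exp_decay_below (T : R -> Prop) (t0 al B c : R) :
  unbounded_above T -> 0 < al -> 0 < c -> 0 <= B ->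
  exists t, restrict T t0 t /\ B * exp (- (al * (t - t0))) < c.
Proof.
  intros Hu Hal Hc HB.
  (* After this time [u = al * (t - t0)] exceeds [B / c], and [exp u >= 1 + u]. *)
  destruct (unbounded_restrict T t0 (t0 + B / (al * c)) Hu) as [t [Ht Hlt]].
  exists t; split; trivial.
  assert (Hac : 0 < al * c) by now apply Rmult_lt_0_compat.
  assert (HB' : 0 <= B / (al * c)).
  { apply Rmult_le_pos; trivial; left; now apply Rinv_0_lt_compat. }
  set (u := al * (t - t0)).
  assert (Hu0 : 0 < u) by (apply Rmult_lt_0_compat; lra).
  assert (HBu : B < c * u).
  { unfold u; apply Rle_lt_trans with (al * c * (B / (al * c))).
    - right; field; split; lra.
    - replace (c * (al * (t - t0))) with (al * c * (t - t0)) by ring.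
      apply Rmult_lt_compat_l; lra. }
  rewrite exp_Ropp.
  assert (He := exp_ineq1_le u).
  apply Rmult_lt_reg_r with (exp u); [apply exp_pos|].
  replace (B * / exp u * exp u) with B by (field; assert (H := exp_pos u); lra).
  nra.
Qed.

Lemma vnorm_ge_abs (n : nat) (x : nat -> R) (i : nat) : (i < n)%nat -> Rabs (x i) <= vnorm n x.
Proof.
  intros Hi; unfold vnorm; rewrite <- sqrt_Rsqr_abs; apply sqrt_le_1_alt.
  replace (Rsqr (x i)) with (x i ^ 2) by (unfold Rsqr; ring).
  apply (rsum_term_le n (fun i => x i ^ 2)); trivial; intros; apply pow2_ge_0.
Qed.

Lemma vnorm_le_sum (n : nat) (x : nat -> R) : vnorm n x <= rsum n (fun i => Rabs (x i)).
Proof.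
  assert (H0 : forall m, 0 <= rsum m (fun i => Rabs (x i)))
    by (intros; apply rsum_ge0; intros; apply Rabs_pos).
  rewrite <- (sqrt_Rsqr (rsum n (fun i => Rabs (x i)))) by apply H0.
  apply sqrt_le_1_alt; unfold Rsqr; induction n as [|n IH]; simpl; [lra|].
  specialize (H0 n); assert (Ha := Rabs_pos (x n)).
  assert (E : x n * (x n * 1) = Rabs (x n) * Rabs (x n)).
  { rewrite <- Rabs_mult, Rabs_pos_eq; [ring|apply Rle_0_sqr]. }
  simpl in IH; nra.
Qed.

Lemma vnorm_pos (n : nat) (x : nat -> R) : 0 <= vnorm n x.
Proof. apply sqrt_pos. Qed.

Lemma linear_form_bound (n : nat) (w x : nat -> R) :
  Rabs (rsum n (fun i => w i * x i)) <= rsum n (fun i => Rabs (w i)) * vnorm n x.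
Proof.
  eapply Rle_trans; [apply rsum_abs|].
  rewrite Rmult_comm, <- rsum_scal_l; apply rsum_le; intros i Hi.
  rewrite Rabs_mult, Rmult_comm; apply Rmult_le_compat_r; [apply Rabs_pos|now apply vnorm_ge_abs].
Qed.

Lemma vnorm_scaled_unit (n : nat) (d : R) (j : nat) : 0 <= d -> (j < n)%nat ->
  vnorm n (fun i => d * unit_vec j i) = d.
Proof.
  intros Hd Hj; apply Rle_antisym.
  - eapply Rle_trans; [apply vnorm_le_sum|]; right.
    rewrite (rsum_ext n _ (fun i => d * (if Nat.eq_dec i j then 1 else 0))).
    + now rewrite (rsum_delta n j (fun _ => d)).
    + intros i _; unfold unit_vec; rewrite Rabs_pos_eq; trivial.
      destruct (Nat.eq_dec i j); lra.
  - eapply Rle_trans; [|apply (vnorm_ge_abs n _ j Hj)]; unfold unit_vec.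
    destruct (Nat.eq_dec j j); [|contradiction]; rewrite Rmult_1_r; apply Rle_abs.
Qed.

(** Stability is granted only near 0, so the nonnegative test vectors are small multiples of unit
    vectors. *)
Lemma open_Rn_unit (n : nat) (V : (nat -> R) -> Prop) :
  open_Rn n V -> V (fun _ => 0) ->
  exists d, 0 < d /\ forall j, (j < n)%nat -> V (fun i => d * unit_vec j i).
Proof.
  intros Ho H0; destruct (Ho _ H0) as [r [Hr H]]; exists (r / 2); split; [lra|].
  intros j Hj; apply H.
  replace (vnorm n (fun i => r / 2 * unit_vec j i - 0)) with (vnorm n (fun i => r / 2 * unit_vec j i)).
  - rewrite vnorm_scaled_unit; trivial; lra.
  - unfold vnorm; f_equal; apply rsum_ext; intros; ring.
Qed.

Lemma scaled_unit_nonneg (n : nat) (d : R) (j : nat) :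
  0 <= d -> nonneg_vec n (fun i => d * unit_vec j i).
Proof. intros Hd i _; unfold unit_vec; destruct (Nat.eq_dec i j); lra. Qed.

Lemma linear_form_unit (n : nat) (w : nat -> R) (d : R) (j : nat) : (j < n)%nat ->
  rsum n (fun i => w i * (d * unit_vec j i)) = d * w j.
Proof.
  intros Hj; rewrite (rsum_ext n _ (fun i => d * w i * (if Nat.eq_dec i j then 1 else 0))).
  - exact (rsum_delta n j (fun i => d * w i) Hj).
  - intros; unfold unit_vec; ring.
Qed.

Lemma linear_form_deriv (T : R -> Prop) (n : nat) (M : nat -> nat -> R) (t0 : R)
  (x0 : nat -> R) (x : R -> nat -> R) (w : nat -> R) (t : R) :
  auto_solution T n M t0 x0 x -> restrict T t0 t ->
  delta_deriv (restrict T t0) (fun s => rsum n (fun i => w i * x s i)) t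
    (rsum n (fun j => rsum n (fun i => w i * M i j) * x t j)).
Proof.
  intros [_ Hsol] Ht.
  replace (rsum n (fun j => rsum n (fun i => w i * M i j) * x t j)) with
    (rsum n (fun i => w i * mv n M (x t) i)).
  - apply delta_deriv_rsum; auto.
  - unfold mv.
    rewrite (rsum_ext n (fun i => w i * _) (fun i => rsum n (fun j => w i * M i j * x t j))).
    + rewrite rsum_exchange; apply rsum_ext; intros j Hj.
      rewrite Rmult_comm, <- rsum_scal_l; apply rsum_ext; intros; ring.
    + intros i Hi; rewrite <- rsum_scal_l; apply rsum_ext; intros; ring.
Qed.

Theorem pos_UES_left_eigenvalue_neg (T : R -> Prop) (n : nat) (M : nat -> nat -> R) (lam : R)
  (w : nat -> R) (j : nat) :
  is_time_scale T -> unbounded_above T -> pos_UES T n M ->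
  (forall k, (k < n)%nat -> rsum n (fun i => w i * M i k) = lam * w k) ->
  (j < n)%nat -> w j <> 0 -> lam < 0.
Proof.
  intros [[t0 H0] Hc] Hunb (K & al & V & HK & Hal & HV & HV0 & Hues) Hw Hj Hwj.
  apply Rnot_le_lt; intros Hlam.
  destruct (open_Rn_unit n V HV HV0) as [d [Hd HVd]].
  destruct (auto_solution_exists T n M t0 (fun i => d * unit_vec j i) Hc H0) as [x Hx].
  (* Multiplying [w] by [w j] fixes the sign: at [unit_vec j] the form takes the value
     [w j * w j > 0], so it starts positive on a nonnegative state. *)
  set (v := fun i => w j * w i).
  set (f := fun s => rsum n (fun i => v i * x s i)).
  pose proof (restrict_start T t0 H0) as Hr.
  assert (Hf0 : f t0 = d * (w j * w j)).
  { unfold f; rewrite (rsum_ext n _ (fun i => v i * (d * unit_vec j i))).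
    - now rewrite linear_form_unit.
    - intros i Hi; destruct Hx as [Hinit _]; now rewrite Hinit. }
  assert (Hf0' : 0 < f t0) by (rewrite Hf0; assert (0 < w j * w j) by nra; nra).
  set (W := rsum n (fun i => Rabs (v i))).
  assert (HW : 0 <= W) by (apply rsum_ge0; intros; apply Rabs_pos).
  destruct (exp_decay_below T t0 al (W * K * d) (f t0)) as [t [Ht Hlt]]; trivial.
  { repeat apply Rmult_le_pos; lra. }
  assert (Hgrow : f t0 <= f t).
  { apply (scalar_growth (restrict T t0) t0 lam); trivial.
    - now apply closed_restrict.
    - intros s [_ Hs]; exact Hs.
    - lra.
    - intros s Hs; replace (lam * f s) with
        (rsum n (fun k => rsum n (fun i => v i * M i k) * x s k)).
      + now apply (linear_form_deriv T n M t0 (fun i => d * unit_vec j i)).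
      + unfold f; rewrite <- rsum_scal_l; apply rsum_ext; intros k Hk; unfold v.
        rewrite (rsum_ext n _ (fun i => w j * (w i * M i k))) by (intros; ring).
        rewrite rsum_scal_l, Hw by trivial; ring. }
  assert (Hbd : f t <= W * vnorm n (x t)).
  { eapply Rle_trans; [apply Rle_abs|apply linear_form_bound]. }
  assert (Hx' : vnorm n (x t) <= K * exp (- (al * (t - t0))) * d).
  { rewrite <- (vnorm_scaled_unit n d j) by (trivial; lra).
    apply (Hues t0 t (fun i => d * unit_vec j i) x); trivial; try apply Ht.
    - now apply HVd.
    - apply scaled_unit_nonneg; lra. }
  assert (W * vnorm n (x t) <= W * (K * exp (- (al * (t - t0))) * d))
    by (apply Rmult_le_compat_l; trivial).
  lra.
Qed.

Lemma Cnorm_mul (z w : C) : Cnorm (Cmul z w) = Cnorm z * Cnorm w.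
Proof.
  unfold Cnorm; rewrite <- sqrt_mult by (apply Rplus_le_le_0_compat; apply pow2_ge_0).
  f_equal; unfold Cmul; simpl; ring.
Qed.

Lemma Cnorm_le_abs (z : C) : Cnorm z <= Rabs (fst z) + Rabs (snd z).
Proof.
  assert (H1 := Rabs_pos (fst z)); assert (H2 := Rabs_pos (snd z)).
  unfold Cnorm; rewrite <- (sqrt_Rsqr (Rabs (fst z) + Rabs (snd z))) by lra.
  apply sqrt_le_1_alt; unfold Rsqr.
  rewrite <- (pow2_abs (fst z)), <- (pow2_abs (snd z)); nra.
Qed.

Theorem nonneg_not_in_S (T : R -> Prop) (lam : R) :
  is_time_scale T -> unbounded_above T -> 0 <= lam -> ~ in_S T (RtoC lam).
Proof.
  intros [[t0 H0] Hc] Hunb Hlam (K & al & V & HK & Hal & HV & HV0 & Hst).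
  destruct (HV C0 HV0) as [r [Hr Hball]].
  set (d := r / 2); assert (Hd : 0 < d) by (unfold d; lra).
  assert (Hnd : forall y, 0 <= y -> Cnorm (y, 0) = y).
  { intros y Hy; unfold Cnorm; simpl.
    replace (y * (y * 1) + 0 * (0 * 1)) with (Rsqr y) by (unfold Rsqr; ring).
    now apply sqrt_Rsqr. }
  destruct (auto_solution_exists T 1 (fun _ _ => lam) t0 (fun _ => d) Hc H0) as [x [Hinit Hsol]].
  assert (Hder : forall s, restrict T t0 s ->
    delta_deriv (restrict T t0) (fun s => x s 0%nat) s (lam * x s 0%nat)).
  { intros s Hs; replace (lam * x s 0%nat) with (mv 1 (fun _ _ => lam) (x s) 0)
      by (unfold mv; simpl; ring); apply Hsol; trivial; lia. }
  assert (Hx0 : x t0 0%nat = d) by (apply Hinit; lia).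
  destruct (exp_decay_below T t0 al (K * d) d) as [t [Ht Hlt]]; trivial.
  { apply Rmult_le_pos; lra. }
  assert (Hgrow : d <= x t 0%nat).
  { rewrite <- Hx0; apply (scalar_growth (restrict T t0) t0 lam (fun s => x s 0%nat)); trivial.
    - now apply closed_restrict.
    - now apply restrict_start.
    - intros s [_ Hs]; exact Hs.
    - lra. }
  assert (Hb : Cnorm (x t 0%nat, 0) <= K * exp (- (al * (t - t0))) * Cnorm (d, 0)).
  { apply (Hst t0 t (d, 0) (fun s => (x s 0%nat, 0))); trivial; try apply Ht.
    - apply Hball; simpl; rewrite !Rminus_0_r, Hnd by lra; unfold d; lra.
    - split; [now rewrite Hx0|]; intros s Hs; simpl; split.
      + replace (lam * x s 0%nat - 0 * 0) with (lam * x s 0%nat) by ring; auto.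
      + replace (lam * 0 + 0 * x s 0%nat) with 0 by ring; apply delta_deriv_const. }
  rewrite !Hnd in Hb by lra; lra.
Qed.

(** The form [p + i q] turns the solution started at [d * unit_vec j] into a solution of
    [z^Delta = lam z] with nonzero initial value, and uniqueness makes every other solution
    proportional to it. Neither [j] nor [d] depends on [t0], so the constants are uniform. *)
Theorem left_eigenvalue_in_S (T : R -> Prop) (n : nat) (M : nat -> nat -> R) (lam : C)
  (p q : nat -> R) (j : nat) :
  is_time_scale T -> pos_UES T n M ->
  (forall k, (k < n)%nat ->
     rsum n (fun i => p i * M i k) = fst lam * p k - snd lam * q k) ->
  (forall k, (k < n)%nat ->
     rsum n (fun i => q i * M i k) = fst lam * q k + snd lam * p k) ->
  (j < n)%nat -> (p j, q j) <> C0 -> in_S T lam.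
Proof.
  intros [_ Hc] (K & al & V & HK & Hal & HV & HV0 & Hues) Hp Hq Hj Hne.
  destruct (open_Rn_unit n V HV HV0) as [d [Hd HVd]].
  set (N := Cnorm (p j, q j)).
  assert (HN : 0 < N).
  { apply sqrt_lt_R0; simpl.
    destruct (Req_dec (p j) 0) as [E1|E1]; destruct (Req_dec (q j) 0) as [E2|E2]; try nra.
    exfalso; apply Hne; now rewrite E1, E2. }
  set (W := rsum n (fun i => Rabs (p i)) + rsum n (fun i => Rabs (q i))).
  assert (HW : 0 <= W).
  { apply Rplus_le_le_0_compat; apply rsum_ge0; intros; apply Rabs_pos. }
  (* Up to the exponential, [W * K * d] bounds the decaying form, whose initial modulus is [d * N];
     the maximum meets the requirement that the constant be at least 1. *)
  exists (Rmax 1 (W * K / N)), al, (fun _ => True).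
  split; [apply Rmax_l|]; split; [exact Hal|].
  split; [intros z _; exists 1; split; [lra|trivial]|]; split; [trivial|].
  intros t0 t z0 z H0 Ht Hle _ Hz.
  destruct (auto_solution_exists T n M t0 (fun i => d * unit_vec j i) Hc H0) as [x Hx].
  set (f := fun s => rsum n (fun i => p i * x s i)).
  set (g := fun s => rsum n (fun i => q i * x s i)).
  assert (Hfg : C_solution T lam t0 (d * p j, d * q j) (fun s => (f s, g s))).
  { split.
    - destruct Hx as [Hinit _]; unfold f, g.
      rewrite (rsum_ext n _ (fun i => p i * (d * unit_vec j i))), linear_form_unit
        by (trivial; intros; now rewrite Hinit).
      now rewrite (rsum_ext n _ (fun i => q i * (d * unit_vec j i))), linear_form_unit
        by (trivial; intros; now rewrite Hinit).
    - intros s Hs; simpl; split.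
      + replace (fst lam * f s - snd lam * g s) with
          (rsum n (fun k => rsum n (fun i => p i * M i k) * x s k)).
        * now apply (linear_form_deriv T n M t0 (fun i => d * unit_vec j i)).
        * unfold f, g.
          replace (fst lam * rsum n (fun i => p i * x s i) - snd lam * rsum n (fun i => q i * x s i))
            with (fst lam * rsum n (fun i => p i * x s i) + - snd lam * rsum n (fun i => q i * x s i))
            by ring.
          rewrite <- !rsum_scal_l, <- rsum_plus; apply rsum_ext; intros k Hk.
          rewrite Hp by trivial; ring.
      + replace (fst lam * g s + snd lam * f s) with
          (rsum n (fun k => rsum n (fun i => q i * M i k) * x s k)).
        * now apply (linear_form_deriv T n M t0 (fun i => d * unit_vec j i)).
        * unfold f, g.
          rewrite <- !rsum_scal_l, <- rsum_plus; apply rsum_ext; intros k Hk.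
          rewrite Hq by trivial; ring. }
  (* Both sides solve the equation, with initial value [z0] times that of the form. *)
  assert (Heq : Cmul (z t) (d * p j, d * q j) = Cmul (f t, g t) z0).
  { apply (C_solution_unique T lam t0 (Cmul z0 (d * p j, d * q j))
             (fun t => Cmul (z t) (d * p j, d * q j)) (fun t => Cmul (f t, g t) z0)); trivial.
    - now apply C_solution_mul.
    - replace (Cmul z0 (d * p j, d * q j)) with (Cmul (d * p j, d * q j) z0).
      + now apply (C_solution_mul T lam z0 t0 _ (fun s => (f s, g s))).
      + unfold Cmul; simpl; f_equal; ring.
    - now split. }
  apply (f_equal Cnorm) in Heq; rewrite !Cnorm_mul in Heq.
  assert (Hdn : Cnorm (d * p j, d * q j) = d * N).
  { replace (d * p j, d * q j) with (Cmul (d, 0) (p j, q j)) by (unfold Cmul; simpl; f_equal; ring).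
    rewrite Cnorm_mul; f_equal; unfold Cnorm; simpl.
    replace (d * (d * 1) + 0 * (0 * 1)) with (Rsqr d) by (unfold Rsqr; ring).
    apply sqrt_Rsqr; lra. }
  rewrite Hdn in Heq.
  assert (Hx' : vnorm n (x t) <= K * exp (- (al * (t - t0))) * d).
  { rewrite <- (vnorm_scaled_unit n d j) by (trivial; lra).
    apply (Hues t0 t (fun i => d * unit_vec j i) x); trivial.
    - now apply HVd.
    - apply scaled_unit_nonneg; lra. }
  set (E := exp (- (al * (t - t0)))) in *.
  assert (HE : 0 < E) by apply exp_pos.
  assert (Hfg' : Cnorm (f t, g t) <= W * (K * E * d)).
  { eapply Rle_trans; [apply Cnorm_le_abs|]; simpl; unfold W.
    rewrite Rmult_plus_distr_r; apply Rplus_le_compat;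
      (eapply Rle_trans; [apply linear_form_bound|]);
      (apply Rmult_le_compat_l; [apply rsum_ge0; intros; apply Rabs_pos|trivial]). }
  assert (Hz0 : 0 <= Cnorm z0) by apply sqrt_pos.
  assert (Hle' : Cnorm (z t) * (d * N) <= W * (K * E * d) * Cnorm z0)
    by (rewrite Heq; now apply Rmult_le_compat_r).
  apply Rle_trans with (W * K / N * E * Cnorm z0).
  - apply Rmult_le_reg_r with (d * N); [now apply Rmult_lt_0_compat|].
    eapply Rle_trans; [exact Hle'|]; right; field; lra.
  - apply Rmult_le_compat_r; trivial; apply Rmult_le_compat_r; [lra|apply Rmax_r].
Qed.

Lemma finite_min (n : nat) (f : nat -> R) : (forall i, (i < n)%nat -> 0 < f i) ->
  exists m, 0 < m /\ forall i, (i < n)%nat -> m <= f i.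
Proof.
  intros H; induction n as [|n IH]; [exists 1; split; [lra|lia]|].
  destruct IH as [m [Hm Hi]]; [intros; apply H; lia|].
  exists (Rmin m (f n)); split; [apply Rmin_pos; trivial; apply H; lia|].
  intros i Hlt; destruct (Nat.eq_dec i n) as [->|Hne]; [apply Rmin_r|].
  eapply Rle_trans; [apply Rmin_l|apply Hi; lia].
Qed.

Theorem pos_UES_of_left_certificate (T : R -> Prop) (n : nat) (M : nat -> nat -> R) (w : nat -> R) :
  is_time_scale T -> positive_auto T n M ->
  (forall i, (i < n)%nat -> 0 < w i) ->
  (forall j, (j < n)%nat -> rsum n (fun i => w i * M i j) < 0) ->
  pos_UES T n M.
Proof.
  intros [_ Hc] Hpos Hw HwM.
  destruct (finite_min n w Hw) as [m [Hm Hmin]].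
  set (W := rsum n w).
  assert (HW : forall i, (i < n)%nat -> w i <= W).
  { intros i Hi; apply rsum_term_le; trivial; intros; left; auto. }
  assert (HW0 : 0 <= W) by (apply rsum_ge0; intros; left; auto).
  (* This choice gives [w M <= - al * w], since [w j <= W]; the 1 guards the quotient when
     [n = 0]. *)
  destruct (finite_min n (fun j => - rsum n (fun i => w i * M i j) / (W + 1))) as [al [Hal Hdec]].
  { intros j Hj; specialize (HwM j Hj); apply Rdiv_lt_0_compat; lra. }
  assert (Hdec' : forall j, (j < n)%nat -> rsum n (fun i => w i * M i j) <= - al * w j).
  { intros j Hj; specialize (Hdec j Hj); specialize (HW j Hj); specialize (Hw j Hj).
    assert (al * (W + 1) <= - rsum n (fun i => w i * M i j)).
    { apply Rle_trans with (- rsum n (fun i => w i * M i j) / (W + 1) * (W + 1)).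
      - apply Rmult_le_compat_r; lra.
      - right; field; lra. }
    nra. }
  (* In terms of the norm, [W] bounds [w x0] from above and [m] bounds [w x] from below; half of
     [al] is lost in [scalar_decay]. *)
  exists (Rmax 1 (W / m)), (al / 2), (fun _ => True).
  split; [apply Rmax_l|]; split; [lra|].
  split; [intros z _; exists 1; split; [lra|trivial]|]; split; [trivial|].
  intros t0 t x0 x H0 Ht Hle _ Hx0 Hx.
  pose proof (Hpos t0 x0 x H0 Hx0 Hx) as Hnn.
  set (f := fun s => rsum n (fun i => w i * x s i)).
  assert (Hf : f t <= f t0 * exp (- (al / 2) * (t - t0))).
  { apply (scalar_decay (restrict T t0) t0 al f
             (fun s => rsum n (fun j => rsum n (fun i => w i * M i j) * x s j))); trivial.
    - now apply closed_restrict.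
    - now apply restrict_start.
    - intros s [_ Hs]; exact Hs.
    - intros s [Hs Hs']; apply rsum_ge0; intros i Hi; apply Rmult_le_pos; [left; auto|].
      now apply Hnn.
    - intros s Hs; now apply (linear_form_deriv T n M t0 x0).
    - intros s [Hs Hs']; unfold f; rewrite <- rsum_scal_l; apply rsum_le; intros i Hi.
      rewrite <- Rmult_assoc; apply Rmult_le_compat_r; [now apply Hnn|auto].
    - now split. }
  assert (Hlow : m * vnorm n (x t) <= f t).
  { apply Rle_trans with (m * rsum n (fun i => Rabs (x t i))).
    - apply Rmult_le_compat_l; [lra|apply vnorm_le_sum].
    - rewrite <- rsum_scal_l; apply rsum_le; intros i Hi.
      rewrite Rabs_pos_eq by now apply Hnn.
      apply Rmult_le_compat_r; [now apply Hnn|auto]. }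
  assert (Hup : f t0 <= W * vnorm n x0).
  { unfold f; rewrite (rsum_ext n _ (fun i => w i * x0 i)).
    - eapply Rle_trans; [apply Rle_abs|]; eapply Rle_trans; [apply linear_form_bound|].
      right; f_equal; apply rsum_ext; intros i Hi; apply Rabs_pos_eq; left; auto.
    - intros i Hi; destruct Hx as [Hinit _]; now rewrite Hinit. }
  replace (- (al / 2) * (t - t0)) with (- (al / 2 * (t - t0))) in Hf by ring.
  set (E := exp (- (al / 2 * (t - t0)))) in *.
  assert (HE : 0 < E) by apply exp_pos.
  assert (Hn0 := vnorm_pos n x0).
  apply Rle_trans with (W / m * E * vnorm n x0).
  - apply Rmult_le_reg_l with m; trivial.
    apply Rle_trans with (W * vnorm n x0 * E).
    + eapply Rle_trans; [exact Hlow|]; eapply Rle_trans; [exact Hf|].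
      apply Rmult_le_compat_r; lra.
    + right; field; lra.
  - apply Rmult_le_compat_r; trivial; apply Rmult_le_compat_r; [lra|apply Rmax_r].
Qed.

(** * Linear algebra and real polynomials *)

Fixpoint Cpow (z : C) (m : nat) : C :=
  match m with O => (1, 0) | S p => Cmul z (Cpow z p) end.

Module LinearAlgebra.
Import all_boot all_order all_algebra Rstruct complex polyrcf zify ring.
Import Order.TTheory GRing.Theory Num.Theory.
Local Open Scope ring_scope.
Local Delimit Scope R_scope with coqR.

(** Strict positivity is asked up to the degree only, a form stable under products; the zero
    polynomial has it vacuously. *)
Definition positive_coefs {F : rcfType} (p : {poly F}) := forall i, (i < size p)%N -> 0 < p`_i.

Lemma positive_coefs_ge0 (F : rcfType) (p : {poly F}) i : positive_coefs p -> 0 <= p`_i.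
Proof.
move=> pp; have [ltip|leip] := ltnP i (size p); first exact/ltW/pp.
by rewrite nth_default.
Qed.

Lemma positive_coefsM (F : rcfType) (p q : {poly F}) :
  positive_coefs p -> positive_coefs q -> positive_coefs (p * q).
Proof.
move=> pp pq i.
have [->|p0] := eqVneq p 0; first by rewrite mul0r size_poly0.
have [->|q0] := eqVneq q 0; first by rewrite mulr0 size_poly0.
have sp : (0 < size p)%N by rewrite size_poly_gt0.
have sq : (0 < size q)%N by rewrite size_poly_gt0.
rewrite size_mul // => lti.
(* One strictly positive term of the convolution is enough: [j] is at most the degree of [p] and
   [i - j] at most that of [q]. *)
pose j := minn i (size p).-1.
have ltj : (j < i.+1)%N by rewrite ltnS geq_minl.
rewrite coefM (bigD1 (Ordinal ltj)) //=.
apply: ltr_pwDl.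
- apply: mulr_gt0.
  + by apply: pp; rewrite /j; lia.
  + apply: pq; rewrite /j; move: sp sq lti; case: (size p) => [|a] //=; case: (size q) => [|c] //=; lia.
- by apply: sumr_ge0 => k _; apply: mulr_ge0; exact: positive_coefs_ge0.
Qed.

(* Peel off the linear or quadratic real factor of a complex root. *)
Lemma hurwitz_positive_coefs (F : rcfType) (p : {poly F}) :
  0 < lead_coef p ->
  (forall z : F[i], root (map_poly (real_complex F) p) z -> complex.Re z < 0) ->
  positive_coefs p.
Proof.
move: {2}(size p) (leqnn (size p)) => s; elim: s p => [|s IHs] p.
  by rewrite leqn0 size_poly_eq0 => /eqP->; rewrite lead_coef0 ltxx.
move=> sizep lcp rootp.
have p0 : p != 0 by rewrite -lead_coef_eq0 gt_eqF.
(* The induction step for any nonconstant monic factor [r]: the cofactor [q] is smaller and inherits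
   the leading sign and the condition on roots. *)
have peel (r q : {poly F}) : p = q * r -> (1 < size r)%N -> positive_coefs r -> r \is monic ->
    positive_coefs p.
  move=> pE sr posr monr; rewrite pE; apply: positive_coefsM => //.
  have q0 : q != 0 by apply: contraNneq p0 => q0; rewrite pE q0 mul0r.
  have sizeq : (size q <= s)%N.
    have r0 : r != 0 by rewrite monic_neq0.
    by move: sizep sr; rewrite pE size_mul //; move: (size q) (size r) => a c; lia.
  apply: IHs => //.
    by move: lcp; rewrite pE lead_coefM (monicP monr) mulr1.
  by move=> z rz; apply: rootp; rewrite pE rmorphM rootM rz.
have [size1|size_neq1] := eqVneq (size p) 1%N.
  by move=> i; rewrite size1 ltnS leqn0 => /eqP ->; move: lcp; rewrite lead_coefE size1.
have /closed_rootP [z rz] : size (map_poly (real_complex F) p) != 1%N by rewrite size_map_poly.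
have rez := rootp z rz.
have [imz|imz] := eqVneq (complex.Im z) 0.
  have zE : z = (complex.Re z)%:C%C by apply/eqP; rewrite eq_complex /= imz !eqxx.
  have rp : root p (complex.Re z).
    by move: rz; rewrite zE /root horner_map /= fmorph_eq0.
  have /factor_theorem [q pE] := rp.
  apply: (peel ('X - (complex.Re z)%:P) q pE); rewrite ?size_XsubC ?monicXsubC //.
  move=> [|[|i]]; rewrite size_XsubC // !coefE /= ?subr0 ?ltr01 //.
  by rewrite sub0r oppr_gt0.
(* The product of [X - z] and its conjugate. *)
pose r : {poly F} := 'X^2 + (- (complex.Re z *+ 2)) *: 'X + (complex.Re z ^+ 2 + complex.Im z ^+ 2)%:P.
have sr : size r = 3%N.
  rewrite /r -addrA size_polyDl size_polyXn //.
  rewrite (leq_ltn_trans (size_polyD _ _)) // gtn_max.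
  rewrite (leq_ltn_trans (size_scale_leq _ _)) ?size_polyX //=.
  by rewrite (leq_ltn_trans (size_polyC_leq1 _)).
have rE i : r`_i = nth 0 [:: complex.Re z ^+ 2 + complex.Im z ^+ 2; - (complex.Re z *+ 2); 1] i.
  by case: i => [|[|[|i]]]; rewrite !coefE /= ?mulr0 ?mulr1 ?addr0 ?add0r //; case: i.
have monr : r \is monic by rewrite monicE lead_coefE sr rE.
have posr : positive_coefs r.
  move=> [|[|[|i]]]; rewrite sr // rE /= ?ltr01 //.
    by rewrite ltr_wpDl ?sqr_ge0 // lt_def sqr_ge0 expf_neq0.
  by rewrite oppr_gt0 pmulrn_llt0.
have rootr : root (map_poly (real_complex F) r) z.
  rewrite /root /r !rmorphD /= map_polyXn map_polyZ /= map_polyX !map_polyC /=.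
  rewrite !hornerE /=; apply/eqP; case: (z) => x y /=.
  rewrite expr2; apply/eqP; rewrite eq_complex /=; simpc.
  by apply/andP; split; apply/eqP; ring.
(* The real remainder of degree at most 1 vanishes at the nonreal [z]; its imaginary and then its
   real part make both coefficients 0. *)
have rem0 : modp p r = 0.
  have szrem : (size (modp p r) <= 2)%N by rewrite -ltnS -sr ltn_modp -size_poly_eq0 sr.
  have rootrem : root (map_poly (real_complex F) (modp p r)) z.
    have /(congr1 (map_poly (real_complex F))) := divp_eq p r; rewrite rmorphD rmorphM /= => E.
    move: rz; rewrite E /root hornerD hornerM.
    by move/rootP: rootr => ->; rewrite mulr0 add0r.
  set t := modp p r in szrem rootrem *.
  have tE : t = t`_1 *: 'X + (t`_0)%:P.
    apply/polyP => -[|[|i]]; rewrite !coefE /= ?mulr0 ?mulr1 ?addr0 ?add0r //.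
    by rewrite nth_default // (leq_trans szrem).
  move: rootrem; rewrite tE /root rmorphD /= map_polyZ /= map_polyX map_polyC /= !hornerE /=.
  move: imz; case: (z) => x y /= y0.
  rewrite eq_complex /=; simpc => /andP[/eqP e1 /eqP e2].
  have t1 : t`_1 = 0 by move/eqP: e2; rewrite mulf_eq0 (negPf y0) orbF => /eqP.
  rewrite t1 mul0r add0r in e1.
  by rewrite t1 e1 scale0r add0r.
apply: (peel r (divp p r)) => //; last by rewrite sr.
by rewrite {1}(divp_eq p r) rem0 addr0.
Qed.

(** * From elementary sums and ranks to matrices *)

Lemma rsumE m (f : nat -> R) : rsum m f = \sum_(i < m) f i.
Proof. by elim: m => [|m IH]; rewrite ?big_ord0 ?big_ord_recr //= IH. Qed.

Definition mx_of n (M : nat -> nat -> R) : 'M[R]_n := \matrix_(i, j) M i j.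

Definition fun_of_row n (w : 'rV[R]_n) (i : nat) : R :=
  if insub i is Some o then w 0 o else 0.

Lemma fun_of_rowE n (w : 'rV[R]_n) (o : 'I_n) : fun_of_row n w o = w 0 o.
Proof. by rewrite /fun_of_row valK. Qed.

(** [in_spec] speaks of right eigenvectors while the argument produces left ones; a matrix and its
    transpose have the same determinant. *)
Lemma right_eigenvector_of_left (n : nat) (A : nat -> nat -> R) (lam : R) (w : nat -> R) :
  (exists i, (i < n)%coq_nat /\ (w i <> 0)%coqR) ->
  (forall j, (j < n)%coq_nat -> (rsum n (fun i => w i * A i j) = lam * w j)%coqR) ->
  exists v : nat -> R, (exists i, (i < n)%coq_nat /\ (v i <> 0)%coqR) /\
    forall i, (i < n)%coq_nat -> (rsum n (fun j => A i j * v j) = lam * v i)%coqR.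
Proof.
move=> [i0 [/ssrnat.ltP lti0 wi0]] Hw.
have Hw' (j : 'I_n) : \sum_(i < n) w i * A i j = lam * w j.
  by rewrite -[RHS](Hw j (ssrnat.ltP (ltn_ord j))) rsumE.
pose N := mx_of n A - lam%:M.
have detN : \det N = 0.
  apply/eqP/det0P; exists (\row_i w i).
    by apply/rV0Pn; exists (Ordinal lti0); rewrite mxE; apply/eqP.
  apply/rowP => j; rewrite mulmxBr mul_mx_scalar !mxE.
  rewrite -Hw'.
  apply/eqP; rewrite subr_eq0; apply/eqP; by apply: eq_bigr => i _; rewrite !mxE.
have /eqP/det0P [v v0 vN] : \det N^T = 0 by rewrite det_tr.
exists (fun_of_row n v); split.
  by case/rV0Pn: v0 => o vo; exists o; split; [exact/ssrnat.ltP | rewrite fun_of_rowE; apply/eqP].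
move=> i /ssrnat.ltP lti; rewrite rsumE.
move/rowP/(_ (Ordinal lti)): vN; rewrite linearB /= tr_scalar_mx mulmxBr mul_mx_scalar !mxE.
move/eqP; rewrite subr_eq0 => /eqP.
rewrite -(fun_of_rowE _ v (Ordinal lti)) => E.
rewrite -[RHS]E.
by apply: eq_bigr => j _; rewrite !mxE fun_of_rowE [RHS]mulrC.
Qed.

(* [F i s] is the [i]-th entry of [chi(s) * 1^T adj(s I - M)], so that [F(s) (s I - M) = chi(s)^2 1^T]. *)
Lemma resolvent_certificate (n : nat) (M : nat -> nat -> R) :
  exists (F : nat -> R -> R) (d : R -> R),
    (forall i s e, (0 < e)%coqR -> exists r, (0 < r)%coqR /\
       forall s', (Rabs (s' - s) < r)%coqR -> (Rabs (F i s' - F i s) < e)%coqR) /\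
    (forall s k, (k < n)%coq_nat ->
       (s * F k s - rsum n (fun i => F i s * M i k) = d s)%coqR) /\
    (forall s, (forall w : nat -> R,
         (forall k, (k < n)%coq_nat -> (rsum n (fun i => w i * M i k) = s * w k)%coqR) ->
         forall i, (i < n)%coq_nat -> (w i = 0)%coqR) -> (0 < d s)%coqR).
Proof.
pose A := mx_of n M; pose Q := char_poly_mx A.
pose P : 'rV[{poly R}]_n := char_poly A *: (const_mx 1 *m \adj Q).
pose F (i : nat) (s : R) : R := fun_of_row n (map_mx (horner_eval s) P) i.
(* The extra factor [chi(s)] in [P] makes the right side a square, positive at every real [s] that
   is not an eigenvalue, whatever the sign of [chi]. *)
exists F, (fun s => (char_poly A).[s] ^+ 2); split; [|split].
- move=> i s e /RltP e0; rewrite /F /fun_of_row.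
  case: insubP => [o _ _|_]; last first.
    by exists 1; split; [exact/RltP/ltr01 | move=> s' _; apply/RltP; rewrite RminusE subrr RabsE normr0].
  have [r r0 rP] := poly_cont s (P 0 o) e0.
  exists r; split; first exact/RltP.
  move=> s' /RltP; rewrite RabsE RminusE => /rP.
  by rewrite !mxE /horner_eval => /RltP; rewrite RabsE.
- move=> s k /ssrnat.ltP ltk; rewrite rsumE.
  have PQ : P *m Q = (char_poly A * char_poly A) *: const_mx 1.
    by rewrite /P -scalemxAl -mulmxA mul_adj_mx mul_mx_scalar scalerA.
  have QE : map_mx (horner_eval s) Q = s%:M - A.
    by apply/matrixP => i j; rewrite !mxE /horner_eval !hornerE; case: (i == j); rewrite /= !hornerE.
  move/(congr1 (map_mx (horner_eval s))): PQ; rewrite map_mxM QE.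
  move/rowP/(_ (Ordinal ltk)); rewrite mulmxBr mul_mx_scalar !mxE mulr1 -expr2 => E.
  have -> : (char_poly A).[s] ^+ 2 = horner_eval s (char_poly A ^+ 2).
    by rewrite /horner_eval horner_exp.
  rewrite -E.
  rewrite /F -[k]/(nat_of_ord (Ordinal ltk)) fun_of_rowE !mxE; congr (_ - _).
  by apply: eq_bigr => i _; rewrite fun_of_rowE !mxE.
- move=> s Hs; apply/RltP; rewrite lt_def sqr_ge0 andbT expf_neq0 //.
  apply/negP; rewrite -/(root (char_poly A) s) -eigenvalue_root_char => /eigenvalueP [v vA v0].
  case/rV0Pn: v0 => o /eqP; apply; rewrite -fun_of_rowE; apply: Hs; last exact/ssrnat.ltP.
  move=> k /ssrnat.ltP ltk; rewrite rsumE.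
  move/rowP/(_ (Ordinal ltk)): vA; rewrite !mxE -fun_of_rowE => E.
  rewrite -[RHS]E.
  by apply: eq_bigr => j _; rewrite !mxE fun_of_rowE.
Qed.

Definition toC (z : C) : R[i] := Complex (fst z) (snd z).
Definition ofC (z : R[i]) : C := (complex.Re z, complex.Im z).

Lemma ofCK : cancel ofC toC. Proof. by case. Qed.
Lemma toCK : cancel toC ofC. Proof. by case. Qed.

Lemma toC_eq0 (z : C) : toC z = 0 -> z = C0.
Proof. by move=> /(congr1 ofC); rewrite toCK. Qed.

Lemma toCM (z w : C) : toC (Cmul z w) = toC z * toC w.
Proof. by case: z w => x y [x' y']. Qed.

Lemma toCD (z w : C) : toC (Cadd z w) = toC z + toC w.
Proof. by case: z w => x y [x' y']. Qed.

Lemma Re_add (z w : R[i]) : complex.Re (z + w) = complex.Re z + complex.Re w.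
Proof. by case: z w => x y [x' y']. Qed.

Lemma Im_add (z w : R[i]) : complex.Im (z + w) = complex.Im z + complex.Im w.
Proof. by case: z w => x y [x' y']. Qed.

Lemma Re_sum n (f : 'I_n -> R[i]) : complex.Re (\sum_i f i) = \sum_i complex.Re (f i).
Proof. by apply: (big_morph _ (id1 := 0)) => // z w; rewrite Re_add. Qed.

Lemma Im_sum n (f : 'I_n -> R[i]) : complex.Im (\sum_i f i) = \sum_i complex.Im (f i).
Proof. by apply: (big_morph _ (id1 := 0)) => // z w; rewrite Im_add. Qed.

Lemma toC_RtoC (x : R) : toC (RtoC x) = (x%:C)%C.
Proof. by []. Qed.

Lemma toC_RtoCN (x : R) : toC (RtoC (Ropp x)) = - toC (RtoC x).
Proof. by rewrite !toC_RtoC -rmorphN. Qed.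

Lemma toC_sum (l : seq nat) (f : nat -> C) :
  toC (Csum_list l f) = \sum_(j <- l) toC (f j).
Proof. by elim: l => [|j l IH]; rewrite ?big_nil ?big_cons //= toCD IH. Qed.

Lemma rsum_listE (l : seq nat) (f : nat -> R) : rsum_list l f = \sum_(j <- l) f j.
Proof. by elim: l => [|j l IH]; rewrite ?big_nil ?big_cons //= IH. Qed.

Lemma InP (l : seq nat) j : reflect (List.In j l) (j \in l).
Proof.
apply: (iffP idP); elim: l => [|x l IH] //=.
  by rewrite inE => /orP[/eqP ->|/IH]; [left | right].
by case=> [->|/IH jl]; rewrite inE ?eqxx // jl orbT.
Qed.

Lemma NoDup_uniq (l : seq nat) : NoDup l <-> uniq l.
Proof.
split; first by elim=> //= x s /InP xs _ ->; rewrite andbT.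
elim: l => [|x l IH] /=; first by move=> _; exact: NoDup_nil.
by case/andP=> /InP xl /IH; exact: NoDup_cons.
Qed.

Lemma ltbE a b : Nat.ltb a b = (a < b)%N.
Proof.
by apply/idP/idP => [/PeanoNat.Nat.ltb_lt/ssrnat.ltP|/ssrnat.ltP/PeanoNat.Nat.ltb_lt].
Qed.

Lemma eqbE a b : Nat.eqb a b = (a == b)%N.
Proof. by apply/idP/eqP => [/PeanoNat.Nat.eqb_eq|/PeanoNat.Nat.eqb_eq]. Qed.

(** The chosen columns become rows, so that their independence is [row_free]. *)
Definition cols_mx (F : Type) (m : nat) (M : nat -> nat -> F) (l : seq nat) : 'M[F]_(size l, m) :=
  \matrix_(a, i) M i (nth 0%N l a).

Lemma cols_mx_free (F : fieldType) (m : nat) (M : nat -> nat -> F) (l : seq nat) :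
  uniq l ->
  (forall c : nat -> F, (forall i, (i < m)%N -> \sum_(j <- l) c j * M i j = 0) ->
     forall j, j \in l -> c j = 0) ->
  row_free (cols_mx F m M l).
Proof.
move=> ul Hl; apply/inj_row_free => u uM; apply/rowP => a; rewrite mxE.
pose c j := if insub (index j l) is Some o then u 0 o else 0.
have cE (o : 'I_(size l)) : c (nth 0%N l o) = u 0 o.
  by rewrite /c index_uniq // valK.
rewrite -cE; apply: Hl; last exact: mem_nth.
move=> i lti; rewrite (big_nth 0%N) big_mkord.
move/rowP/(_ (Ordinal lti)): uM; rewrite !mxE => uM; rewrite -[RHS]uM.
by apply: eq_bigr => o _; rewrite cE mxE.
Qed.

Lemma cols_mx_freeC m c (M : nat -> nat -> C) (l : seq nat) :
  indep_cols_C m c M l -> row_free (cols_mx _ m (fun i j => toC (M i j)) l).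
Proof.
case=> /NoDup_uniq ul [_ Hl]; apply: cols_mx_free => // d Hd j /InP jl.
suff E : ofC (d j) = C0 by rewrite -[d j]ofCK E.
apply: (Hl (fun j => ofC (d j))) jl.
move=> i /ssrnat.ltP lti; apply: toC_eq0; rewrite toC_sum -[RHS](Hd i lti).
by apply: eq_bigr => k _; rewrite toCM ofCK.
Qed.

Lemma rank_C_row_free m c (M : nat -> nat -> C) :
  rank_C m c M m -> row_free (\matrix_(i < m, j < c) toC (M i j)).
Proof.
case=> -[l [sl Hl]] _; have fl := cols_mx_freeC _ _ _ _ Hl.
set G := \matrix_(_, _) _; rewrite /row_free eqn_leq rank_leq_row /=.
rewrite -[X in (X <= _)%N]sl -[X in (X <= _)%N](eqP fl) -(mxrank_tr G).
apply: mxrankS; apply/row_subP => a.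
have /InP/Hl.2.1/ssrnat.ltP ltc : nth 0%N l a \in l by exact: mem_nth.
rewrite (_ : row a _ = row (Ordinal ltc) G^T) ?row_sub //.
by apply/rowP => i; rewrite !mxE.
Qed.

Lemma row_free_rank_C m c (M : nat -> nat -> C) :
  row_free (\matrix_(i < m, j < c) toC (M i j)) -> rank_C m c M m.
Proof.
set G := \matrix_(_, _) _ => Gfree; split; last first.
  move=> l /cols_mx_freeC/eqP fl; apply/ssrnat.leP; rewrite -[length l]/(size l) -fl.
  exact: rank_leq_col.
have Gfull : row_full G^T by rewrite /row_full mxrank_tr.
(* [fullrankfun] selects [m] independent rows of the transpose, that is, columns of [G]. *)
pose f := fullrankfun Gfull.
exists [seq nat_of_ord (f a) | a <- enum 'I_m]; split.
  by rewrite -[length _]/(size _) size_map size_enum_ord.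
have finj : injective f by exact: fullrankfun_inj.
split; [|split].
- by apply/NoDup_uniq; rewrite map_inj_uniq ?enum_uniq // => a a' /ord_inj/finj.
- by move=> j /InP/mapP [a _ ->]; exact/ssrnat.ltP.
move=> d Hd j /InP/mapP [a _ ->]; apply: toC_eq0.
have := fullrowsub_free Gfull; move/row_free_inj/(_ (\row_a toC (d (f a))) 0) => H.
suff /H/rowP/(_ a) : (\row_a toC (d (f a))) *m rowsub f G^T = 0 *m rowsub f G^T by rewrite !mxE.
rewrite mul0mx; apply/rowP => i; rewrite !mxE.
have /(congr1 toC) := Hd i (ssrnat.ltP (ltn_ord i)).
rewrite toC_sum big_map big_enum /= => E; rewrite -[RHS]/(toC C0) -E.
by apply: eq_bigr => k _; rewrite !mxE toCM.
Qed.

(** A family of [k] vectors whose span contains [k] independent ones is independent. This transfers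
    the rank of the Krylov matrix to the vectors [v_m]. *)
Lemma rank_R_spanning_free (n c k : nat) (M V : nat -> nat -> R) (g : nat -> R) :
  rank_R n c M k ->
  (forall j, (j < c)%coq_nat -> exists d : nat -> R, forall i, (i < n)%coq_nat ->
     (M i j = rsum k (fun m => d m * V m i))%coqR) ->
  (forall i, (i < n)%coq_nat -> (rsum k (fun m => g m * V m i) = 0)%coqR) ->
  forall m, (m < k)%coq_nat -> (g m = 0)%coqR.
Proof.
case=> -[l [sl [nd [lc Hl]]]] _ span Hg m /ssrnat.ltP ltm.
have fl : row_free (cols_mx _ n M l).
  apply: cols_mx_free; first exact/NoDup_uniq.
  move=> d Hd j /InP jl; apply: Hl jl => i /ssrnat.ltP lti.
  by rewrite rsum_listE; exact: Hd.
pose W : 'M[R]_(k, n) := \matrix_(a, i) V a i.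
have Wfree : row_free W.
  rewrite /row_free eqn_leq rank_leq_row /= -[X in (X <= _)%N]sl -[X in (X <= _)%N](eqP fl).
  apply: mxrankS; apply/row_subP => a.
  have /InP/lc/span [d dE] : nth 0%N l a \in l by exact: mem_nth.
  apply/submxP; exists (\row_m d m); apply/rowP => i; rewrite !mxE dE ?rsumE; last exact/ssrnat.ltP.
  by apply: eq_bigr => b _; rewrite !mxE.
have /rowP/(_ (Ordinal ltm)) : \row_(a < k) g a = 0.
  apply: (row_free_inj Wfree); rewrite mul0mx; apply/rowP => i; rewrite !mxE.
  rewrite -[RHS](Hg i (ssrnat.ltP (ltn_ord i))) rsumE.
  by apply: eq_bigr => b _; rewrite !mxE.
by rewrite !mxE.
Qed.

(** A deficient rank leaves a nonzero complex row in the left kernel; its real part [p] and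
    imaginary part [q] carry the eigenvalue equation, and the last column says that it annihilates
    [b]. *)
Lemma augm_left_kernel (n : nat) (A : nat -> nat -> R) (b : nat -> R) (lam : C) :
  ~ rank_C n n.+1 (augm n A b lam) n ->
  exists (p q : nat -> R) (j : nat),
    [/\ (j < n)%coq_nat, (p j, q j) <> C0,
      (forall k, (k < n)%coq_nat ->
         (rsum n (fun i => p i * A i k) = fst lam * p k - snd lam * q k)%coqR) /\
      (forall k, (k < n)%coq_nat ->
         (rsum n (fun i => q i * A i k) = fst lam * q k + snd lam * p k)%coqR) &
      (rsum n (fun i => p i * b i) = 0)%coqR /\ (rsum n (fun i => q i * b i) = 0)%coqR].
Proof.
move=> nrk; pose G : 'M[R[i]]_(n, n.+1) := \matrix_(i, j) toC (augm n A b lam i j).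
have [/row_free_rank_C //|] := boolP (row_free G).
rewrite -kermx_eq0 => /rowV0Pn [u /sub_kermxP uG u0].
pose uf (i : nat) : R[i] := if insub i is Some o then u 0 o else 0.
have ufE (o : 'I_n) : uf o = u 0 o by rewrite /uf valK.
have HA k (ltk : (k < n)%N) : \sum_(i < n) uf i * toC (RtoC (A i k)) = toC lam * uf k.
  have ltk1 : (k < n.+1)%N by exact: ltnW.
  move/rowP/(_ (Ordinal ltk1)): uG; rewrite !mxE => uG.
  apply/eqP; rewrite eq_sym -subr_eq0 -sumrN -[X in _ == X]uG.
  rewrite (bigD1 (Ordinal ltk)) // [X in _ == X](bigD1 (Ordinal ltk)) //=; apply/eqP.
  rewrite addrA; congr (_ + _).
    rewrite mxE /augm /= ltbE ltk eqbE eqxx.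
    by rewrite toCD toC_RtoCN -ufE /=; ring.
  apply: eq_bigr => i ik; rewrite mxE /augm /= ltbE ltk eqbE.
  rewrite -[k]/(nat_of_ord (Ordinal ltk)) (inj_eq val_inj) (negPf ik).
  by rewrite -ufE toC_RtoCN mulrN.
have Hb : \sum_(i < n) uf i * toC (RtoC (b i)) = 0.
  move/rowP/(_ ord_max): uG; rewrite !mxE => uG; rewrite -[RHS]uG.
  by apply: eq_bigr => i _; rewrite mxE ufE /augm /= ltbE ltnn.
case/rV0Pn: u0 => o uo.
exists (fun i => complex.Re (uf i)), (fun i => complex.Im (uf i)), (nat_of_ord o); split.
- exact/ssrnat.ltP.
- move=> E; case/eqP: uo; rewrite -ufE; apply/eqP; rewrite eq_complex /=.
  by case: E => -> ->; rewrite !eqxx.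
- split=> k /ssrnat.ltP ltk; rewrite rsumE.
    have /(congr1 (@complex.Re _)) := HA k ltk; rewrite Re_sum.
    case: (lam) (uf k) => [c d] [x y] /= E; rewrite -[RHS]E; apply: eq_bigr => i _.
    by case: (uf i) => x' y' /=; rewrite mulr0 subr0.
  have /(congr1 (@complex.Im _)) := HA k ltk; rewrite Im_sum.
  case: (lam) (uf k) => [c d] [x y] /= E; rewrite -[RHS]E; apply: eq_bigr => i _.
  by case: (uf i) => x' y' /=; rewrite mulr0 add0r.
- split; rewrite rsumE.
    have /(congr1 (@complex.Re _)) := Hb; rewrite Re_sum => E; rewrite -[RHS]E.
    by apply: eq_bigr => i _; case: (uf i) => x' y' /=; rewrite mulr0 subr0.
  have /(congr1 (@complex.Im _)) := Hb; rewrite Im_sum => E; rewrite -[RHS]E.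
  by apply: eq_bigr => i _; case: (uf i) => x' y' /=; rewrite mulr0 add0r.
Qed.

Lemma augm_rank_left_kernel (n : nat) (A : nat -> nat -> R) (b : nat -> R) (lam : R) (w : nat -> R) :
  rank_C n n.+1 (augm n A b (RtoC lam)) n ->
  (forall k, (k < n)%coq_nat -> (rsum n (fun i => w i * A i k) = lam * w k)%coqR) ->
  (rsum n (fun i => w i * b i) = 0)%coqR ->
  forall i, (i < n)%coq_nat -> (w i = 0)%coqR.
Proof.
move=> /rank_C_row_free; set G := \matrix_(_, _) _ => Gfree HA Hb i /ssrnat.ltP lti.
have sumC (f : 'I_n -> R) : \sum_i ((f i)%:C)%C = ((\sum_i f i)%:C)%C :> R[i].
  by rewrite rmorph_sum.
have /rowP/(_ (Ordinal lti)) : \row_(i < n) ((w i)%:C)%C = 0 :> 'rV[R[i]]_n.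
  apply: (row_free_inj Gfree); rewrite mul0mx; apply/rowP => j; rewrite !mxE.
  have [ltj|gej] := ltnP j n.
    rewrite (eq_bigr (fun i : 'I_n => ((w i * ((i == j :> nat)%:R * lam - A i j))%:C)%C)); last first.
      move=> k _; rewrite !mxE /augm ltbE ltj eqbE rmorphM; congr (_ * _).
      case: eqVneq => [->|_].
        by rewrite mul1r toCD toC_RtoCN rmorphB.
      by rewrite mul0r sub0r toC_RtoCN rmorphN.
    rewrite sumC (eq_bigr (fun i : 'I_n => w i * (i == j :> nat)%:R * lam - w i * A i j)); last first.
      by move=> k _; rewrite mulrBr mulrA.
    rewrite sumrB (_ : \sum_(i < n) w i * A i j = lam * w j); last first.
      by rewrite -[RHS](HA j (ssrnat.ltP ltj)) rsumE.
    rewrite (bigD1 (Ordinal ltj)) //= eqxx big1 => [|k]; first by rewrite mulr1 addr0 mulrC subrr.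
    by rewrite -(inj_eq val_inj) /= => /negPf ->; rewrite mulr0 mul0r.
  rewrite (eq_bigr (fun i : 'I_n => ((w i * b i)%:C)%C)); last first.
    by move=> k _; rewrite !mxE /augm ltbE ltnNge gej rmorphM.
  by rewrite sumC (_ : \sum_(i < n) w i * b i = 0) // -[RHS]Hb rsumE.
by rewrite !mxE => -[].
Qed.

Lemma hurwitz_coefs (k : nat) (c : nat -> R) :
  (forall z : C,
     (fst (Cpow z k) + rsum k (fun m => c m * fst (Cpow z m)) = 0)%coqR ->
     (snd (Cpow z k) + rsum k (fun m => c m * snd (Cpow z m)) = 0)%coqR ->
     (fst z < 0)%coqR) ->
  forall m, (m < k)%coq_nat -> (0 < c m)%coqR.
Proof.
move=> Hz m /ssrnat.ltP ltm.
pose p : {poly R} := 'X^k + \poly_(i < k) c i.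
have sp : size p = k.+1 by rewrite size_polyDl size_polyXn // ltnS size_poly.
have powE (z : R[i]) i : z ^+ i = toC (Cpow (ofC z) i).
  by elim: i => // i IH; rewrite exprS IH toCM ofCK.
have pos : positive_coefs p.
  apply: hurwitz_positive_coefs.
    rewrite lead_coefE sp /= !coefE eqxx ltnn addr0; exact: ltr01.
  move=> z; rewrite /root rmorphD /= map_polyXn hornerD hornerXn => /eqP.
  rewrite (_ : (map_poly _ _).[z] = \sum_(i < k) (c i)%:C%C * z ^+ i); last first.
    rewrite (@horner_coef_wide _ k) ?size_map_poly ?size_poly //.
    by apply: eq_bigr => i _; rewrite coef_map coef_poly ltn_ord.
  move=> E; apply/RltP; apply: (Hz (ofC z)); rewrite rsumE.
    move/(congr1 (@complex.Re _)): E; rewrite powE -[RHS]/0 => E; rewrite -[RHS]E.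
    rewrite [RHS](Re_add _ _) Re_sum; congr (_ + _); apply: eq_bigr => i _.
    by rewrite powE /= mul0r subr0.
  move/(congr1 (@complex.Im _)): E; rewrite powE -[RHS]/0 => E; rewrite -[RHS]E.
  rewrite [RHS](Im_add _ _) Im_sum; congr (_ + _); apply: eq_bigr => i _.
  by rewrite powE /= mul0r addr0.
apply/RltP; have := pos m; rewrite sp ltnS (ltnW ltm) !coefE ltm (ltn_eqF ltm) add0r; exact.
Qed.

End LinearAlgebra.
Import LinearAlgebra.

(** * Metzler matrices and the closed loop *)

Lemma finite_argmin (n : nat) (f : nat -> R) : (0 < n)%nat ->
  exists j, (j < n)%nat /\ forall i, (i < n)%nat -> f j <= f i.
Proof.
  induction n as [|n IH]; intros Hn; [lia|].
  destruct (Nat.eq_dec n 0) as [->|Hn0].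
  - exists 0%nat; split; [lia|]; intros i Hi; replace i with 0%nat by lia; lra.
  - destruct IH as [j [Hj Hmin]]; [lia|].
    destruct (Rle_dec (f j) (f n)) as [Hle|Hgt].
    + exists j; split; [lia|]; intros i Hi.
      destruct (Nat.eq_dec i n) as [->|Hne]; [trivial|apply Hmin; lia].
    + exists n; split; [lia|]; intros i Hi.
      destruct (Nat.eq_dec i n) as [->|Hne]; [lra|].
      assert (f j <= f i) by (apply Hmin; lia); lra.
Qed.

(** An M-matrix argument: a row [y] with a negative entry is lifted by the multiple [r] of the
    certificate [w] that makes [z = y + r w] nonnegative and zero at some [j]. Entry [j] of
    [z (s I - M)] is then at most 0 by the Metzler property, yet positive by the hypotheses on [w]
    and [y]. *)
Lemma metzler_inverse_nonneg (n : nat) (M : nat -> nat -> R) (s : R) (w y : nat -> R) :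
  (forall i j, (i < n)%nat -> (j < n)%nat -> i <> j -> 0 <= M i j) ->
  (forall i, (i < n)%nat -> 0 < w i) ->
  (forall k, (k < n)%nat -> 0 < s * w k - rsum n (fun i => w i * M i k)) ->
  (forall k, (k < n)%nat -> 0 <= s * y k - rsum n (fun i => y i * M i k)) ->
  forall i, (i < n)%nat -> 0 <= y i.
Proof.
  intros HM Hw HwM HyM i Hi; apply Rnot_lt_le; intros Hneg.
  destruct (finite_argmin n (fun i => y i / w i)) as [j [Hj Hmin]]; [lia|].
  set (r := - (y j / w j)).
  assert (Hr : 0 < r).
  { unfold r; specialize (Hmin i Hi); assert (Hwi := Hw i Hi).
    assert (y i / w i < 0); [|lra].
    unfold Rdiv; assert (0 < / w i) by now apply Rinv_0_lt_compat. nra. }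
  set (z := fun i => y i + r * w i).
  assert (Hz : forall i, (i < n)%nat -> 0 <= z i).
  { intros l Hl; unfold z; specialize (Hmin l Hl); assert (Hwl := Hw l Hl).
    assert (- r * w l <= y l); [|lra].
    replace (y l) with (y l / w l * w l) by (field; lra).
    apply Rmult_le_compat_r; [lra|unfold r; lra]. }
  assert (Hzj : z j = 0) by (unfold z, r; assert (Hwj := Hw j Hj); field; lra).
  assert (E : rsum n (fun i => z i * M i j) =
              rsum n (fun i => y i * M i j) + r * rsum n (fun i => w i * M i j)).
  { rewrite <- rsum_scal_l, <- rsum_plus; apply rsum_ext; intros; unfold z; ring. }
  assert (0 <= rsum n (fun i => z i * M i j)).
  { apply rsum_ge0; intros l Hl; destruct (Nat.eq_dec l j) as [->|Hne]; [rewrite Hzj; lra|].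
    apply Rmult_le_pos; auto. }
  specialize (HwM j Hj); specialize (HyM j Hj).
  assert (0 < r * (s * w j - rsum n (fun i => w i * M i j))) by now apply Rmult_lt_0_compat.
  assert (Es : s * z j = s * y j + r * (s * w j)) by (unfold z; ring).
  rewrite Hzj in Es; lra.
Qed.

(* The resolvent at [s] stays nonnegative while [s] descends from infinity to [0]: it is so on a
   closed set by continuity, and on an open set since a nonnegative resolvent yields a strictly
   positive left certificate, which survives small decreases of [s]. *)
Theorem metzler_left_certificate (n : nat) (M : nat -> nat -> R) :
  (forall i j, (i < n)%nat -> (j < n)%nat -> i <> j -> 0 <= M i j) ->
  (forall lam w, 0 <= lam ->
     (forall k, (k < n)%nat -> rsum n (fun i => w i * M i k) = lam * w k) ->
     forall i, (i < n)%nat -> w i = 0) ->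
  exists w, (forall i, (i < n)%nat -> 0 < w i) /\
    forall k, (k < n)%nat -> rsum n (fun i => w i * M i k) < 0.
Proof.
  intros HM Heig.
  destruct (resolvent_certificate n M) as (F & d & Hcont & Hres & Hd).
  assert (Hd0 : forall s, 0 <= s -> 0 < d s) by (intros s Hs; apply Hd; intros w; now apply Heig).
  set (G := fun s => forall j, (j < n)%nat -> 0 <= F j s).
  assert (Hcert : forall s w, 0 <= s -> (forall i, (i < n)%nat -> 0 < w i) ->
    (forall k, (k < n)%nat -> 0 < s * w k - rsum n (fun i => w i * M i k)) -> G s).
  { intros s w Hs Hw HwM; intros j Hj.
    apply (metzler_inverse_nonneg n M s w (fun i => F i s)); trivial.
    intros k Hk; rewrite Hres by trivial; left; auto. }
  (* If [F j s = 0], entry [j] of [F (s I - M)] is at most 0 by the Metzler property, while it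
     equals [d s > 0]. *)
  assert (Hpos : forall s, 0 <= s -> G s -> forall j, (j < n)%nat -> 0 < F j s).
  { intros s Hs HG j Hj.
    destruct (HG j Hj) as [Hlt|Heq]; trivial; exfalso.
    pose proof (Hres s j Hj) as Hj'; rewrite <- Heq in Hj'; specialize (Hd0 s Hs).
    assert (0 <= rsum n (fun i => F i s * M i j)); [|lra].
    apply rsum_ge0; intros l Hl; destruct (Nat.eq_dec l j) as [->|Hne]; [rewrite <- Heq; lra|].
    apply Rmult_le_pos; auto. }
  (* Above all absolute column sums the constant vector 1 is a certificate. *)
  destruct (row_sum_bound n (fun i j => M j i)) as [B [HB Hcol]].
  assert (Hlarge : forall s, B <= s -> G s).
  { intros s Hs; apply (Hcert s (fun _ => 1)); [lra|intros; lra|].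
    intros k Hk; specialize (Hcol k Hk).
    assert (rsum n (fun i => 1 * M i k) <= rsum n (fun i => Rabs (M i k))); [|lra].
    apply rsum_le; intros; rewrite Rmult_1_l; apply Rle_abs. }
  assert (Hdown : forall s, 0 <= s -> G s ->
    exists e, 0 < e /\ forall s', 0 <= s' -> s - e < s' <= s -> G s').
  { intros s Hs HG; pose proof (Hpos s Hs HG) as Hp; specialize (Hd0 s Hs).
    set (W := rsum n (fun j => F j s)).
    assert (HW : 0 <= W) by (apply rsum_ge0; auto).
    (* Moving from [s] to [s'] costs [(s - s') * F k s] in entry [k], which stays below [d s] as
       [F k s <= W]. *)
    exists (d s / (W + 1)); split; [apply Rdiv_lt_0_compat; lra|].
    intros s' Hs' Hlt; apply (Hcert s' (fun i => F i s)); trivial.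
    intros k Hk.
    assert (Hk' := Hres s k Hk).
    assert (F k s <= W) by (apply (rsum_term_le n (fun j => F j s)); auto).
    assert (0 < F k s) by auto.
    assert ((s - s') * (W + 1) < d s).
    { apply Rlt_le_trans with (d s / (W + 1) * (W + 1)); [apply Rmult_lt_compat_r; lra|].
      right; field; lra. }
    nra. }
  assert (HG0 : G 0).
  { apply NNPP; intros HnG.
    (* The supremum [m] of the bad parameters is itself good by continuity from above, and [Hdown]
       then frees an interval below it. *)
    set (E := fun u => 0 <= u /\ ~ G u).
    destruct (completeness E) as [m [Hub Hl]].
    { exists B; intros u [_ Hu]; apply Rnot_lt_le; intros Hlt; apply Hu, Hlarge; lra. }
    { exists 0; split; [lra|trivial]. }
    assert (Hm : 0 <= m) by (apply Hub; split; [lra|trivial]).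
    assert (Habove : forall s, m < s -> G s).
    { intros s Hs; apply NNPP; intros Hn; assert (s <= m); [|lra].
      apply Hub; split; [lra|trivial]. }
    assert (HGm : G m).
    { intros j Hj; apply Rnot_lt_le; intros Hneg.
      destruct (Hcont j m (- F j m)) as [r [Hr Hc]]; [lra|].
      assert (Hc' : Rabs (F j (m + r / 2) - F j m) < - F j m)
        by (apply Hc; rewrite Rabs_pos_eq; lra).
      assert (0 <= F j (m + r / 2)) by (apply Habove; trivial; lra).
      apply Rabs_def2 in Hc'; lra. }
    destruct (Hdown m Hm HGm) as [e [He Hlow]].
    assert (m <= m - e); [|lra].
    apply Hl; intros u [Hu0 Hu]; apply Rnot_lt_le; intros Hlt; apply Hu, Hlow; trivial.
    split; trivial; apply Hub; now split. }
  exists (fun i => F i 0); split; [apply Hpos; trivial; lra|].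
  intros k Hk; pose proof (Hres 0 k Hk); specialize (Hd0 0 ltac:(lra)); lra.
Qed.

Lemma Cnorm_triangle (z w : C) : Cnorm (Cadd z w) <= Cnorm z + Cnorm w.
Proof.
  assert (Hz : 0 <= Cnorm z) by apply sqrt_pos.
  assert (Hw : 0 <= Cnorm w) by apply sqrt_pos.
  rewrite <- (sqrt_Rsqr (Cnorm z + Cnorm w)) by lra.
  apply sqrt_le_1_alt.
  assert (Ez : Cnorm z * Cnorm z = fst z ^ 2 + snd z ^ 2)
    by (apply sqrt_sqrt, Rplus_le_le_0_compat; apply pow2_ge_0).
  assert (Ew : Cnorm w * Cnorm w = fst w ^ 2 + snd w ^ 2)
    by (apply sqrt_sqrt, Rplus_le_le_0_compat; apply pow2_ge_0).
  assert (Hcs : fst z * fst w + snd z * snd w <= Cnorm z * Cnorm w).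
  { unfold Cnorm; pose proof (sqrt_cauchy (fst z) (snd z) (fst w) (snd w)) as H.
    unfold Rsqr in H; simpl; rewrite !Rmult_1_r; exact H. }
  unfold Rsqr, Cadd; simpl in *; nra.
Qed.

Lemma Cnorm_nonneg_comb (n : nat) (c p q : nat -> R) :
  (forall j, (j < n)%nat -> 0 <= c j) ->
  Cnorm (rsum n (fun j => c j * p j), rsum n (fun j => c j * q j))
    <= rsum n (fun j => c j * Cnorm (p j, q j)).
Proof.
  induction n as [|n IH]; intros Hc; simpl.
  - right; unfold Cnorm; simpl; rewrite Rmult_0_l, Rplus_0_l; apply sqrt_0.
  - eapply Rle_trans; [apply (Cnorm_triangle (_, _) (c n * p n, c n * q n))|].
    apply Rplus_le_compat; [apply IH; intros; apply Hc; lia|].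
    replace (c n * p n, c n * q n) with (Cmul (c n, 0) (p n, q n))
      by (unfold Cmul; simpl; f_equal; ring).
    rewrite Cnorm_mul; right; f_equal; unfold Cnorm; simpl.
    replace (c n * (c n * 1) + 0 * (0 * 1)) with (Rsqr (c n)) by (unfold Rsqr; ring).
    apply sqrt_Rsqr, Hc; lia.
Qed.

(* If [Re lam >= 0] then the vector of moduli [|y|] satisfies [M |y| >= 0], against [w M < 0]. *)
Lemma left_certificate_right_eigenvalue (n : nat) (M : nat -> nat -> R) (w : nat -> R) (lam : C)
  (p q : nat -> R) (j : nat) :
  (forall i j, (i < n)%nat -> (j < n)%nat -> i <> j -> 0 <= M i j) ->
  (forall i, (i < n)%nat -> 0 < w i) ->
  (forall k, (k < n)%nat -> rsum n (fun i => w i * M i k) < 0) ->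
  (forall i, (i < n)%nat -> mv n M p i = fst lam * p i - snd lam * q i) ->
  (forall i, (i < n)%nat -> mv n M q i = fst lam * q i + snd lam * p i) ->
  (j < n)%nat -> p j <> 0 -> fst lam < 0.
Proof.
  intros HM Hw HwM Hp Hq Hj Hpj; apply Rnot_le_lt; intros Hlam.
  (* [s] exceeds every [|M i i|], so [M + s I] has nonnegative entries. *)
  destruct (row_sum_bound n M) as [s [Hs Hrow]].
  set (y := fun i => Cnorm (p i, q i)).
  assert (Hy : forall i, 0 <= y i) by (intros; apply sqrt_pos).
  assert (Hdelta : forall (i : nat) (x : nat -> R), (i < n)%nat ->
    rsum n (fun j => (M i j + (if Nat.eq_dec j i then s else 0)) * x j) = mv n M x i + s * x i).
  { intros i x Hi; unfold mv.
    rewrite <- (rsum_delta n i (fun j => s * x j) Hi), <- rsum_plus.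
    apply rsum_ext; intros l Hl; destruct (Nat.eq_dec l i); ring. }
  assert (HMy : forall i, (i < n)%nat -> 0 <= mv n M y i).
  { intros i Hi.
    (* The triangle inequality for [(M + s I) (p + i q) = (s + lam) (p + i q)], where the
       coefficients on the left are nonnegative; it is combined with [|s + lam| >= s]. *)
    assert (H : Cnorm (Cmul (s + fst lam, snd lam) (p i, q i)) <= mv n M y i + s * y i).
    { rewrite <- Hdelta by trivial.
      replace (Cmul (s + fst lam, snd lam) (p i, q i)) with
        (rsum n (fun j => (M i j + (if Nat.eq_dec j i then s else 0)) * p j),
         rsum n (fun j => (M i j + (if Nat.eq_dec j i then s else 0)) * q j)).
      - apply Cnorm_nonneg_comb; intros l Hl.
        destruct (Nat.eq_dec l i) as [->|Hne]; [|rewrite Rplus_0_r; auto].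
        specialize (Hrow i Hi).
        assert (Rabs (M i i) <= rsum n (fun j => Rabs (M i j)))
          by (apply (rsum_term_le n (fun j => Rabs (M i j))); trivial; intros; apply Rabs_pos).
        assert (Hn := Rle_abs (- M i i)); rewrite Rabs_Ropp in Hn; lra.
      - rewrite !Hdelta, Hp, Hq by trivial; unfold Cmul; simpl; f_equal; ring. }
    rewrite Cnorm_mul in H; fold (y i) in H.
    assert (s <= Cnorm (s + fst lam, snd lam)).
    { unfold Cnorm; simpl; rewrite <- (sqrt_Rsqr s) at 1 by lra.
      apply sqrt_le_1_alt; unfold Rsqr; nra. }
    assert (s * y i <= Cnorm (s + fst lam, snd lam) * y i) by (apply Rmult_le_compat_r; auto).
    lra. }
  assert (Hsum : 0 <= rsum n (fun k => rsum n (fun i => w i * M i k) * y k)).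
  { rewrite (rsum_ext n _ (fun k => rsum n (fun i => w i * (M i k * y k)))).
    - rewrite rsum_exchange; apply rsum_ge0; intros i Hi; rewrite rsum_scal_l.
      apply Rmult_le_pos; [left; auto|now apply HMy].
    - intros k Hk; rewrite Rmult_comm, <- rsum_scal_l; apply rsum_ext; intros; ring. }
  assert (Hyj : 0 < y j).
  { apply sqrt_lt_R0; simpl; assert (0 < p j * p j) by nra; nra. }
  assert (Hj0 : 0 < - (rsum n (fun i => w i * M i j) * y j)) by (specialize (HwM j Hj); nra).
  assert (Hle : - (rsum n (fun i => w i * M i j) * y j)
                <= rsum n (fun k => -1 * (rsum n (fun i => w i * M i k) * y k))).
  { eapply Rle_trans; [|apply (rsum_term_le n (fun k => -1 * (rsum n (fun i => w i * M i k) * y k)) j)];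
      trivial; [lra|].
    intros k Hk; specialize (HwM k Hk); specialize (Hy k); nra. }
  rewrite rsum_scal_l in Hle; lra.
Qed.

(** * The vectors [v_m] and the gain bounds *)

Lemma mv_linear (n : nat) (M : nat -> nat -> R) (m : nat) (c : nat -> R) (v : nat -> nat -> R) (i : nat) :
  mv n M (fun j => rsum m (fun l => c l * v l j)) i = rsum m (fun l => c l * mv n M (v l) i).
Proof.
  unfold mv.
  rewrite (rsum_ext n _ (fun j => rsum m (fun l => c l * (M i j * v l j)))).
  - rewrite rsum_exchange; apply rsum_ext; intros; apply rsum_scal_l.
  - intros j Hj; rewrite <- rsum_scal_l; apply rsum_ext; intros; ring.
Qed.

Lemma vvec_last (n : nat) (A : nat -> nat -> R) (b a : nat -> R) (k i : nat) :
  vvec n A b a k k i = b i.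
Proof. unfold vvec; rewrite Nat.sub_diag; simpl; ring. Qed.

(** The [v_m] are the Horner steps of the polynomial [X^k + a_k X^(k-1) + ... + a_1] evaluated at
    [A] and applied to [b]. *)
Lemma vvec_step (n : nat) (A : nat -> nat -> R) (b a : nat -> R) (k m i : nat) :
  (m < k)%nat -> vvec n A b a k m i = mv n A (vvec n A b a k (S m)) i + a (S m) * b i.
Proof.
  intros Hm; unfold vvec; cbv zeta.
  replace (k - m)%nat with (S (k - S m)) by lia; set (r := (k - S m)%nat).
  assert (Hmv : mv n A (fun r0 => Apow n A r b r0 +
      rsum r (fun l => a (k - l)%nat * Apow n A (r - 1 - l) b r0)) i =
    Apow n A (S r) b i + rsum r (fun l => a (k - l)%nat * Apow n A (S (r - 1 - l)) b i)).
  { simpl; rewrite <- (mv_linear n A r (fun l => a (k - l)%nat) (fun l => Apow n A (r - 1 - l) b)).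
    unfold mv; rewrite <- rsum_plus; apply rsum_ext; intros; ring. }
  rewrite Hmv; change (rsum (S r) (fun l => a (k - l)%nat * Apow n A (S r - 1 - l) b i)) with
    (rsum r (fun l => a (k - l)%nat * Apow n A (S r - 1 - l) b i)
     + a (k - r)%nat * Apow n A (S r - 1 - r) b i).
  replace (S r - 1 - r)%nat with 0%nat by lia.
  replace (k - r)%nat with (S m) by (unfold r; lia).
  rewrite Rplus_assoc; f_equal; simpl Apow at 2; f_equal.
  apply rsum_ext; intros l Hl; do 2 f_equal; lia.
Qed.

(** The index 0 extends the range [1..k]: there the formula gives the full polynomial, which
    annihilates [b]. *)
Lemma vvec_zero (n : nat) (A : nat -> nat -> R) (b a : nat -> R) (k i : nat) :
  Apow n A k b i = - rsum k (fun l => a (S l) * Apow n A l b i) ->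
  vvec n A b a k 0 i = 0.
Proof.
  intros H; unfold vvec; cbv zeta; rewrite Nat.sub_0_r, H.
  rewrite <- (rsum_rev k (fun l => a (S l) * Apow n A l b i)).
  rewrite (rsum_ext k (fun l => a (k - l)%nat * Apow n A (k - 1 - l) b i)
    (fun l => a (S (k - 1 - l)) * Apow n A (k - 1 - l) b i)); [ring|].
  intros l Hl; do 2 f_equal; lia.
Qed.

Lemma closed_loop_vvec (n : nat) (A : nat -> nat -> R) (b a K : nat -> R) (k m i : nat) :
  (m < k)%nat ->
  mv n (fun i j => A i j + b i * K j) (vvec n A b a k (S m)) i =
  vvec n A b a k m i - (a (S m) - rsum n (fun j => K j * vvec n A b a k (S m) j)) * b i.
Proof.
  intros Hm; rewrite (vvec_step n A b a k m i Hm); set (v := vvec n A b a k (S m)).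
  unfold mv; rewrite (rsum_ext n _ (fun j => A i j * v j + b i * (K j * v j))) by (intros; ring).
  rewrite rsum_plus, rsum_scal_l; ring.
Qed.

Lemma closed_loop_left (n : nat) (A : nat -> nat -> R) (b K w : nat -> R) (k : nat) :
  rsum n (fun i => w i * (A i k + b i * K k)) =
  rsum n (fun i => w i * A i k) + rsum n (fun i => w i * b i) * K k.
Proof.
  rewrite (rsum_ext n _ (fun i => w i * A i k + K k * (w i * b i))) by (intros; ring).
  rewrite rsum_plus, rsum_scal_l; ring.
Qed.

Lemma ge_ext_max_list (x : R) (l : list R) :
  ge_ext x (max_list l) <-> forall y, In y l -> y <= x.
Proof.
  induction l as [|z l IH]; simpl; [intuition|].
  destruct (max_list l) as [m|]; simpl in *.
  - split.
    + intros H y [<-|Hy]; [eapply Rle_trans; [apply Rmax_l|exact H]|].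
      apply IH; trivial; eapply Rle_trans; [apply Rmax_r|exact H].
    + intros H; apply Rmax_lub; [now apply H; left|apply IH; intros; apply H; now right].
  - split.
    + intros H y [<-|Hy]; [trivial|apply IH; trivial].
    + intros H; apply H; now left.
Qed.

(** Multiplying by [b i > 0] turns each number of the list into a condition on an entry of the
    closed loop. Where [b i = 0] the gain changes nothing and the condition is inherited from [A];
    for [mub = 0] the diagonal condition is trivial. *)
Theorem alpha_closed_loop_metzler (n : nat) (A : nat -> nat -> R) (b K : nat -> R) (mub : R) (j : nat) :
  0 <= mub -> (forall i, (i < n)%nat -> 0 <= b i) -> (j < n)%nat ->
  (forall i, (i < n)%nat -> i <> j -> 0 <= A i j) -> 0 <= 1 + mub * A j j ->
  (ge_ext (K j) (alpha n A b mub j) <->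
   (forall i, (i < n)%nat -> i <> j -> 0 <= A i j + b i * K j) /\
   0 <= 1 + mub * (A j j + b j * K j)).
Proof.
  intros Hmub Hb Hj Hoff Hdiag; unfold alpha; rewrite ge_ext_max_list.
  assert (Hdiv : forall i c, (i < n)%nat -> b i <> 0 -> (c / b i <= K j <-> c <= b i * K j)).
  { intros i c Hi Hne; assert (Hbi : 0 < b i) by (specialize (Hb i Hi); lra).
    split; intros H.
    - apply Rmult_le_compat_l with (r := b i) in H; [|lra].
      replace (b i * (c / b i)) with c in H by (field; lra); lra.
    - apply Rmult_le_reg_l with (b i); trivial.
      replace (b i * (c / b i)) with c by (field; lra); lra. }
  split.
  - intros H; split.
    + intros i Hi Hij; destruct (Req_dec (b i) 0) as [E|Hne]; [rewrite E; specialize (Hoff i Hi Hij); lra|].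
      assert (- A i j <= b i * K j); [|lra].
      apply Hdiv; trivial; apply H, in_or_app; left; apply in_flat_map; exists i; split.
      * apply in_seq; lia.
      * destruct (Nat.eq_dec i j); [contradiction|]; destruct (Req_dec_T (b i) 0); [contradiction|].
        now left.
    + destruct (Req_dec (b j) 0) as [E|Hne]; [rewrite E, Rmult_0_l, Rplus_0_r; exact Hdiag|].
      destruct (Req_dec mub 0) as [->|Hm]; [lra|].
      assert (Hk : - A j j - / mub <= b j * K j).
      { apply Hdiv; trivial; apply H, in_or_app; right.
        destruct (Req_dec_T (b j) 0); [contradiction|]; destruct (Req_dec_T mub 0); [contradiction|].
        now left. }
      assert (mub * - / mub <= mub * (A j j + b j * K j)) by (apply Rmult_le_compat_l; lra).
      replace (mub * - / mub) with (-1) in * by (field; lra); lra.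
  - intros [H1 H2] y Hy; apply in_app_or in Hy; destruct Hy as [Hy|Hy].
    + apply in_flat_map in Hy; destruct Hy as [i [Hi Hy]]; apply in_seq in Hi.
      destruct (Nat.eq_dec i j); [contradiction|]; destruct (Req_dec_T (b i) 0); [contradiction|].
      destruct Hy as [<-|[]]; apply Hdiv; [lia|trivial|].
      assert (0 <= A i j + b i * K j) by (apply H1; trivial; lia); lra.
    + destruct (Req_dec_T (b j) 0); [contradiction|]; destruct (Req_dec_T mub 0) as [|Hm]; [contradiction|].
      destruct Hy as [<-|[]]; apply Hdiv; trivial.
      assert (- / mub <= A j j + b j * K j); [|lra].
      apply Rmult_le_reg_l with mub; [lra|].
      replace (mub * - / mub) with (-1) by (field; lra); lra.
Qed.

Lemma Csum_list_seq (n s : nat) (f : nat -> C) :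
  Csum_list (seq s n) f = (rsum n (fun i => fst (f (s + i)%nat)), rsum n (fun i => snd (f (s + i)%nat))).
Proof.
  revert s; induction n as [|n IH]; intros s; [reflexivity|].
  rewrite !rsum_head; simpl seq; unfold Csum_list; simpl fold_right; fold (Csum_list (seq (S s) n) f).
  rewrite IH; unfold Cadd; simpl; rewrite Nat.add_0_r; f_equal; f_equal; apply rsum_ext;
    intros i _; do 2 f_equal; lia.
Qed.

Lemma left_eigenvalue_in_spec (n : nat) (A : nat -> nat -> R) (lam : R) (w : nat -> R) :
  (exists i, (i < n)%nat /\ w i <> 0) ->
  (forall j, (j < n)%nat -> rsum n (fun i => w i * A i j) = lam * w j) ->
  in_spec n A (RtoC lam).
Proof.
  intros Hw Heig.
  destruct (right_eigenvector_of_left n A lam w Hw Heig) as [v [[i [Hi Hvi]] Hv]].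
  exists (fun j => RtoC (v j)); split.
  - exists i; split; trivial; intros E; apply Hvi; now apply (f_equal fst) in E.
  - intros l Hl; rewrite Csum_list_seq; unfold Cmul, RtoC; simpl; f_equal.
    + rewrite (rsum_ext n _ (fun j => A l j * v j)) by (intros; ring).
      rewrite Hv by trivial; ring.
    + rewrite rsum_zero by (intros; ring); ring.
Qed.

(* Along [v_k = b, ..., v_0 = 0] the ratios [w v_m / w b] obey [P m = lam * P (S m) + c m] with
   [c m > 0], hence stay positive, which is absurd at [m = 0]. *)
Lemma closed_loop_no_nonneg_eigenvalue (T : R -> Prop) (n : nat) (A : nat -> nat -> R)
  (b a K : nat -> R) (k : nat) (lam : R) (w : nat -> R) :
  is_time_scale T -> unbounded_above T ->
  (forall i, (i < n)%nat -> Apow n A k b i = - rsum k (fun l => a (S l) * Apow n A l b i)) ->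
  (forall lam, in_spec n A lam -> ~ in_S T lam -> rank_C n (S n) (augm n A b lam) n) ->
  (forall m, (1 <= m <= k)%nat -> rsum n (fun j => K j * vvec n A b a k m j) < a m) ->
  0 <= lam ->
  (forall j, (j < n)%nat -> rsum n (fun i => w i * (A i j + b i * K j)) = lam * w j) ->
  forall i, (i < n)%nat -> w i = 0.
Proof.
  intros HT Hunb Hrec Hhautus HK Hlam Hw i Hi; apply NNPP; intros Hwi.
  set (be := rsum n (fun i => w i * b i)).
  destruct (Req_dec be 0) as [Hbe|Hbe].
  - assert (HwA : forall j, (j < n)%nat -> rsum n (fun i => w i * A i j) = lam * w j).
    { intros j Hj; specialize (Hw j Hj); rewrite closed_loop_left in Hw; fold be in Hw.
      rewrite Hbe in Hw; lra. }
    apply Hwi, (augm_rank_left_kernel n A b lam w); trivial.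
    apply Hhautus; [|now apply nonneg_not_in_S].
    apply (left_eigenvalue_in_spec n A lam w); trivial; now exists i.
  - set (P := fun m => rsum n (fun i => w i * vvec n A b a k m i) / be).
    assert (Pk : P k = 1).
    { unfold P; rewrite (rsum_ext n _ (fun i => w i * b i)) by (intros; now rewrite vvec_last).
      fold be; field; exact Hbe. }
    assert (P0 : P 0%nat = 0).
    { unfold P; rewrite rsum_zero; [field; exact Hbe|].
      intros l Hl; rewrite vvec_zero by auto; ring. }
    assert (Hstep : forall m, (m < k)%nat ->
      P m = lam * P (S m) + (a (S m) - rsum n (fun j => K j * vvec n A b a k (S m) j))).
    { intros m Hm; set (c := a (S m) - _).
      assert (E : lam * rsum n (fun i => w i * vvec n A b a k (S m) i) =
                  rsum n (fun i => w i * vvec n A b a k m i) - c * be).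
      { transitivity (rsum n (fun i => w i * mv n (fun i j => A i j + b i * K j)
                                                  (vvec n A b a k (S m)) i)).
        - rewrite (rsum_ext n (fun i => w i * mv _ _ _ _) (fun i => rsum n (fun j =>
            w i * (A i j + b i * K j) * vvec n A b a k (S m) j))).
          + rewrite rsum_exchange, <- rsum_scal_l; apply rsum_ext; intros j Hj.
            rewrite <- Rmult_assoc, <- Hw by trivial.
            rewrite Rmult_comm, <- rsum_scal_l; apply rsum_ext; intros; ring.
          + intros l Hl; unfold mv; rewrite <- rsum_scal_l; apply rsum_ext; intros; ring.
        - rewrite (rsum_ext n _ (fun i => w i * vvec n A b a k m i + - c * (w i * b i))).
          + rewrite rsum_plus, rsum_scal_l; unfold be; ring.
          + intros l Hl; rewrite closed_loop_vvec by trivial; fold c; ring. }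
      unfold P; replace (lam * (rsum n (fun i => w i * vvec n A b a k (S m) i) / be)) with
        (lam * rsum n (fun i => w i * vvec n A b a k (S m) i) / be) by (field; exact Hbe).
      rewrite E; field; exact Hbe. }
    (* Descent from [m = k] to [m = 0], with [d = k - m]. *)
    assert (Hpos : forall d, (d <= k)%nat -> 0 < P (k - d)%nat).
    { induction d as [|d IH]; intros Hd; [rewrite Nat.sub_0_r, Pk; lra|].
      rewrite Hstep by lia; replace (S (k - S d)) with (k - d)%nat by lia.
      specialize (IH ltac:(lia)); specialize (HK (k - d)%nat ltac:(lia)).
      assert (0 <= lam * P (k - d)%nat) by (apply Rmult_le_pos; lra); lra. }
    specialize (Hpos k (Nat.le_refl k)); rewrite Nat.sub_diag, P0 in Hpos; lra.
Qed.

(** The span of [v_1, ..., v_k] contains [b = v_k] and is invariant under [A], because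
    [A v_(m+1) = v_m - a_(m+1) b] with [v_0 = 0]. *)
Lemma vvec_span_krylov (n : nat) (A : nat -> nat -> R) (b a : nat -> R) (k j : nat) :
  (0 < k)%nat ->
  (forall i, (i < n)%nat -> Apow n A k b i = - rsum k (fun l => a (S l) * Apow n A l b i)) ->
  exists d : nat -> R, forall i, (i < n)%nat ->
    Apow n A j b i = rsum k (fun m => d m * vvec n A b a k (S m) i).
Proof.
  intros Hk Hrec; induction j as [|j [d Hd]].
  - exists (fun m => if Nat.eq_dec m (k - 1) then 1 else 0); intros i Hi.
    rewrite (rsum_ext k _ (fun m => vvec n A b a k (S m) i * (if Nat.eq_dec m (k - 1) then 1 else 0)))
      by (intros; ring).
    rewrite (rsum_delta k (k - 1) (fun m => vvec n A b a k (S m) i)) by lia.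
    replace (S (k - 1)) with k by lia; now rewrite vvec_last.
  (* [e k] collects the multiples of [b = v_k] produced by the recursion, and [e 0] is dropped
     together with [v_0 = 0]; hence the shift [e (S m)]. *)
  - set (e := fun m => if Nat.eq_dec m k then - rsum k (fun m => d m * a (S m)) else d m).
    exists (fun m => e (S m)); intros i Hi; simpl.
    rewrite (mv_ext n A _ (fun i => rsum k (fun m => d m * vvec n A b a k (S m) i))) by auto.
    rewrite (mv_linear n A k d (fun m => vvec n A b a k (S m))).
    transitivity (rsum (S k) (fun m => e m * vvec n A b a k m i)).
    + simpl; rewrite vvec_last; unfold e at 2; destruct (Nat.eq_dec k k); [|contradiction].
      rewrite (rsum_ext k (fun l => d l * mv n A _ i)
        (fun l => e l * vvec n A b a k l i + - b i * (d l * a (S l)))).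
      * rewrite rsum_plus, rsum_scal_l; ring.
      * intros l Hl; rewrite (vvec_step n A b a k l i Hl); unfold e.
        destruct (Nat.eq_dec l k); [lia|ring].
    + rewrite rsum_head, vvec_zero by auto; ring.
Qed.

(* [sum_m z^m v_(m+1)] is an eigenvector of the closed loop for every root [z] of the polynomial
   with coefficients [a_m - K v_m]. *)
Lemma closed_loop_coefs_pos (n : nat) (A : nat -> nat -> R) (b a K w : nat -> R) (k : nat) :
  rank_R n n (fun i j => Apow n A j b i) k ->
  (forall i, (i < n)%nat -> Apow n A k b i = - rsum k (fun l => a (S l) * Apow n A l b i)) ->
  (forall i j, (i < n)%nat -> (j < n)%nat -> i <> j -> 0 <= A i j + b i * K j) ->
  (forall i, (i < n)%nat -> 0 < w i) ->
  (forall j, (j < n)%nat -> rsum n (fun i => w i * (A i j + b i * K j)) < 0) ->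
  forall m, (m < k)%nat -> 0 < a (S m) - rsum n (fun j => K j * vvec n A b a k (S m) j).
Proof.
  intros Hrank Hrec HM Hw HwM.
  apply (hurwitz_coefs k (fun m => a (S m) - rsum n (fun j => K j * vvec n A b a k (S m) j))).
  intros z Hre Him.
  destruct (Nat.eq_dec k 0) as [->|Hk0]; [simpl in Hre; lra|].
  set (c := fun m => a (S m) - rsum n (fun j => K j * vvec n A b a k (S m) j)) in *.
  (* [g] stands for the real or the imaginary part of the powers of [z]; its hypothesis is the
     polynomial equation, which absorbs the multiples of [b]. *)
  assert (Heig : forall g : nat -> R,
    g k + rsum k (fun m => c m * g m) = 0 -> forall i, (i < n)%nat ->
    mv n (fun i j => A i j + b i * K j) (fun i => rsum k (fun m => g m * vvec n A b a k (S m) i)) i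
    = rsum k (fun m => g (S m) * vvec n A b a k (S m) i)).
  { intros g Hg i Hi.
    rewrite (mv_linear n _ k g (fun m => vvec n A b a k (S m))).
    transitivity (rsum (S k) (fun m => g m * vvec n A b a k m i)).
    - simpl; rewrite vvec_last.
      rewrite (rsum_ext k (fun l => g l * mv n _ _ i)
        (fun l => g l * vvec n A b a k l i + - b i * (c l * g l))).
      + rewrite rsum_plus, rsum_scal_l; replace (g k) with (- rsum k (fun m => c m * g m)) by lra; ring.
      + intros l Hl; rewrite closed_loop_vvec by trivial; unfold c; ring.
    - rewrite rsum_head, vvec_zero by auto; ring. }
  set (p := fun i => rsum k (fun m => fst (Cpow z m) * vvec n A b a k (S m) i)).
  set (q := fun i => rsum k (fun m => snd (Cpow z m) * vvec n A b a k (S m) i)).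
  (* [v_1] enters [p] with coefficient 1, the real part of [z^0], and the [v_m] are independent, so
     the real part of the eigenvector is already nonzero. *)
  assert (exists j, (j < n)%nat /\ p j <> 0) as [j [Hj Hpj]].
  { apply NNPP; intros Hno.
    assert (Hp0 : forall i, (i < n)%nat -> p i = 0).
    { intros i Hi; apply NNPP; intros Hne; apply Hno; now exists i. }
    assert (fst (Cpow z 0) = 0); [|simpl in *; lra].
    apply (rank_R_spanning_free n n k (fun i j => Apow n A j b i)
             (fun m => vvec n A b a k (S m)) (fun m => fst (Cpow z m))); trivial; [|lia].
    intros l Hl; apply vvec_span_krylov; trivial; lia. }
  apply (left_certificate_right_eigenvalue n (fun i j => A i j + b i * K j) w z p q j); trivial.
  - intros i Hi; unfold p, q; rewrite (Heig (fun m => fst (Cpow z m))) by trivial.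
    rewrite (rsum_ext k _ (fun m => fst z * (fst (Cpow z m) * vvec n A b a k (S m) i) +
      - snd z * (snd (Cpow z m) * vvec n A b a k (S m) i))) by (intros; simpl; ring).
    rewrite rsum_plus, !rsum_scal_l; ring.
  - intros i Hi; unfold p, q; rewrite (Heig (fun m => snd (Cpow z m))) by trivial.
    rewrite (rsum_ext k _ (fun m => fst z * (snd (Cpow z m) * vvec n A b a k (S m) i) +
      snd z * (fst (Cpow z m) * vvec n A b a k (S m) i))) by (intros; simpl; ring).
    rewrite rsum_plus, !rsum_scal_l; ring.
Qed.

Theorem mainTheorem6 (T : R -> Prop) (n : nat) (A : nat -> nat -> R) (b : nat -> R)
  (mub : R) (k : nat) (a : nat -> R) :
  is_time_scale T ->
  unbounded_above T ->
  is_lub (grain_set T) mub ->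
  positive_ctrl T n A b ->
  rank_R n n (fun i j => Apow n A j b i) k ->
  (forall i, (i < n)%nat -> Apow n A k b i = - rsum k (fun l => a (S l) * Apow n A l b i)) ->
  (pos_stabilizable T n A b <->
    ((forall lam, in_spec n A lam -> ~ in_S T lam -> rank_C n (S n) (augm n A b lam) n) /\
     (exists K : nat -> R,
        (forall j, (j < n)%nat -> ge_ext (K j) (alpha n A b mub j)) /\
        (forall m, (1 <= m <= k)%nat -> rsum n (fun j => K j * vvec n A b a k m j) < a m)))).
Proof.
  intros HT Hunb Hlub Hpos Hrank Hrec.
  pose proof (grain_sup_nonneg T mub HT Hlub) as Hmub.
  (* The control 0 gives the conditions on [A], and the control 1 gives [b >= 0]. *)
  destruct (positive_auto_metzler T n A mub HT Hunb Hlub (positive_ctrl_auto T n A b Hpos))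
    as [HAoff HAdiag].
  assert (Hb : forall i, (i < n)%nat -> 0 <= b i).
  { intros i Hi; now apply (positive_ctrl_input T n A b). }
  split.
  - intros [K [HposM Hues]].
    destruct (positive_auto_metzler T n _ mub HT Hunb Hlub HposM) as [HMoff HMdiag].
    (* Stability excludes real eigenvalues [lam >= 0]; the resulting certificate then also excludes
       complex ones with nonnegative real part, as the sign of the coefficients requires. *)
    assert (exists w, (forall i, (i < n)%nat -> 0 < w i) /\
      forall j, (j < n)%nat -> rsum n (fun i => w i * (A i j + b i * K j)) < 0) as [w [Hw HwM]].
    { apply (metzler_left_certificate n (fun i j => A i j + b i * K j)); trivial.
      intros lam w Hlam Hw i Hi; apply NNPP; intros Hwi.
      pose proof (pos_UES_left_eigenvalue_neg T n _ lam w i HT Hunb Hues Hw Hi Hwi); lra. }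
    split; [|exists K; split].
    + intros lam _ HnS; apply NNPP; intros Hrk; apply HnS.
      destruct (augm_left_kernel n A b lam Hrk) as (p & q & j & [Hj Hne [Hp Hq] [Hpb Hqb]]).
      (* The form annihilates [b], so it remains a left eigenvector after feedback. *)
      apply (left_eigenvalue_in_S T n (fun i j => A i j + b i * K j) lam p q j); trivial.
      * intros l Hl; rewrite closed_loop_left, Hp, Hpb by trivial; lra.
      * intros l Hl; rewrite closed_loop_left, Hq, Hqb by trivial; lra.
    + intros j Hj; apply alpha_closed_loop_metzler; auto.
    + intros [|m] Hm; [lia|].
      pose proof (closed_loop_coefs_pos n A b a K w k Hrank Hrec HMoff Hw HwM m ltac:(lia)); lra.
  - intros [Hhautus [K [Halpha HK]]]; exists K.
    assert (HM : forall j, (j < n)%nat ->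
      (forall i, (i < n)%nat -> i <> j -> 0 <= A i j + b i * K j) /\
      0 <= 1 + mub * (A j j + b j * K j)).
    { intros j Hj; apply (alpha_closed_loop_metzler n A b K mub j); auto. }
    assert (HposM : positive_auto T n (fun i j => A i j + b i * K j)).
    { apply (metzler_positive_auto T n _ mub); trivial; [apply HT| |].
      - intros i j Hi Hj; now apply HM.
      - intros j Hj; now apply HM. }
    split; trivial.
    destruct (metzler_left_certificate n (fun i j => A i j + b i * K j)) as [w [Hw HwM]].
    + intros i j Hi Hj; now apply HM.
    + intros lam w Hlam Hw; now apply (closed_loop_no_nonneg_eigenvalue T n A b a K k lam w).
    + now apply (pos_UES_of_left_certificate T n _ w).
Qed.
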